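(* Let $n\ge 2$ and $m\ge 3$ be integers. For every $\mathrm{I}\in\mathfrak{I}_n^m=\mathbb{C}[X_n^m]^{\mathrm{GL}(n,\mathbb{C})}$ there exists $\mathbf{I}\in\mathcal{I}_n^{n(m-2)}$ such that the composition $\mathbf{I}\circ\Phi$ is a regular function on $X_n^m$ and coincides with $\mathrm{I}$. (Here $\mathbf{I}\circ\Phi$ is understood as a rational function on $X_n^m$, so that in particular $\mathbf{I}$ is required to be defined at at least one point of $\Phi(X_n^m)$; it is not required that $\mathbf{I}$ be defined at every point of $\Phi(X_n^m)$.)
   Context: All topological notions refer to the Zariski topology. $\mathcal{Q}_n^m$ is the complex vector space of forms (homogeneous polynomials) of degree $m$ on $\mathbb{C}^n$. The discriminant $\Delta$ satisfies: for a form $Q$ of degree at least $2$, $\Delta(Q)\neq 0$ if and only if the first-order partial derivatives $Q_j:=\partial Q/\partial z_j$, $j=1,\dots,n$, have no common zero in $\mathbb{C}^n\setminus\{0\}$. For $m\ge 3$, $X_n^m:=\{Q\in\mathcal{Q}_n^m:\Delta(Q)\ne 0\}$, an affine variety. Associated form: for $Q\in X_n^m$ let $M(Q):=\mathbb{C}[z_1,\dots,z_n]/J(Q)$, where $J(Q)$ is the ideal generated by $Q_1,\dots,Q_n$ (the Milnor algebra). It is a local Artinian Gorenstein algebra; with $\mathfrak{m}$ its maximal ideal, $\mathrm{Soc}(M(Q)):=\{x\in\mathfrak{m}:x\mathfrak{m}=0\}$ is one-dimensional, equals $\mathfrak{m}^{n(m-2)}$, and is spanned by the element $e_0$ represented by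 the Hessian determinant $\mathrm{Hess}(Q)=\det(\partial^2Q/\partial z_i\partial z_j)$. Let $\omega:\mathrm{Soc}(M(Q))\to\mathbb{C}$ be the linear isomorphism with $\omega(e_0)=1$, and let $e_j$ be the element of $M(Q)$ represented by $z_j$. The associated form of $Q$ is $\mathbf{Q}\in\mathcal{Q}_n^{n(m-2)}$, $\mathbf{Q}(z):=\omega\left((z_1e_1+\dots+z_ne_n)^{n(m-2)}\right)$ for $z=(z_1,\dots,z_n)\in\mathbb{C}^n$. The map $\Phi:X_n^m\to\mathcal{Q}_n^{n(m-2)}$, $Q\mapsto\mathbf{Q}$, is a morphism of affine varieties. Invariants: $\mathrm{GL}(n,\mathbb{C})$ acts on $\mathcal{Q}_n^m$ by $(C,Q)\mapsto Q_C$, $Q_C(z):=Q(z(C^{-1})^T)$, with $z$ a row vector. A relative invariant of forms of degree $m$ on $\mathbb{C}^n$ is a polynomial $I:\mathcal{Q}_n^m\to\mathbb{C}$ for which there is an integer $\ell\ge0$ (the weight) with $I(Q)=(\det C)^{\ell}I(Q_C)$ for all $Q\in\mathcal{Q}_n^m$, $C\in\mathrm{GL}(n,\mathbb{C})$. $\mathcal{I}_n^m$ is the field of absolute invariants: rational functions on $\mathcal{Q}_n^m$ of the form $I/\tilde I$ with $I,\tilde I$ relative invariants of equal weights and $\tilde I\not\equiv0$ (equivalently, the field of $\mathrm{GL}(n,\mathbb{C})$-invariant rational functions on $\mathcal{Q}_n^m$). $\mathfrak{I}_n^m:=\mathbb{C}[X_n^m]^{\mathrm{GL}(n,\mathbb{C})}$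 is the algebra of $\mathrm{GL}(n,\mathbb{C})$-invariant regular functions on $X_n^m$. *)

(* Defs.v *)
From HB Require Import structures.
From mathcomp Require Import all_boot all_order all_algebra.
From mathcomp Require Export boolp classical_sets functions reals.
From mathcomp Require Export ring_quotient fraction complex mpoly.

Set Implicit Arguments.
Unset Strict Implicit.
Unset Printing Implicit Defensive.

Import GRing.Theory.

Local Open Scope classical_set_scope.
Local Open Scope quotient_scope.
Local Open Scope ring_scope.

Notation Qform K n d := (dhomog n K d).

(* Polynomial and rational functions on the space of forms of degree d are
   taken in the coefficients of the form, which are indexed by the monomials
   of degree d in n variables. *)

Definition monom n d := {u : 'X_{1..n < d.+1} | mdeg u == d}.

Definition ncoef n d : nat := #|{: monom n d}|.

Definition coefs (K : fieldType) n d (Q : Qform K n d) (i : 'I_(ncoef n d)) : K :=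
  (Q : {mpoly K[n]})@_(val (enum_val i : monom n d)).

Definition formpoly (K : fieldType) n d := {mpoly K[ncoef n d]}.

Definition evalf (K : fieldType) n d (P : formpoly K n d) (Q : Qform K n d) : K :=
  P.@[coefs Q].

Definition formrat (K : fieldType) n d := {fraction (formpoly K n d)}.

(* r is defined at Q with value c when some representation of r as a quotient
   of two polynomials has a denominator that does not vanish at Q. *)
Definition value_at (K : fieldType) n d (r : formrat K n d) (Q : Qform K n d)
    (c : K) : Prop :=
  exists P S : formpoly K n d,
    [/\ r = tofrac P / tofrac S, evalf S Q != 0 & c = evalf P Q / evalf S Q].

Definition defined_at (K : fieldType) n d (r : formrat K n d) (Q : Qform K n d)
  : Prop := exists c : K, value_at r Q c.

(* Q_A(z) = Q(z (A^-1)^T) for a row vector z. *)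

Definition lin_subst (K : fieldType) n (A : 'M[K]_n) : n.-tuple {mpoly K[n]} :=
  [tuple \sum_j ((invmx A)^T j i) *: 'X_j | i < n].

Lemma comp_dhomog (K : fieldType) n d (p : {mpoly K[n]})
    (lq : n.-tuple {mpoly K[n]}) :
    p \is d.-homog -> (forall i, tnth lq i \is 1%N.-homog) ->
  p \mPo lq \is d.-homog.
Proof.
move=> /dhomogP hp hl; rewrite comp_mpolyE big_seq; apply: rpred_sum => u up.
apply: rpredZ; rewrite -(hp _ up) /= mdegE.
elim/big_rec2: _ => [|i y x _ h]; first exact: dhomog1.
by apply: dhomogM => //; have := dhomogMn (u i) (hl i); rewrite mul1n.
Qed.

Lemma act_subproof (K : fieldType) n d (A : 'M[K]_n) (Q : Qform K n d) :
  (Q : {mpoly K[n]}) \mPo lin_subst A \is d.-homog.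
Proof.
apply: comp_dhomog; first exact/dhomog_is_dhomog.
move=> i; rewrite tnth_mktuple; apply: rpred_sum => j _; apply: rpredZ.
by rewrite dhomogX /= mdeg1.
Qed.

Definition act (K : fieldType) n d (A : 'M[K]_n) (Q : Qform K n d) : Qform K n d :=
  DHomog (act_subproof A Q).

Lemma actE (K : fieldType) n d (A : 'M[K]_n) (Q : Qform K n d) (z : 'rV[K]_n) :
  (act A Q : {mpoly K[n]}).@[fun i => z 0 i] =
  (Q : {mpoly K[n]}).@[fun i => (z *m (invmx A)^T) 0 i].
Proof.
rewrite /= comp_mpoly_meval; apply: meval_eq => i.
rewrite tnth_mktuple mxE raddf_sum; apply: eq_bigr => j _ /=.
by rewrite mevalZ mevalXU mulrC.
Qed.

Definition relative_invariant (K : fieldType) n d (l : nat) (P : formpoly K n d)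
  : Prop :=
  forall (Q : Qform K n d) (A : 'M[K]_n), A \in unitmx ->
    evalf P Q = (\det A) ^+ l * evalf P (act A Q).

Definition absolute_invariant (K : fieldType) n d (r : formrat K n d) : Prop :=
  exists (l : nat) (P S : formpoly K n d),
    [/\ relative_invariant l P, relative_invariant l S, S != 0
      & r = tofrac P / tofrac S].

(* The locus of nonvanishing discriminant: the discriminant of a form of
   degree at least 2 vanishes exactly when the first partial derivatives have
   a common zero other than the origin. *)
Definition nondegenerate (K : fieldType) n d : set (Qform K n d) :=
  [set Q | forall z : 'I_n -> K,
     (forall j, ((Q : {mpoly K[n]})^`M(j)).@[z] = 0) -> forall j, z j = 0].

(* Regular functions on the variety of nondegenerate forms are represented by
   functions on all forms, whose values elsewhere are irrelevant.  Regularity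
   is the usual one: to be locally a quotient of polynomials. *)
Definition regular_function (K : fieldType) n d (f : Qform K n d -> K) : Prop :=
  forall Q0, nondegenerate Q0 -> exists P S : formpoly K n d,
    evalf S Q0 != 0 /\
    forall Q, nondegenerate Q -> evalf S Q != 0 -> f Q = evalf P Q / evalf S Q.

Definition GL_invariant (K : fieldType) n d (f : Qform K n d -> K) : Prop :=
  forall (A : 'M[K]_n) Q, A \in unitmx -> nondegenerate Q -> f (act A Q) = f Q.

Definition jacobian_ideal (K : fieldType) n m (m_ge3 : (3 <= m)%N)
    (Q : Qform K n m) : {pred {mpoly K[n]}} :=
  fun p => `[< exists h : 'I_n -> {mpoly K[n]},
                 p = \sum_j h j * (Q : {mpoly K[n]})^`M(j) >].

(* m >= 3 is what makes the ideal proper. *)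
Lemma jacobian_ideal_closed (K : fieldType) n m (m_ge3 : (3 <= m)%N)
    (Q : Qform K n m) : idealr_closed (jacobian_ideal m_ge3 Q).
Proof.
split.
- by apply/asboolP; exists (fun=> 0); rewrite big1 // => j _; rewrite mul0r.
- apply/negP => /asboolP[h /(congr1 (fun p : {mpoly K[n]} => p@_0%MM))] /eqP.
  rewrite mcoeff1 eqxx raddf_sum big1 ?oner_eq0 //= => j _.
  rewrite rmorphM /= mcoeff_deriv.
  rewrite (dhomog_nemf_coeff (dhomog_is_dhomog Q)) ?mul0rn ?mulr0 //=.
  by rewrite mdegD mdeg0 mdeg1; case: m m_ge3 {Q h} => [|[|]].
- move=> a p q /asboolP[h ->] /asboolP[k ->]; apply/asboolP.
  exists (fun j => a * h j + k j); rewrite mulr_sumr -big_split /=.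
  by apply: eq_bigr => j _; rewrite mulrDl mulrA.
Qed.

HB.instance Definition _ (K : fieldType) n m (m_ge3 : (3 <= m)%N)
    (Q : Qform K n m) :=
  isIdealr.Build {mpoly K[n]} (jacobian_ideal m_ge3 Q)
    (jacobian_ideal_closed m_ge3 Q).

Definition milnor_algebra (K : fieldType) n m (m_ge3 : (3 <= m)%N)
    (Q : Qform K n m) : comNzRingType := {ideal_quot (jacobian_ideal m_ge3 Q)}.

Definition milnor_class (K : fieldType) n m (m_ge3 : (3 <= m)%N)
    (Q : Qform K n m) (p : {mpoly K[n]}) : milnor_algebra m_ge3 Q :=
  \pi_({ideal_quot (jacobian_ideal m_ge3 Q)}) p.

(* The maximal ideal of a local ring is its set of nonunits. *)
Definition max_ideal (M : comNzRingType) : set M :=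
  [set x | ~ exists y, y * x = 1].

Definition socle (M : comNzRingType) : set M :=
  [set x | max_ideal x /\ forall y, max_ideal y -> x * y = 0].

Definition hessian (K : fieldType) n m (Q : Qform K n m) : {mpoly K[n]} :=
  \det (\matrix_(i < n, j < n) (Q : {mpoly K[n]})^`M(i)^`M(j)).

(* The restriction of w to the socle is the K-linear isomorphism onto K sending
   the class of the Hessian to 1; K acts through the constant polynomials, and
   the values of w off the socle are irrelevant. *)
Definition socle_iso (K : fieldType) n m (m_ge3 : (3 <= m)%N) (Q : Qform K n m)
    (w : milnor_algebra m_ge3 Q -> K) : Prop :=
  [/\ forall (a : K) x y, socle x -> socle y ->
        w (milnor_class m_ge3 Q a%:MP * x + y) = a * w x + w y,
      set_bij (@socle (milnor_algebra m_ge3 Q)) setT w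
    & w (milnor_class m_ge3 Q (hessian Q)) = 1].

Definition is_associated_form (K : fieldType) n m (m_ge3 : (3 <= m)%N)
    (Q : Qform K n m) (B : Qform K n (n * (m - 2))) : Prop :=
  exists2 w : milnor_algebra m_ge3 Q -> K, socle_iso w &
    forall z : 'I_n -> K, (B : {mpoly K[n]}).@[z] =
      w ((\sum_j milnor_class m_ge3 Q (z j)%:MP * milnor_class m_ge3 Q 'X_j)
           ^+ (n * (m - 2))).

Definition Phi (K : fieldType) n m (m_ge3 : (3 <= m)%N) (Q : Qform K n m)
  : Qform K n (n * (m - 2)) := xget 0 [set B | is_associated_form m_ge3 Q B].

(* The rational function obtained by composing r with Phi makes sense on the
   nondegenerate forms, and coincides with f there.  The nondegenerate forms
   are an irreducible variety, so the nonempty open set of those Q for which r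
   is defined at Phi Q is dense. *)
Definition comp_Phi_coincides (K : fieldType) n m (m_ge3 : (3 <= m)%N)
    (r : formrat K n (n * (m - 2))) (f : Qform K n m -> K) : Prop :=
  (exists2 Q, nondegenerate Q & defined_at r (Phi m_ge3 Q)) /\
  forall Q c, nondegenerate Q -> value_at r (Phi m_ge3 Q) c -> f Q = c.

(* Main.v *)
(* Put N = n(m - 2) and let J(Q) be the Jacobian ideal.  The form B = Phi(Q) is the inverse
   system of J(Q): a form p of degree N lies in J(Q) if and only if p is apolar to B.  Let Q1 be
   a nondegenerate form such that every form of degree m whose partial derivatives lie in J(Q1)
   is a multiple of Q1.  Then, for B close to Phi(Q1), the annihilator of B determines Q up to a
   factor by linear algebra, so there are polynomials p and s with s(Phi(Q1)) <> 0 and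
   p = f s on the GL_n-orbits of all Phi(Q).

   The denominators s of this kind form a GL_n-stable ideal I, and I contains some s with
   s(u B1) = 1 for all u in SL_n, where B1 = Phi(Q1).  Otherwise some place of the function
   field of SL_n is finite on the coordinates of the generic point u B1 of the orbit and kills I.
   By the Smith normal form over the valuation ring one may replace u by diag(d_1, ..., d_n) with
   d_1 | ... | d_n.  Finiteness says that d^a has nonnegative valuation for every monomial z^a of
   degree N outside J(Q1), and enough such monomials exist to force all d_i / d_1 to be units.
   Hence u specializes to an invertible matrix and I vanishes at B1, which is absurd.

   Pairing u |-> s(u B) and u |-> p(u B) with a power of det u, as the Reynolds operator does,
   turns s and p into relative invariants S and P with P(Phi(Q)) = f(Q) S(Phi(Q)).

   There is no Q1 as above for (n, m) = (2, 3), but the nondegenerate binary cubics form a single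
   orbit, so f is constant. *)

(* The difficulty is that [f] is known as a fraction near one point only, and averaging its
   denominator over the group may give zero. Geometric invariant theory would exclude this by
   showing that the SL_n-orbit of Phi(Q1) is closed; the place replaces the Hilbert-Mumford
   criterion. Its residue field is not C, so duality for Jacobian ideals is developed over fields of
   characteristic 0, and Q1 has integer coefficients.

   The monomials that control the elementary divisors come from a degree count. Modulo the first i
   variables, n - i combinations of the partial derivatives form a complete intersection of socle
   degree (n - i)(m - 2), so a monomial of degree N outside J(Q1) can be traded for one of degree at
   least i(m - 2) in the first i variables. If the inequality were never strict, the Milnor algebra
   would behave like a tensor product and Q1 would split into forms in complementary sets of
   variables, which the property of Q1 forbids.

   S may vanish at some Phi(Q) where another fraction for the same rational function is defined;
   there the equality with f comes from the irreducibility of the nondegenerate locus. *)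
Require Import Defs.
From HB Require Import structures.
From mathcomp Require Import all_boot all_order all_algebra.
From mathcomp Require Import zify perm ring.
From mathcomp.multinomials Require Import ssrcomplements.

Set Implicit Arguments.
Unset Strict Implicit.
Unset Printing Implicit Defensive.

Import Order.TTheory GRing.Theory Num.Theory.
Local Open Scope ring_scope.

(** * Ideals, apolarity and linear substitutions *)

Lemma mpoly_ring_ind n (R : comNzRingType) (P : {mpoly R[n]} -> Prop) :
    (forall c, P c%:MP) -> (forall i, P 'X_i) ->
    (forall p q, P p -> P q -> P (p + q)) ->
    (forall p q, P p -> P q -> P (p * q)) -> forall p, P p.
Proof.
move=> PC PX PD PM p; rewrite (mpolyE p).
elim/big_rec: _ => [|m q _ Pq]; first by rewrite -mpolyC0; exact: PC.
apply: PD => //; rewrite -mul_mpolyC; apply: (PM) => //.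
rewrite mpolyXE_id; elim/big_rec: _ => [|i r _ Pr]; first exact: PC 1.
by apply: (PM) => //; elim: (m i) => [|k IHk]; [exact: PC 1 | rewrite exprS; exact: (PM)].
Qed.

Section Ideals.

Definition gideal (R : comNzRingType) (I : finType) (g : I -> R) (p : R) : Prop :=
  exists h : I -> R, p = \sum_i h i * g i.

Variables (R : comNzRingType) (I : finType) (g : I -> R).
Implicit Types p q : R.

Lemma gideal0 : gideal g 0.
Proof. by exists (fun=> 0); rewrite big1 // => i _; rewrite mul0r. Qed.

Lemma gidealD p q : gideal g p -> gideal g q -> gideal g (p + q).
Proof.
move=> [h ->] [k ->]; exists (fun i => h i + k i); rewrite -big_split /=.
by apply: eq_bigr => i _; rewrite mulrDl.
Qed.

Lemma gidealMl q p : gideal g p -> gideal g (q * p).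
Proof.
move=> [h ->]; exists (fun i => q * h i); rewrite mulr_sumr.
by apply: eq_bigr => i _; rewrite mulrA.
Qed.

Lemma gidealMr q p : gideal g p -> gideal g (p * q).
Proof. by rewrite mulrC; exact: gidealMl. Qed.

Lemma gidealN p : gideal g p -> gideal g (- p).
Proof. by rewrite -mulN1r; exact: gidealMl. Qed.

Lemma gidealB p q : gideal g p -> gideal g q -> gideal g (p - q).
Proof. by move=> gp gq; apply: gidealD => //; exact: gidealN. Qed.

Lemma gideal_gen i : gideal g (g i).
Proof.
exists (fun j => (j == i)%:R); rewrite (bigD1 i) //= eqxx mul1r big1 ?addr0 //.
by move=> j /negPf ->; rewrite mul0r.
Qed.

Lemma gideal_sum (J : Type) (r : seq J) (P : pred J) (F : J -> R) :
  (forall j, P j -> gideal g (F j)) -> gideal g (\sum_(j <- r | P j) F j).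
Proof. by move=> gF; elim/big_ind: _ => //; [exact: gideal0 | exact: gidealD]. Qed.

End Ideals.

Lemma gideal_trans (R : comNzRingType) (I J : finType) (g : I -> R) (k : J -> R) p :
  (forall i, gideal k (g i)) -> gideal g p -> gideal k p.
Proof. by move=> kg [h ->]; apply: gideal_sum => i _; exact: gidealMl. Qed.

Lemma gideal_rmorph (R S : comNzRingType) (I : finType) (g : I -> R) p
    (phi : {rmorphism R -> S}) : gideal g p -> gideal (phi \o g) (phi p).
Proof.
move=> [h ->]; exists (phi \o h); rewrite rmorph_sum.
by apply: eq_bigr => i _; rewrite rmorphM.
Qed.

Section Homogeneous.
Variables (n : nat) (R : comNzRingType).
Implicit Types (p q : {mpoly R[n]}) (d e : nat).

Lemma mcoeff_pihomog d p m :
  (pihomog mdeg d p)@_m = if mdeg m == d then p@_m else 0.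
Proof.
rewrite [in RHS](mpolyE p) [in LHS](mpolyE p) [pihomog _ _ _]linear_sum.
rewrite !raddf_sum /=; case: ifP => md; last first.
  rewrite big1 // => u _; rewrite linearZ /= pihomogX mcoeffZ.
  case: ifP => ud; last by rewrite mcoeff0 mulr0.
  rewrite mcoeffX; case: eqP => [um|]; last by rewrite mulr0.
  by rewrite -um ud in md.
apply: eq_bigr => u _; rewrite linearZ /= pihomogX !mcoeffZ mcoeffX.
case: ifP => ud; first by rewrite mcoeffX.
by rewrite mcoeff0; case: eqP => [um|] //; rewrite um md in ud.
Qed.

Lemma homogP_coeff d p :
  reflect (forall m, mdeg m != d -> p@_m = 0) (p \is d.-homog).
Proof.
apply: (iffP idP) => [hp m|hp]; first exact: dhomog_nemf_coeff.
apply/dhomogP => m; rewrite mcoeff_msupp; apply: contraNeq => md.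
by rewrite hp ?eqxx.
Qed.

Lemma pihomogMr d e p q : q \is d.-homog ->
  pihomog mdeg e (p * q) =
  if (d <= e)%N then pihomog mdeg (e - d) p * q else 0.
Proof.
move=> hq; rewrite [in LHS](mpolyE p) [in RHS](mpolyE p) mulr_suml !raddf_sum /=.
rewrite mulr_suml; case: ifP => de; last first.
  rewrite big1 // => m _; rewrite -scalerAl linearZ /=.
  have hmq : 'X_[m] * q \is (mdeg m + d)%N.-homog.
    by apply: dhomogM => //; rewrite dhomogX /=.
  rewrite (pihomog_ne0 _ hmq) ?scaler0 //.
  by apply: contraFN de => /eqP <-; rewrite leq_addl.
apply: eq_bigr => m _; rewrite -!scalerAl !linearZ /= -scalerAl; congr (_ *: _).
have hmq : 'X_[m] * q \is (mdeg m + d)%N.-homog.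
  by apply: dhomogM => //; rewrite dhomogX /=.
rewrite pihomogX /=; case: eqP => [md|/eqP md].
  by apply: pihomog_dE; rewrite -(subnK de) -md.
rewrite mul0r (pihomog_ne0 _ hmq) //; apply: contraNneq md => <-.
by rewrite addnK.
Qed.

Lemma gideal_pihomog (I : finType) (g : I -> {mpoly R[n]}) (d : I -> nat) e p :
  (forall i, g i \is (d i).-homog) -> gideal g p -> gideal g (pihomog mdeg e p).
Proof.
move=> hg [h ->]; rewrite raddf_sum /=; apply: gideal_sum => i _.
rewrite (pihomogMr _ _ (hg i)); case: ifP => _; last exact: gideal0.
by apply: gidealMl; exact: gideal_gen.
Qed.

(** Each multiplier is cut down to its component of the right degree. As [e - d i] is truncated, the
    second clause records that generators of degree above [e] do not contribute. *)
Lemma gideal_homogE (I : finType) (g : I -> {mpoly R[n]}) (d : I -> nat) e p :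
  (forall i, g i \is (d i).-homog) -> p \is e.-homog -> gideal g p ->
  exists2 h : I -> {mpoly R[n]}, p = \sum_i h i * g i
    & forall i, h i \is (e - d i)%N.-homog /\ ((e < d i)%N -> h i = 0).
Proof.
move=> hg hp [h ph]; exists (fun i => if (d i <= e)%N then pihomog mdeg (e - d i) (h i) else 0).
  rewrite -[LHS](pihomog_dE hp) ph raddf_sum /=; apply: eq_bigr => i _.
  by rewrite (pihomogMr _ _ (hg i)); case: ifP => //; rewrite mul0r.
move=> i; case: leqP => _; first by split=> //; exact: pihomogP.
by split=> //; exact: dhomog0.
Qed.

Lemma homog_deriv d p j : p \is d.-homog -> p^`M(j) \is d.-1.-homog.
Proof.
move=> /homogP_coeff hp; apply/homogP_coeff => m md.
rewrite mcoeff_deriv hp ?mul0rn // mdegD mdeg1 addn1.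
by apply: contraNneq md => <-.
Qed.

Lemma euler d p : p \is d.-homog -> \sum_j 'X_j * p^`M(j) = d%:R *: p.
Proof.
move=> hp; rewrite [in RHS](mpolyE p) scaler_sumr [in LHS](mpolyE p).
under eq_bigr => j _ do rewrite raddf_sum mulr_sumr /=.
rewrite exchange_big big_seq [RHS]big_seq /=; apply: eq_bigr => m mp.
rewrite -((dhomogP _ _ _ hp) m mp) /= mdegE natr_sum scaler_suml.
apply: eq_bigr => j _; rewrite linearZ /= mderivX mulrC -scalerAl.
rewrite -scalerAl -mpolyXD scalerA mulrC -scalerA.
case: (posnP (m j)) => [->|mj]; first by rewrite !scale0r.
congr (_ *: (_ *: 'X_[_])); apply/mnmP => i; rewrite mnmDE mnmBE mnm1E.
by case: eqP => [<-|_]; rewrite ?subnK // subn0 addn0.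
Qed.

End Homogeneous.

Section Apolar.
Variables (n : nat) (R : comNzRingType).
Implicit Types (p q : {mpoly R[n]}) (c : 'X_{1..n} -> R).

Definition lfunc c p : R := \sum_(m <- msupp p) p@_m * c m.

Lemma lfuncwE k c p : (msize p <= k)%N ->
  lfunc c p = \sum_(m : 'X_{1..n < k}) p@_m * c m.
Proof.
move=> pk; pose I : subFinType _ := 'X_{1..n < k}.
rewrite /lfunc (big_mksub I) /=; first last.
- by move=> m /msize_mdeg_lt /leq_trans; exact.
- exact: msupp_uniq.
rewrite [RHS](bigID (fun m : 'X_{1..n < k} => val m \in msupp p)) /=.
by rewrite [X in _ + X]big1 ?addr0 // => m /memN_msupp_eq0 ->; rewrite mul0r.
Qed.

Lemma lfunc_is_linear c : linear_for *%R (lfunc c).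
Proof.
move=> a p q; set k := maxn (msize p) (msize q).
rewrite !(@lfuncwE k) ?leq_maxl ?leq_maxr //; last first.
  apply: leq_trans (msizeD_le _ _) _; rewrite geq_max leq_maxr andbT.
  by apply: leq_trans (msizeZ_le _ _) (leq_maxl _ _).
rewrite mulr_sumr -big_split /=; apply: eq_bigr => m _.
by rewrite mcoeffD mcoeffZ mulrDl mulrA.
Qed.

HB.instance Definition _ c :=
  GRing.isLinear.Build R {mpoly R[n]} R *%R (lfunc c) (lfunc_is_linear c).

Lemma lfuncX c m : lfunc c 'X_[m] = c m.
Proof. by rewrite /lfunc msuppX big_seq1 mcoeffX eqxx mul1r. Qed.

Definition mfact (m : 'X_{1..n}) : nat := \prod_i (m i)`!.

(** This is p(d/dz) q at the origin. The factorials make multiplication by a variable adjoint to the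
    derivation, and a substitution adjoint to the transposed one. *)
Definition apolar p q : R := lfunc (fun m => q@_m *+ mfact m) p.

Lemma apolarX m q : apolar 'X_[m] q = q@_m *+ mfact m.
Proof. exact: lfuncX. Qed.

Lemma apolar_suml (I : Type) (r : seq I) (P : pred I) F q :
  apolar (\sum_(i <- r | P i) F i) q = \sum_(i <- r | P i) apolar (F i) q.
Proof. exact: (raddf_sum (lfunc _)). Qed.

Lemma apolarZl a p q : apolar (a *: p) q = a * apolar p q.
Proof. exact: (linearZ_LR (lfunc _)). Qed.

Lemma apolarDl p p' q : apolar (p + p') q = apolar p q + apolar p' q.
Proof. exact: (raddfD (lfunc _)). Qed.

Lemma apolar_is_linear p : linear_for *%R (apolar p).
Proof.
move=> a q r; rewrite /apolar /lfunc mulr_sumr -big_split /=.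
apply: eq_bigr => m _; rewrite mcoeffD mcoeffZ mulrnDl mulrDr.
by rewrite -mulrnAr mulrCA.
Qed.

HB.instance Definition _ p := GRing.isLinear.Build R {mpoly R[n]} R *%R
  (apolar p) (apolar_is_linear p).

Lemma mfactD1 (m : 'X_{1..n}) i : mfact (m + U_(i)) = ((m i).+1 * mfact m)%N.
Proof.
rewrite /mfact (bigD1 i) //= [in RHS](bigD1 i) //= mnmDE mnm1E eqxx addn1 factS mulnA.
congr (_ * _)%N; apply: eq_bigr => j ji.
by rewrite mnmDE mnm1E eq_sym (negPf ji) addn0.
Qed.

Lemma apolarXU i p q : apolar ('X_i * p) q = apolar p q^`M(i).
Proof.
rewrite (mpolyE p) mulr_sumr !apolar_suml /=; apply: eq_bigr => m _.
rewrite -scalerAr -mpolyXD addmC !apolarZl !apolarX mcoeff_deriv.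
by rewrite mfactD1 -mulrnA.
Qed.

Lemma apolar1 q : apolar 1 q = q@_0.
Proof.
by rewrite -mpolyX0 apolarX /mfact big1 // => i _; rewrite mnm0E.
Qed.

End Apolar.

Section Substitution.
Variables (n : nat) (R : comNzRingType).
Implicit Types (p q : {mpoly R[n]}) (M : 'M[R]_n).

Definition sub M : {mpoly R[n]} -> {mpoly R[n]} :=
  comp_mpoly [tuple \sum_j M i j *: 'X_j | i < n].

HB.instance Definition _ M := GRing.RMorphism.on (sub M).
HB.instance Definition _ M := GRing.Linear.on (sub M).

Lemma subC M c : sub M c%:MP = c%:MP.
Proof. exact: comp_mpolyC. Qed.

Lemma subX M i : sub M 'X_i = \sum_j M i j *: 'X_j.
Proof. by rewrite /sub comp_mpolyXU -tnth_nth tnth_mktuple. Qed.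

Lemma sub_sub M1 M2 p : sub M2 (sub M1 p) = sub (M1 *m M2) p.
Proof.
elim/mpoly_ring_ind: p => [c|i|p q IHp IHq|p q IHp IHq].
- by rewrite !subC.
- rewrite !subX raddf_sum /=.
  under eq_bigr => j _ do rewrite linearZ /= subX scaler_sumr.
  rewrite exchange_big /=; apply: eq_bigr => k _; rewrite mxE scaler_suml.
  by apply: eq_bigr => j _; rewrite scalerA.
- by rewrite !rmorphD /= IHp IHq.
- by rewrite !rmorphM /= IHp IHq.
Qed.

Lemma sub1 p : sub 1%:M p = p.
Proof.
elim/mpoly_ring_ind: p => [c|i|p q IHp IHq|p q IHp IHq].
- by rewrite subC.
- rewrite subX (bigD1 i) //= mxE eqxx scale1r big1 ?addr0 // => j ji.
  by rewrite mxE eq_sym (negPf ji) scale0r.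
- by rewrite rmorphD /= IHp IHq.
- by rewrite rmorphM /= IHp IHq.
Qed.

Lemma sub_meval M p v : (sub M p).@[v] = p.@[fun i => \sum_j M i j * v j].
Proof.
rewrite /sub comp_mpoly_meval; apply: meval_eq => i.
rewrite tnth_mktuple raddf_sum /=; apply: eq_bigr => j _.
by rewrite mevalZ mevalXU.
Qed.

Lemma sub_deriv M p j : (sub M p)^`M(j) = \sum_i M i j *: sub M p^`M(i).
Proof.
elim/mpoly_ring_ind: p => [c|i|p q IHp IHq|p q IHp IHq].
- by rewrite subC mderivC big1 // => i _; rewrite mderivC raddf0 scaler0.
- rewrite subX raddf_sum /= (bigD1 j) //= linearZ /= mderivX mnm1E eqxx.
  have -> : (U_(j) - U_(j) = 0 :> 'X_{1..n})%MM.
    by apply/mnmP => k; rewrite mnmBE subnn mnm0E.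
  rewrite mpolyX0 scale1r big1 ?addr0; last first.
    by move=> k kj; rewrite linearZ /= mderivX mnm1E (negPf kj) scale0r scaler0.
  rewrite (bigD1 i) //= mderivX mnm1E eqxx.
  have -> : (U_(i) - U_(i) = 0 :> 'X_{1..n})%MM.
    by apply/mnmP => k; rewrite mnmBE subnn mnm0E.
  rewrite mpolyX0 scale1r rmorph1 big1 ?addr0 // => k ki.
  by rewrite mderivX mnm1E eq_sym (negPf ki) scale0r raddf0 scaler0.
- rewrite rmorphD /= mderivD IHp IHq -big_split /=; apply: eq_bigr => i _.
  by rewrite mderivD rmorphD scalerDr.
- rewrite rmorphM /= mderivM IHp IHq mulr_suml mulr_sumr -big_split /=.
  apply: eq_bigr => i _; rewrite mderivM rmorphD !rmorphM /= scalerDr.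
  by rewrite -scalerAl -scalerAr.
Qed.

Lemma sub_homog d M p : p \is d.-homog -> sub M p \is d.-homog.
Proof.
move=> hp; rewrite (mpolyE p) raddf_sum /= big_seq; apply: rpred_sum => m mp.
rewrite linearZ /=; apply: rpredZ; rewrite -(dhomogP _ _ _ hp _ mp) /=.
rewrite mpolyXE_id rmorph_prod mdegE /=.
elim/big_rec2: _ => [|i y x _ h]; first exact: dhomog1.
apply: dhomogM => //; rewrite rmorphXn /= -[X in X.-homog]mul1n.
apply: dhomogMn; rewrite subX; apply: rpred_sum => j _; apply: rpredZ.
by rewrite dhomogX /= mdeg1.
Qed.

Lemma mevalz p : p.@[fun=> 0] = p@_0.
Proof.
elim/mpoly_ring_ind: p => [c|i|p q IHp IHq|p q IHp IHq].
- by rewrite mevalC mcoeffC eqxx mulr1.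
- by rewrite mevalXU mcoeffX mnm1_eq0.
- by rewrite mevalD IHp IHq mcoeffD.
- by rewrite mevalM IHp IHq rmorphM.
Qed.

(** Peeling one variable off a monomial turns it into a derivation of the other argument, where the
    chain rule produces the transposed matrix. *)
Lemma apolar_sub M p q : apolar (sub M^T p) q = apolar p (sub M q).
Proof.
suff apX k m r : mdeg m = k -> apolar (sub M^T 'X_[m]) r = apolar 'X_[m] (sub M r).
  rewrite (mpolyE p) [sub _ _]raddf_sum /= !apolar_suml.
  by apply: eq_bigr => m _; rewrite [sub _ _]linearZ /= !apolarZl (apX (mdeg m)).
elim: k m r => [|k IHk] m r.
  move/eqP; rewrite mdeg_eq0 => /eqP ->; rewrite mpolyX0 rmorph1 !apolar1 -!mevalz.
  rewrite sub_meval; apply: meval_eq => i; rewrite big1 // => j _.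
  by rewrite mulr0.
move=> mk; have [i mi] : exists i, m i != 0%N.
  apply/existsP; rewrite -negb_forall; apply/negP => /forallP m0; move: mk.
  by rewrite mdegE big1 // => i _; apply/eqP.
have -> : m = (U_(i) + (m - U_(i)))%MM by rewrite addmC submK // lep1mP.
have mk' : mdeg (m - U_(i)) = k.
  apply/eqP; rewrite -eqSS -mk -[X in _ == mdeg X](submK (m' := m) (m := U_(i))).
    by rewrite mdegD mdeg1 addn1.
  by rewrite lep1mP.
rewrite mpolyXD rmorphM /= subX mulr_suml apolar_suml apolarXU sub_deriv.
rewrite [RHS]linear_sum; apply: eq_bigr => j _ /=.
by rewrite -scalerAl apolarZl apolarXU mxE IHk // [RHS]linearZ.
Qed.

End Substitution.

(** * Complete intersections and their socles *)

Lemma mcoeffXM n (R : comNzRingType) (u m : 'X_{1..n}) (p : {mpoly R[n]}) :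
  ('X_[u] * p)@_m = if (u <= m)%MM then p@_(m - u) else 0.
Proof.
rewrite mulrC; case: ifP => um; first by rewrite -{1}(submK um) addmC mcoeffMX.
rewrite (mpolyE p) mulr_suml raddf_sum big1 // => k _ /=.
rewrite -scalerAl -mpolyXD mcoeffZ mcoeffX; case: eqP => [km|]; last by rewrite mulr0.
by rewrite -km lem_addl in um.
Qed.

Lemma det_homog n (R : comNzRingType) k (A : 'M[{mpoly R[n]}]_k) (c : 'I_k -> nat) :
  (forall i j, A i j \is (c j).-homog) -> \det A \is (\sum_j c j)%N.-homog.
Proof.
move=> hA; apply: rpred_sum => s _; rewrite -signr_odd mulr_sign.
have h : \prod_i A i (s i) \is (\sum_j c j)%N.-homog.
  rewrite [X in X.-homog](reindex_inj (@perm_inj _ s)) /=.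
  by elim/big_rec2: _ => [|i y x _ hx]; [exact: dhomog1 | exact: dhomogM].
by case: ifP => _ //; rewrite rpredN.
Qed.

Lemma det_adj_row (R : comNzRingType) n (c : 'M[R]_n) (v : 'I_n -> R) i :
  \det c * v i = \sum_k \adj c i k * (\sum_j c k j * v j).
Proof.
have /matrixP/(_ i 0) := mulmxA (\adj c) c (\col_j v j).
rewrite mul_adj_mx mul_scalar_mx !mxE => <-.
by apply: eq_bigr => k _; rewrite !mxE; congr (_ * _); apply: eq_bigr => j _; rewrite !mxE.
Qed.

(** [inx] and [iny] are the two copies of the polynomial ring inside the ring in doubled variables:
    x sits in the coefficients, y in the outer variables. The lock stops conversion from mixing the
    two layers. *)
HB.lock Definition inx n (R : comNzRingType) (p : {mpoly R[n]}) :
  {mpoly {mpoly R[n]}[n]} := p%:MP.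
Canonical inx_unlockable := Unlockable inx.unlock.
HB.lock Definition iny n (R : comNzRingType) (p : {mpoly R[n]}) :
  {mpoly {mpoly R[n]}[n]} := map_mpoly (@mpolyC n R) p.
Canonical iny_unlockable := Unlockable iny.unlock.

(** * Grothendieck residues of n forms in n variables *)

Section SquareSystem.
Variables (n : nat) (R : comNzRingType).
Local Notation S := {mpoly R[n]}.
Implicit Types (p q h : S).

Section TopCoefficient.
Variables (e : nat) (e_gt0 : (0 < e)%N).

(** The monomial spanning the socle modulo the powers ['X_i ^+ e]. *)
Definition topm : 'X_{1..n} := [multinom e.-1 | i < n].

Lemma topm_coeff (f : 'I_n -> S) (m : 'X_{1..n}) (P : pred 'I_n) :
    (forall k, P k -> (m k < e)%N) ->
  (\sum_(k | P k) f k * 'X_k ^+ e)@_m = 0.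
Proof.
move=> mP; rewrite raddf_sum big1 // => k Pk; rewrite /= mulrC mpolyXn mcoeffXM.
case: ifP => // /mnm_lepP/(_ k); rewrite mulmnE mnm1E eqxx mul1n => em.
by have := leq_trans (mP _ Pk) em; rewrite ltnn.
Qed.

(** By Cramer's rule [\det c * 'X_i] is a combination of the powers ['X_k ^+ e] with k distinct from
    i, and none of these divides ['X_i] times the top monomial. *)
Lemma det_row_kill (c : 'M[S]_n) i :
    (forall k, k != i -> \sum_j c k j * 'X_j = 'X_k ^+ e) ->
    \sum_j c i j * 'X_j = 0 -> (\det c)@_topm = 0.
Proof.
move=> ck ci; rewrite -(mcoeffMX _ U_(i)%MM) (det_adj_row c (fun j => 'X_j)).
rewrite (bigD1 i) //= ci mulr0 add0r.
under eq_bigr => k ki do rewrite ck //.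
apply: topm_coeff => k ki.
by rewrite mnmDE mnm1E eq_sym (negPf ki) add0n mnmE prednK.
Qed.

(** The rows of [c'] are exchanged for those of [c] one at a time. Each exchange adds a determinant
    in which the exchanged row is a difference that kills the vector of variables. *)
Lemma det_top_unique (c c' : 'M[S]_n) :
    (forall k, \sum_j c k j * 'X_j = 'X_k ^+ e) ->
    (forall k, \sum_j c' k j * 'X_j = 'X_k ^+ e) ->
  (\det c)@_topm = (\det c')@_topm.
Proof.
move=> hc hc'; pose M t : 'M[S]_n := \matrix_(i, j) if (i < t)%N then c i j else c' i j.
have -> : c = M n by apply/matrixP => i j; rewrite mxE ltn_ord.
have -> : c' = M 0%N by apply/matrixP => i j; rewrite mxE.
suff H t : (t <= n)%N -> (\det (M t))@_topm = (\det (M 0%N))@_topm by exact: H.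
elim: t => [|t IHt] tn; first by [].
rewrite -(IHt (ltnW tn)); pose i := Ordinal tn.
pose D : 'M[S]_n := \matrix_(k, j) if k == i then c k j - c' k j else M t k j.
have MtE k j : k != i -> M t.+1 k j = M t k j.
  move=> ki; rewrite !mxE ltnS leq_eqVlt.
  by case: eqP => // kt; case/negP: ki; apply/eqP/val_inj.
rewrite (@determinant_multilinear _ _ _ (M t) D i 1 1) ?mul1r.
- rewrite mcoeffD [X in _ + X](@det_row_kill _ i); first exact: addr0.
    move=> k ki; under eq_bigr => j _ do rewrite mxE (negPf ki) mxE.
    by case: (k < t)%N.
  under eq_bigr => j _ do rewrite mxE eqxx mulrBl.
  by rewrite sumrB hc hc' subrr.
- apply/rowP => j; rewrite !scale1r !mxE eqxx /= ltnn ltnSn.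
  by rewrite addrC subrK.
- apply/matrixP => k j; rewrite !mxE.
  by have := MtE (lift i k) j; rewrite eq_sym neq_lift !mxE => ->.
- apply/matrixP => k j; rewrite !mxE.
  have := MtE (lift i k) j; rewrite !mxE eq_sym neq_lift => -> //.
  by case: eqP (neq_lift i k) => // <-; rewrite eqxx.
Qed.

(** The comparison is with the diagonal matrix of the ['X_k ^+ e.-1], whose determinant is the top
    monomial. *)
Lemma det_top1 (c : 'M[S]_n) :
  (forall k, \sum_j c k j * 'X_j = 'X_k ^+ e) -> (\det c)@_topm = 1.
Proof.
move=> hc; rewrite (@det_top_unique _ (diag_mx (\row_j 'X_j ^+ e.-1))) //; last first.
  move=> k; rewrite (bigD1 k) //= !mxE eqxx mulr1n -exprSr prednK // big1 ?addr0 //.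
  by move=> j jk; rewrite !mxE eq_sym (negPf jk) mulr0n mul0r.
rewrite det_diag; under eq_bigr => i _ do rewrite mxE.
rewrite (_ : \prod_i _ = 'X_[topm]) ?mcoeffX ?eqxx //.
by rewrite mpolyXE_id; apply: eq_bigr => i _; rewrite mnmE.
Qed.

End TopCoefficient.

Section DividedDifferences.

Lemma inxD p q : inx (p + q) = inx p + inx q. Proof. by rewrite unlock rmorphD. Qed.
Lemma inxM p q : inx (p * q) = inx p * inx q. Proof. by rewrite unlock rmorphM. Qed.
Lemma inyD p q : iny (p + q) = iny p + iny q. Proof. by rewrite unlock rmorphD. Qed.
Lemma inyM p q : iny (p * q) = iny p * iny q. Proof. by rewrite unlock rmorphM. Qed.

Lemma mcoeff_iny p m : (iny p)@_m = (p@_m)%:MP.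
Proof. by rewrite unlock mcoeff_map_mpoly. Qed.

Lemma mcoeff_inx p m : (inx p)@_m = p * (m == 0%MM)%:R.
Proof. by rewrite unlock mcoeffC. Qed.

Lemma mcoeff_inxM p (P : {mpoly {mpoly R[n]}[n]}) m : (inx p * P)@_m = p * P@_m.
Proof. by rewrite unlock mcoeffCM. Qed.

Lemma inyC (c : R) : iny c%:MP_[n] = inx c%:MP.
Proof.
apply/mpolyP => m; rewrite mcoeff_iny mcoeff_inx mcoeffC.
by case: eqP; rewrite ?mulr0 ?mulr1 ?mpolyC0.
Qed.

Lemma inyX (i : 'I_n) : iny ('X_i : S) = 'X_i.
Proof.
apply/mpolyP => u; rewrite mcoeff_iny /= !mcoeffX.
by case: eqP; rewrite ?mpolyC0.
Qed.

Lemma divided_difference p :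
  gideal (fun j => inx 'X_j - iny 'X_j) (inx p - iny p).
Proof.
elim/mpoly_ring_ind: p => [c|i|p q IHp IHq|p q IHp IHq].
- by rewrite inyC subrr; exact: gideal0.
- exact: (gideal_gen (fun j => inx 'X_j - iny 'X_j)).
- by rewrite inxD inyD opprD addrACA; exact: gidealD.
- rewrite inxM inyM.
  have -> : inx p * inx q - iny p * iny q =
            inx q * (inx p - iny p) + iny p * (inx q - iny q).
    by rewrite !mulrBr [iny p * inx q]mulrC addrA subrK mulrC.
  by apply: gidealD; exact: gidealMl.
Qed.

End DividedDifferences.

Variables (g : 'I_n -> S) (d : 'I_n -> nat).
Hypothesis g_homog : forall k, g k \is (d k).-homog.
Hypothesis d_gt0 : forall k, (0 < d k)%N.

(** Pigeonhole: in degree above n(e - 1) some exponent is at least e. *)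
Lemma gideal_highdeg e p : (forall i, gideal g ('X_i ^+ e)) ->
  (forall m, m \in msupp p -> (n * e.-1 < mdeg m)%N) -> gideal g p.
Proof.
move=> ge hp; rewrite (mpolyE p) big_seq; apply: gideal_sum => m mp.
rewrite -mul_mpolyC; apply: gidealMl.
have [i mi] : exists i, (e.-1 < m i)%N.
  apply/existsP; rewrite -[X in is_true X]negbK negb_exists; apply/negP => /forallP h.
  have := hp m mp; rewrite mdegE ltnNge.
  have -> : (n * e.-1 = \sum_(i < n) e.-1)%N by rewrite sum_nat_const card_ord.
  by rewrite leq_sum // => i _; have := h i; rewrite -leqNgt.
have em : (U_(i) *+ e <= m)%MM.
  apply/mnm_lepP => j; rewrite mulmnE mnm1E.
  case: eqP => [<-|_]; last by rewrite mul0n.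
  by rewrite mul1n (leq_trans _ mi) //; case: (e).
rewrite -(submK em) mpolyXD -mpolyXn; exact: gidealMl.
Qed.

Lemma lowdegM a b p q :
    (forall m, (mdeg m < a)%N -> p@_m = 0) ->
    (forall m, (mdeg m < b)%N -> q@_m = 0) ->
  forall m, (mdeg m < a + b)%N -> (p * q)@_m = 0.
Proof.
move=> ha hb m mab; rewrite (mpolyE p) (mpolyE q) mulr_suml raddf_sum big1 //= => u _.
rewrite mulr_sumr raddf_sum big1 //= => v _.
rewrite -scalerAl -scalerAr scalerA -mpolyXD mcoeffZ mcoeffX.
case: eqP => [uv|]; last by rewrite mulr0.
case: (ltnP (mdeg u) a) => ua; first by rewrite ha // !mul0r.
case: (ltnP (mdeg v) b) => vb; first by rewrite hb // mulr0 mul0r.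
by move: mab; rewrite -uv mdegD ltnNge leq_add.
Qed.

Lemma lowdegX p k : p@_0 = 0 -> forall m, (mdeg m < k)%N -> (p ^+ k)@_m = 0.
Proof.
move=> p0; elim: k => // k IHk; rewrite exprS -add1n; apply: lowdegM => // m.
by rewrite ltnS leqn0 mdeg_eq0 => /eqP ->.
Qed.

Lemma gideal_nilp p : (exists e, forall i, gideal g ('X_i ^+ e)) -> p@_0 = 0 ->
  exists k, gideal g (p ^+ k).
Proof.
move=> [e ge] p0; exists (n * e.-1).+1; apply: (gideal_highdeg ge) => m.
by rewrite mcoeff_msupp; apply: contraR; rewrite -ltnNge => /(lowdegX p0) ->.
Qed.

(** [1 - p] is nilpotent modulo the ideal, so a geometric series inverts [p]. *)
Lemma gideal_unit_cancel p h : (exists e, forall i, gideal g ('X_i ^+ e)) ->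
  p@_0 = 1 -> gideal g (h * p) -> gideal g h.
Proof.
move=> ge p0 ghp; have [|k gk] := @gideal_nilp (1 - p) ge.
  by rewrite mcoeffB mcoeff1 eqxx p0 subrr.
have -> : h = h * p * (\sum_(i < k) (1 - p) ^+ i) + h * (1 - p) ^+ k.
  rewrite -mulrA -mulrDr.
  have {1}-> : p = - (1 - p - 1) by rewrite addrAC subrr add0r opprK.
  by rewrite mulNr -subrX1 opprB subrK mulr1.
by apply: gidealD; [exact: gidealMr | exact: gidealMl].
Qed.

Section Residue.
Variables (e : nat) (a : 'M[S]_n).
Hypothesis e_gt0 : (0 < e)%N.
Hypothesis ag : forall i, \sum_j a i j * g j = 'X_i ^+ e.

(** The Grothendieck residue along [g]: the transformation law moves it, through the matrix [a], to
    the system of powers ['X_i ^+ e], where it is a coefficient. *)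
Definition residue h : R := (\det a * h)@_(topm e).

Lemma residue_is_linear : linear_for *%R residue.
Proof.
by move=> c p q; rewrite /residue mulrDr -scalerAr mcoeffD mcoeffZ.
Qed.
HB.instance Definition _ :=
  GRing.isLinear.Build R {mpoly R[n]} R *%R residue residue_is_linear.

Lemma residue_ideal h : gideal g h -> residue h = 0.
Proof.
move=> [k ->]; rewrite /residue mulr_sumr raddf_sum big1 // => j _ /=.
rewrite mulrCA det_adj_row; under eq_bigr => i _ do rewrite ag.
rewrite mulr_sumr; under eq_bigr => i _ do rewrite mulrA.
by apply: topm_coeff => i _; rewrite mnmE prednK.
Qed.

Lemma residue_det (b : 'M[S]_n) :
  (forall k, \sum_j b k j * 'X_j = g k) -> residue (\det b) = 1.
Proof.
move=> bg; rewrite /residue -det_mulmx; apply: det_top1 => // k.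
under eq_bigr => j _ do rewrite mxE mulr_suml.
rewrite exchange_big -ag /=; apply: eq_bigr => i _; rewrite -bg mulr_sumr.
by apply: eq_bigr => j _; rewrite mulrA.
Qed.

Local Notation S2 := {mpoly {mpoly R[n]}[n]}.

Fact residue_x_key : unit. Proof. by []. Qed.
Definition residue_x : S2 -> S := locked_with residue_x_key (map_mpoly residue).

Lemma residue_xE P m : (residue_x P)@_m = residue P@_m.
Proof. by rewrite /residue_x unlock mcoeff_map_mpoly. Qed.

Lemma residue_xD P Q : residue_x (P + Q) = residue_x P + residue_x Q.
Proof. by apply/mpolyP => m; rewrite mcoeffD !residue_xE mcoeffD raddfD. Qed.

Lemma residue_xB P Q : residue_x (P - Q) = residue_x P - residue_x Q.
Proof. by apply/mpolyP => m; rewrite mcoeffB !residue_xE mcoeffB raddfB. Qed.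

Lemma residue_x_sum (J : Type) (r : seq J) (F : J -> S2) :
  residue_x (\sum_(j <- r) F j) = \sum_(j <- r) residue_x (F j).
Proof.
elim: r => [|j r IHr]; last by rewrite !big_cons residue_xD IHr.
rewrite !big_nil; apply/mpolyP => m.
by rewrite residue_xE !mcoeff0 raddf0.
Qed.

Lemma residue_x_iny q P : residue_x (iny q * P) = q * residue_x P.
Proof.
elim/mpoly_ring_ind: q P => [c|i|p q IHp IHq|p q IHp IHq] P.
- by apply/mpolyP => m; rewrite residue_xE inyC mcoeff_inxM !mul_mpolyC linearZ mcoeffZ residue_xE.
- apply/mpolyP => m; rewrite residue_xE inyX !mcoeffXM.
  by case: ifP => _; rewrite ?residue_xE ?raddf0.
- by rewrite inyD !mulrDl residue_xD IHp IHq.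
- by rewrite inyM -!mulrA IHp IHq.
Qed.

Lemma residue_x_inx q P : gideal g q -> residue_x (inx q * P) = 0.
Proof.
move=> gq; apply/mpolyP => m.
by rewrite residue_xE mcoeff_inxM mcoeff0; apply: residue_ideal; exact: gidealMr.
Qed.

(* The Bezoutian [\det Delta] satisfies [h(x) \det Delta = h(y) \det Delta] modulo
   [(g(x), g(y))]; applying the residue in [x] recovers [h] up to a unit. *)
Lemma residue_nondeg h : (forall p, residue (h * p) = 0) -> gideal g h.
Proof.
move=> h0.
have [D DE] := @choice _ _ _ (fun k => divided_difference (g k)).
pose Delta : 'M[S2]_n := \matrix_(k, j) D k j.
have DeltaE k : \sum_j Delta k j * (inx 'X_j - iny 'X_j) = inx (g k) - iny (g k).
  by rewrite DE; apply: eq_bigr => j _; rewrite mxE.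
have [q qE] : gideal (fun k => inx (g k) - iny (g k))
    (\det Delta * (inx h - iny h)).
  have [k ->] := divided_difference h; rewrite mulr_sumr; apply: gideal_sum => j _.
  rewrite mulrCA; apply: gidealMl.
  rewrite (det_adj_row Delta (fun j => inx 'X_j - iny 'X_j)).
  apply: gideal_sum => i _; rewrite DeltaE; apply: gidealMl.
  exact: (gideal_gen (fun k => inx (g k) - iny (g k)) i).
have ge : exists e, forall i, gideal g ('X_i ^+ e).
  by exists e => i; exists (a i).
(* At y = 0 the matrix of divided differences expresses [g] through the variables, so the residue of
   its determinant has constant term 1 in y. *)
apply: (@gideal_unit_cancel (residue_x (\det Delta))) => //.
  rewrite residue_xE -(det_map_mx (@mcoeff n S 0%MM)); apply: residue_det => k.
  have /(congr1 (mcoeff 0%MM)) := DeltaE k.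
  rewrite raddf_sum mcoeffB mcoeff_inx eqxx mulr1 mcoeff_iny.
  have -> : (g k)@_0 = 0.
    by apply: (dhomog_nemf_coeff (g_homog k)); rewrite /= mdeg0 eq_sym -lt0n.
  rewrite mpolyC0 subr0 => <-; apply: eq_bigr => j _.
  rewrite mxE [X in _ = X]rmorphM [X in _ = _ * X]mcoeffB mcoeff_inx eqxx mulr1 mcoeff_iny.
  by rewrite mcoeffX mnm1_eq0 mpolyC0 subr0.
(* The residue in x of h(x) times the Bezoutian vanishes by the assumption on [h], which leaves only
   the term with h(y). *)
have -> : h * residue_x (\det Delta) = - residue_x (\det Delta * (inx h - iny h)).
  rewrite mulrBr residue_xB [in X in X - _]mulrC [in X in _ - X]mulrC residue_x_iny.
  suff -> : residue_x (inx h * \det Delta) = 0 by rewrite sub0r opprK.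
  by apply/mpolyP => m; rewrite residue_xE mcoeff_inxM h0 mcoeff0.
apply: gidealN; rewrite qE residue_x_sum; apply: gideal_sum => k _.
rewrite mulrBr residue_xB ![q k * _]mulrC residue_x_inx ?residue_x_iny ?sub0r.
  by apply: gidealN; apply: gidealMr; exact: gideal_gen.
exact: gideal_gen.
Qed.

(** The degree of the top monomial is the sum of the [e - d j], which is the degree of [\det a],
    plus the sum of the [d j - 1]. *)
Lemma residue_homog h k : (forall i j, a i j \is (e - d j).-homog) ->
  (forall j, d j <= e)%N -> h \is k.-homog -> k != (\sum_j (d j).-1)%N ->
  residue h = 0.
Proof.
move=> ha de hh; apply: contraNeq => nz.
have hm : \det a * h \is (\sum_j (e - d j) + k)%N.-homog.
  by apply: dhomogM => //; exact: det_homog.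
have : mdeg (topm e) == (\sum_j (e - d j) + k)%N.
  by apply: contraNT nz => ne; rewrite /residue (dhomog_nemf_coeff hm) // eq_sym.
have -> : mdeg (topm e) = (\sum_j (e - d j) + \sum_j (d j).-1)%N.
  rewrite mdegE -big_split /=; apply: eq_bigr => j _; rewrite mnmE.
  by rewrite -!subn1 addnBA // subnK.
by rewrite eqn_add2l eq_sym.
Qed.

End Residue.

Lemma square_duality : (exists e, forall i, gideal g ('X_i ^+ e)) ->
  exists w : S -> R, [/\ linear_for *%R w,
    forall h, gideal g h <-> (forall p, w (h * p) = 0),
    forall b : 'M[S]_n, (forall k, \sum_j b k j * 'X_j = g k) -> w (\det b) = 1
    & forall h k, h \is k.-homog -> k != (\sum_j (d j).-1)%N -> w h = 0].
Proof.
(* Adding the sum of the [d j] makes [e] at least every [d k], so that the cofactors can be taken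
   homogeneous of degree [e - d j]. *)
move=> [e0 ge0]; pose e := (e0 + \sum_j d j).+1.
have de k : (d k <= e)%N.
  by rewrite /e (bigD1 k) //= addnCA -addnS leq_addr.
have ge i : exists h : 'I_n -> S, 'X_i ^+ e = \sum_j h j * g j /\
    forall j, h j \is (e - d j)%N.-homog.
  have [||h hE hh] := @gideal_homogE n R _ g d e ('X_i ^+ e) g_homog.
  - by rewrite -[X in X.-homog]mul1n; apply: dhomogMn; rewrite dhomogX /= mdeg1.
  - by rewrite /e -addnS exprD; exact: gidealMr.
  by exists h; split=> // j; have [] := hh j.
have [a aE] := @choice _ _ _ ge.
pose A : 'M[S]_n := \matrix_(i, j) a i j.
have AE i : \sum_j A i j * g j = 'X_i ^+ e.
  by rewrite (aE i).1; apply: eq_bigr => j _; rewrite mxE.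
exists (residue e A); split.
- exact: residue_is_linear.
- move=> h; split=> [gh p|]; last exact: residue_nondeg.
  by apply: residue_ideal => //; exact: gidealMr.
- by move=> b; exact: residue_det.
- move=> h k; apply: residue_homog => // i j.
  by rewrite mxE; exact: (aE i).2.
Qed.

End SquareSystem.

Section SquareConsequences.
Variables (n : nat) (R : comNzRingType).
Local Notation S := {mpoly R[n]}.
Variables (g : 'I_n -> S) (d : 'I_n -> nat).
Hypothesis g_homog : forall k, g k \is (d k).-homog.
Hypothesis d_gt0 : forall k, (0 < d k)%N.
Hypothesis g_fin : exists e, forall i, gideal g ('X_i ^+ e).
Local Notation N := (\sum_j (d j).-1)%N.

(** Macaulay duality, degree by degree: a form pairs nontrivially only with forms of complementary
    degree. Hence in degree N the ideal is the kernel of one functional, and above N it contains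
    every form. *)
Lemma square_residue : exists w : {linear S -> R | *%R}, [/\
    forall h, h \is N.-homog -> gideal g h <-> w h = 0,
    forall k h, h \is k.-homog -> (N < k)%N -> gideal g h,
    forall k h, (k <= N)%N -> h \is k.-homog ->
      (forall q, q \is (N - k)%N.-homog -> w (h * q) = 0) -> gideal g h
    & forall b : 'M[S]_n, (forall k, \sum_j b k j * 'X_j = g k) -> w (\det b) = 1].
Proof.
have [w0 [wl wg wb wh]] := square_duality g_homog d_gt0 g_fin.
pose wL := GRing.isLinear.Build R S R *%R w0 wl.
pose w : {linear S -> R | *%R} := HB.pack w0 wL.
have pair k h : h \is k.-homog ->
    (forall q, (k <= N)%N -> q \is (N - k)%N.-homog -> w (h * q) = 0) -> gideal g h.
  move=> hh h0; apply/wg => p; rewrite -[w0]/(w : S -> R).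
  rewrite (pihomog_partitionE (mf := mdeg) (leqnn (msize p))) mulr_sumr raddf_sum.
  rewrite big1 // => j _; have [kj|kj] := eqVneq (k + j)%N N.
    apply: h0; first by rewrite -kj leq_addr.
    by rewrite -kj addKn; exact: pihomogP.
  by apply: (wh _ (k + j)%N) => //; apply: dhomogM => //; exact: pihomogP.
exists w; split=> //.
- move=> h hh; split=> [/wg/(_ 1)|h0]; first by rewrite mulr1.
  apply: (pair N) => // q _; rewrite subnn => q0.
  suff -> : q = (q@_0)%:MP by rewrite mulrC mul_mpolyC (linearZ_LR w) h0 mulr0.
  apply/mpolyP => m; rewrite mcoeffC; case: eqP => [->|/eqP m0]; first by rewrite mulr1.
  by rewrite mulr0 (dhomog_nemf_coeff q0) //= mdeg_eq0.
- by move=> k h hh Nk; apply: (pair k) => // q; rewrite leqNgt Nk.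
- by move=> k h kN hh h0; apply: (pair k) => // q _; exact: h0.
Qed.

End SquareConsequences.

Definition hess n (R : comNzRingType) (p : {mpoly R[n]}) : {mpoly R[n]} :=
  \det (\matrix_(i < n, j < n) p^`M(i)^`M(j)).

Section Milnor.
Variables (n m : nat) (F : fieldType) (Q : {mpoly F[n]}).
Hypothesis m_ge3 : (3 <= m)%N.
Hypothesis charF : (m.-1)%:R != 0 :> F.
Hypothesis Qh : Q \is m.-homog.
Local Notation J := (gideal (fun j => Q^`M(j))).
Hypothesis Qfin : exists e, forall i, J ('X_i ^+ e).
Local Notation N := (n * (m - 2))%N.

Lemma jac_homog j : Q^`M(j) \is m.-1.-homog.
Proof. exact: homog_deriv. Qed.

Lemma milnor_residue : exists w : {linear {mpoly F[n]} -> F | *%R}, [/\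
    forall h, h \is N.-homog -> J h <-> w h = 0,
    forall k h, h \is k.-homog -> (N < k)%N -> J h,
    forall k h, (k <= N)%N -> h \is k.-homog ->
      (forall q, q \is (N - k)%N.-homog -> w (h * q) = 0) -> J h
    & w (hess Q) != 0].
Proof.
have [|w [w1 w2 w3 w4]] := square_residue jac_homog _ Qfin.
  by move=> _; case: (m) m_ge3 => [|[]].
have NE : (\sum_(j < n) m.-1.-1 = N)%N.
  by rewrite sum_nat_const card_ord -!subn1 -subnDA.
rewrite !NE in w1 w2 w3.
have wH : w (hess Q) != 0.
  (* By Euler's formula the Hessian matrix divided by m - 1 expresses the partial derivatives
     through the variables, so its determinant has residue 1. *)
  have := w4 ((m.-1)%:R^-1%:MP *: \matrix_(k, j) Q^`M(k)^`M(j)).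
  rewrite detZ -(rmorphXn (@mpolyC n F)) mul_mpolyC linearZ /= => H.
  have : (m.-1)%:R^-1 ^+ n * w (hess Q) = 1.
    apply: H => k; under eq_bigr => j _ do rewrite !mxE mul_mpolyC -scalerAl mulrC.
    by rewrite -scaler_sumr (euler (jac_homog k)) scalerA mulVf ?scale1r.
  by apply: contra_eq_neq => ->; rewrite mulr0 eq_sym oner_eq0.
by exists w.
Qed.

End Milnor.

(** * Systems of parameters *)

Definition char0 (R : nzRingType) := forall k : nat, k.+1%:R != 0 :> R.

Lemma char0_natr_inj (R : nzRingType) : char0 R -> injective (fun k : nat => k%:R : R).
Proof.
move=> R0 a b /=; wlog ab : a b / (a <= b)%N.
  by move=> H /[dup] E; case: (leqP a b) => [/H|/ltnW/H] h; [apply: h | move/esym/h].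
move=> /esym/eqP; rewrite -subr_eq0 -natrB // => /eqP; case: (b - a)%N (subnKC ab) => [|k].
  by rewrite addn0.
by move=> _ /eqP; rewrite (negPf (R0 k)).
Qed.

(* Kronecker substitution [X_i := x ^ (B ^ i)], with [B] larger than the degree. *)
Lemma digits_inj B n (a b : 'I_n -> nat) : (forall i, a i < B)%N ->
    (forall i, b i < B)%N ->
  (\sum_i a i * B ^ i = \sum_i b i * B ^ i)%N -> a =1 b.
Proof.
elim: n a b => [|n IHn] a b aB bB; first by move=> _ [].
rewrite !big_ord_recl expn0 !muln1.
have E (c : 'I_n.+1 -> nat) : (\sum_(i < n) c (lift ord0 i) * B ^ lift ord0 i =
    (\sum_(i < n) c (lift ord0 i) * B ^ i) * B)%N.
  rewrite big_distrl; apply: eq_bigr => i _ /=.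
  by rewrite /bump leq0n add1n expnSr mulnA.
rewrite !E ![(_ ord0 + _)%N]addnC => ab.
have B0 : (0 < B)%N := leq_trans (ltn0Sn _) (aB ord0).
have ab0 : a ord0 = b ord0.
  by have := congr1 (modn^~ B) ab; rewrite !modnMDl !modn_small.
move/eqP: ab; rewrite ab0 eqn_add2r eqn_pmul2r // => /eqP ab.
have {}ab := IHn _ _ (fun i => aB _) (fun i => bB _) ab.
by move=> i; case: (unliftP ord0 i) => [j|] ->; [exact: ab | exact: ab0].
Qed.

(** Natural coordinates are asked for because every ring morphism respects them; later this makes
    the points over C dense among the points over a residue field. *)
Lemma mpoly_nat_nonzero n (R : idomainType) (p : {mpoly R[n]}) : char0 R -> p != 0 ->
  exists v : 'I_n -> nat, p.@[fun i => (v i)%:R] != 0.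
Proof.
move=> R0 p0; pose B := msize p.
pose h (i : 'I_n) : {poly R} := 'X^(B ^ i).
pose P : {poly R} := mmap (@polyC R) h p.
have hX m : mmap1 h m = 'X^(\sum_i m i * B ^ i).
  rewrite /mmap1 -prodrXr; apply: eq_bigr => i _.
  by rewrite /h -exprM mulnC.
have P0 : P != 0.
  have [m mp] : exists m, m \in msupp p.
    by case E: (msupp p) => [|m s]; [move: p0; rewrite -msupp_eq0 E | exists m; rewrite inE eqxx].
  apply: contraNneq p0 => /(congr1 (fun P : {poly R} => P`_(\sum_i m i * B ^ i)%N)).
  rewrite coef0 /P /mmap coef_sum (bigD1_seq m) ?msupp_uniq //= [X in _ + X]big1_seq ?addr0.
    by rewrite hX coefCM coefXn eqxx mulr1 => /eqP; rewrite mcoeff_eq0 mp.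
  move=> u /andP[um up]; rewrite hX coefCM coefXn.
  case: eqP => [/digits_inj mu|]; last by rewrite mulr0.
  have dB w i : w \in msupp p -> (w i < B)%N.
    move=> /msize_mdeg_lt; apply: leq_ltn_trans.
    by rewrite mdegE (bigD1 i) //= leq_addr.
  case/eqP: um; apply/mnmP => i; apply/esym/mu => j; exact: dB.
have [k Pk] : exists k : nat, ~~ root P k%:R.
  pose s := [seq k%:R : R | k <- iota 0 (size P)].
  have : ~~ all (root P) s.
    apply/negP => sP; suff us : uniq s.
      by have := max_poly_roots P0 sP us; rewrite size_map size_iota ltnn.
    by rewrite map_inj_uniq ?iota_uniq //; exact: char0_natr_inj.
  by move/allPn => [x /mapP[k _ ->]]; exists k.
exists (fun i => (k ^ (B ^ i))%N); rewrite /root in Pk.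
suff -> : p.@[fun i => (k ^ B ^ i)%:R] = P.[k%:R] by [].
rewrite /P /mmap mevalE horner_sum; apply: eq_bigr => m _.
rewrite hornerM hornerC; congr (_ * _); rewrite /mmap1 horner_prod.
by apply: eq_bigr => i _; rewrite horner_exp /h hornerXn natrX.
Qed.

Section PolySubstitution.
Variables (R : comNzRingType) (n r : nat) (u : 'I_r -> {mpoly R[n]}).

Definition csub (p : {mpoly R[r]}) : {mpoly R[n]} := mmap (@mpolyC n R) u p.

HB.instance Definition _ :=
  GRing.RMorphism.copy csub (mmap (@mpolyC n R) u).

Lemma csubC c : csub c%:MP = c%:MP. Proof. exact: mmapC. Qed.
Lemma csubXm m : csub 'X_[m] = mmap1 u m. Proof. exact: mmapX. Qed.
Lemma csubX i : csub 'X_i = u i. Proof. by rewrite csubXm mmap1U. Qed.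
Lemma csubZ c p : csub (c *: p) = c *: csub p.
Proof. by rewrite -mul_mpolyC rmorphM /= csubC mul_mpolyC. Qed.
Lemma csubE p : csub p = \sum_(m <- msupp p) p@_m *: mmap1 u m.
Proof. by apply: eq_bigr => m _; rewrite mul_mpolyC. Qed.

End PolySubstitution.

Lemma gideal_mmap_congr (R : comNzRingType) n r (I : finType)
    (g : I -> {mpoly R[n]}) (u v : 'I_r -> {mpoly R[n]}) (p : {mpoly R[r]}) :
  (forall k, gideal g (u k - v k)) ->
  gideal g (csub u p - csub v p).
Proof.
move=> uv; elim/mpoly_ring_ind: p => [c|i|p q IHp IHq|p q IHp IHq].
- by rewrite !csubC subrr; exact: gideal0.
- by rewrite !csubX.
- by rewrite !raddfD addrACA; exact: gidealD.
- rewrite !rmorphM /=; set a := csub u p; set b := csub v p.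
  set a' := csub u q; set b' := csub v q.
  have -> : a * a' - b * b' = (a - b) * a' + b * (a' - b').
    by rewrite mulrBl mulrBr addrA subrK.
  by apply: gidealD; [exact: gidealMr | exact: gidealMl].
Qed.

Lemma mmap_homog (R : comNzRingType) n r d (u : 'I_r -> {mpoly R[n]}) (m : 'X_{1..r}) :
  (forall k, u k \is d.-homog) -> mmap1 u m \is (d * mdeg m)%N.-homog.
Proof.
move=> hu; rewrite mdegE big_distrr /mmap1 /=.
elim/big_rec2: _ => [|i y x _ h]; first exact: dhomog1.
by apply: dhomogM => //; exact: dhomogMn.
Qed.

Lemma pihomog_mmap (R : comNzRingType) n r d e (u : 'I_r -> {mpoly R[n]}) p :
    (0 < d)%N -> (forall k, u k \is d.-homog) ->
  pihomog mdeg (d * e) (csub u p) =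
  csub u (pihomog mdeg e p).
Proof.
move=> d0 hu; rewrite [in LHS](mpolyE p) [in RHS](mpolyE p).
rewrite [csub _ _]raddf_sum [pihomog _ _ _]linear_sum.
rewrite [pihomog _ e _]linear_sum [RHS]raddf_sum.
apply: eq_bigr => m _; rewrite !linearZ /= !csubZ csubXm !linearZ /=.
rewrite pihomogX /=; congr (_ *: _); have hm := mmap_homog m hu.
case: eqP => [<-|/eqP me]; first by rewrite csubXm pihomog_dE.
by rewrite raddf0 (pihomog_ne0 _ hm) // eqn_pmul2l.
Qed.

Lemma mmap_scale (R : comNzRingType) n r e (l : 'I_r -> R) (x : {mpoly R[n]}) p :
  p \is e.-homog ->
  csub (fun k => l k *: x) p = p.@[l] *: x ^+ e.
Proof.
move=> hp; rewrite csubE mevalE scaler_suml !big_seq; apply: eq_bigr => m mp.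
rewrite -scalerA; congr (_ *: _).
rewrite -(dhomogP _ _ _ hp _ mp) /= mdegE /mmap1 -prodrXr -scaler_prod.
by apply: eq_bigr => i _; rewrite exprZn.
Qed.

Section HSOP.
Variables (n : nat) (F : fieldType).
Hypothesis F0 : char0 F.
Local Notation S := {mpoly F[n]}.
Implicit Types (i r d : nat).

(** Padding by zeros keeps the index type independent of [i]. *)
Definition kill i (j : 'I_n) : S := if (j < i)%N then 'X_j else 0.
Definition mixed i r (g : 'I_r -> S) (s : 'I_n + 'I_r) : S :=
  match s with inl j => kill i j | inr k => g k end.

Definition cut i (p : S) : S :=
  csub (fun j : 'I_n => if (j < i)%N then 0 else 'X_j) p.
HB.instance Definition _ i := GRing.RMorphism.copy (cut i) (csub _).

Lemma cut_kill i p : gideal (kill i) (p - cut i p).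
Proof.
have {1}-> : p = csub (fun j => 'X_j) p.
  have := comp_mpoly_id p; rewrite /comp_mpoly => {1}<-.
  apply: eq_bigr => m _; congr (_ * _); apply: eq_bigr => j _.
  by rewrite tnth_mktuple.
apply: gideal_mmap_congr => j; case: ifP => ji; last by rewrite subrr; exact: gideal0.
by rewrite subr0; have := gideal_gen (kill i) j; rewrite /kill ji.
Qed.

Lemma mcoeff_cut i p m : (cut i p)@_m =
  if [forall j : 'I_n, (j < i)%N ==> (m j == 0%N)] then p@_m else 0.
Proof.
rewrite {2}(mpolyE p) /cut csubE !raddf_sum /=.
have cutX (u : 'X_{1..n}) : mmap1 (fun j : 'I_n => if (j < i)%N then 0 else 'X_j : S) u =
    if [forall j : 'I_n, (j < i)%N ==> (u j == 0%N)] then 'X_[u] else 0.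
  case: ifP => [/forallP u0|/negbT/forallPn[j]].
    rewrite mpolyXE_id; apply: eq_bigr => j _; case: ifP => // ji.
    by have := u0 j; rewrite ji /= => /eqP ->.
  rewrite negb_imply => /andP[ji uj]; rewrite /mmap1 (bigD1 j) //= ji expr0n.
  by rewrite (negPf uj) mul0r.
case: ifP => um; last first.
  rewrite big1 // => u _; rewrite mcoeffZ cutX; case: ifP => uu.
    by rewrite mcoeffX; case: eqP => [E|]; rewrite ?mulr0 //; rewrite -E uu in um.
  by rewrite mcoeff0 mulr0.
apply: eq_bigr => u _; rewrite !mcoeffZ cutX.
case: ifP => uu //; rewrite mcoeff0 mcoeffX; case: eqP => // E.
by rewrite E um in uu.
Qed.

Lemma cut_cut i p : cut i (cut i p) = cut i p.
Proof. by apply/mpolyP => m; rewrite !mcoeff_cut; case: ifP => // ->. Qed.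

Lemma cut_homog i d p : p \is d.-homog -> cut i p \is d.-homog.
Proof.
move=> /homogP_coeff hp; apply/homogP_coeff => m md.
by rewrite mcoeff_cut; case: ifP => // _; exact: hp.
Qed.

(* Counting: the [E ^ r] monomials with exponents below [E] in [r] forms of degree [d]
   in [n - i < r] variables are polynomials with exponents below [r d E]. *)
Lemma algebraic_dependence i r d (g : 'I_r -> S) : (i <= n)%N -> (0 < d)%N ->
    (n - i < r)%N -> (forall k, g k \is d.-homog) ->
  exists e (P : {mpoly F[r]}), [/\ P != 0, P \is e.-homog
    & gideal (kill i) (csub g P)].
Proof.
(* As E > (rd)^(n-i) and r > n - i, one has E^r > (rdE)^(n-i) = D^(n-i): more monomials than
   coefficients to cancel. *)
move=> i_n d0 nr hg; pose E := ((r * d) ^ (n - i)).+1; pose D := (r * d * E)%N.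
have r0 : (0 < r)%N by exact: leq_trans nr.
pose T1 := {ffun 'I_r -> 'I_E}; pose T2 := {ffun 'I_(n - i) -> 'I_D}.
have card12 : (#|T2| < #|T1|)%N.
  rewrite !card_ffun !card_ord /D expnMn.
  apply: (@leq_trans (E * E ^ (n - i))).
    by rewrite ltn_pmul2r ?expn_gt0 // /E ltnSn.
  by rewrite -expnS leq_pexp2l.
pose u k := cut i (g k).
have hu k : u k \is d.-homog by exact: cut_homog.
pose mon1 (a : T1) : 'X_{1..r} := [multinom (a k : nat) | k < r].
pose mon2 (b : T2) : 'X_{1..n} := [multinom
  (if insub (j - i)%N is Some k then (if (i <= j)%N then b k : nat else 0%N) else 0%N) | j < n].
pose M : 'M[F]_(#|T1|, #|T2|) :=
  \matrix_(a, b) (mmap1 u (mon1 (enum_val a)))@_(mon2 (enum_val b)).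
have [c c0 cM] : exists2 c : 'rV[F]_#|T1|, c != 0 & c *m M = 0.
  have : \rank (kermx M) != 0%N.
    by rewrite mxrank_ker -lt0n subn_gt0 (leq_ltn_trans (rank_leq_col M)).
  rewrite mxrank_eq0 => /rowV0Pn[c]; rewrite sub_kermx => /eqP cM c0.
  by exists c.
pose P : {mpoly F[r]} := \sum_a c 0 a *: 'X_[mon1 (enum_val a)].
have mon1_inj : injective mon1.
  move=> a b /mnmP ab; apply/ffunP => k; apply/val_inj; have := ab k.
  by rewrite !mnmE.
have P0 : P != 0.
  have [a ca] : exists a, c 0 a != 0.
    by apply/rV0Pn.
  apply: contraNneq ca => /(congr1 (mcoeff (mon1 (enum_val a)))).
  rewrite mcoeff0 raddf_sum (bigD1 a) //= mcoeffZ mcoeffX eqxx mulr1 big1 ?addr0 // => [-> //|b ba].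
  rewrite mcoeffZ mcoeffX; case: eqP => [/mon1_inj/enum_val_inj E1|]; last by rewrite mulr0.
  by rewrite E1 eqxx in ba.
have PuE : csub u P = \sum_a c 0 a *: mmap1 u (mon1 (enum_val a)).
  rewrite raddf_sum; apply: eq_bigr => a _.
  by rewrite /= csubZ csubXm.
have Pu : csub u P = 0.
  apply/mpolyP => m; rewrite mcoeff0; apply/eqP; apply: contraT => nz.
  have mcut : [forall j : 'I_n, (j < i)%N ==> (m j == 0%N)].
    apply: contraR nz => um; have -> : csub u P = cut i (csub u P).
      rewrite PuE rmorph_sum; apply: eq_bigr => a _ /=.
      rewrite /cut csubZ -/(cut i _); congr (_ *: _).
      rewrite /mmap1 rmorph_prod; apply: eq_bigr => k _; rewrite rmorphXn /=.
      by rewrite /u cut_cut.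
    by rewrite mcoeff_cut (negPf um).
  have mD j : (m j < D)%N.
    move: nz; rewrite PuE raddf_sum /=; apply: contraR; rewrite -leqNgt => Dm.
    apply/eqP; rewrite big1 // => a _; rewrite mcoeffZ.
    rewrite (dhomog_nemf_coeff (mmap_homog _ hu)) ?mulr0 //=.
    apply: contraTneq Dm => mE; rewrite -ltnNge.
    apply: (@leq_ltn_trans (mdeg m)); first by rewrite mdegE (bigD1 j) //= leq_addr.
    rewrite mE mdegE (@leq_ltn_trans (d * (r * E.-1))) //.
      have -> : (r * E.-1 = \sum_(k < r) E.-1)%N by rewrite sum_nat_const card_ord.
      rewrite leq_pmul2l // leq_sum // => k _.
      by rewrite mnmE -ltnS prednK.
    by rewrite /D mulnA [(d * r)%N]mulnC ltn_pmul2l ?muln_gt0 ?r0.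
  pose b : T2 := [ffun k => Ordinal (mD (cast_ord (subnKC i_n) (rshift i k)))].
  have mb : m = mon2 b.
    apply/mnmP => j; rewrite mnmE; have [ij|ji] := leqP i j; last first.
      have := forallP mcut j; rewrite ji /= => /eqP ->.
      by case: insubP.
    have ji : (j - i < n - i)%N by rewrite ltn_sub2r // (leq_ltn_trans ij).
    rewrite insubT ffunE /=; congr (m _); apply/val_inj => /=.
    by rewrite subnKC.
  have /rowP/(_ (enum_rank b)) := cM; rewrite !mxE => cM0.
  move/eqP: nz; case; rewrite -[RHS]cM0 PuE raddf_sum; apply: eq_bigr => a _ /=.
  by rewrite mcoeffZ mxE enum_rankK mb.
have [e Pe] : exists e, pihomog mdeg e P != 0.
  apply: contrapT => /forallNP H; move/eqP: P0; apply.
  rewrite (pihomog_partitionE (mf := mdeg) (leqnn (msize P))) big1 // => e _.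
  by apply/eqP/negbNE/negP/H.
exists e, (pihomog mdeg e P); split=> //; first exact: pihomogP.
have /(congr1 (pihomog mdeg (d * e))) := Pu.
rewrite pihomog_mmap // raddf0 => Pu0.
rewrite -[X in gideal _ X]subr0 -Pu0; apply: gideal_mmap_congr => k.
exact: cut_kill.
Qed.

(** Induction on the number of forms. If there are more than n - i, they satisfy a homogeneous
    relation P modulo the first i variables. Subtracting the multiples [l k *: x] of one form leaves
    one form fewer; modulo the new forms the relation reads P(l) x^D = 0, so x is nilpotent once
    P(l) is nonzero. *)
Lemma hsop_reduce i r d (g : 'I_r -> S) : (i <= n)%N -> (0 < d)%N ->
    (forall k, g k \is d.-homog) ->
    (exists e, forall j, gideal (mixed i g) ('X_j ^+ e)) ->
  exists A : 'M[F]_(n, r), exists e, forall j, gideal (fun k : 'I_n =>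
    if (k < i)%N then 'X_k else \sum_l A k l *: g l) ('X_j ^+ e).
Proof.
move=> i_n d0; elim: r g => [|r IHr] g hg ge.
  exists 0; have [e {}ge] := ge; exists e => j; apply: gideal_trans (ge j).
  case=> [k|[]] //=; rewrite /kill; case: ifP => [ki|_]; last exact: gideal0.
  by have := gideal_gen (fun k : 'I_n => if (k < i)%N then 'X_k else
       \sum_l (0 : 'M[F]_(n, 0)) k l *: g l) k; rewrite ki.
have [nr|rn] := ltnP (n - i) r.+1; last first.
  pose A : 'M[F]_(n, r.+1) := \matrix_(k, l) (k == i + l :> nat)%:R.
  exists A; have [e {}ge] := ge; exists e => j; apply: gideal_trans (ge j).
  set G := fun k : 'I_n => _.
  case=> [k|l] /=.
    rewrite /kill; case: ifP => [ki|_]; last exact: gideal0.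
    by have := gideal_gen G k; rewrite /G ki.
  have il : (i + l < n)%N.
    by rewrite -ltn_subRL (leq_trans _ rn).
  have := gideal_gen G (Ordinal il); rewrite /G /= ltnNge leq_addr /=.
  rewrite (bigD1 l) //= mxE eqxx scale1r big1 ?addr0 // => k kl.
  by rewrite mxE /= eqn_add2l eq_sym (inj_eq val_inj) (negPf kl) scale0r.
have [D [P [P0 hP gP]]] := algebraic_dependence i_n d0 nr hg.
have [v Pv] := mpoly_nat_nonzero F0 P0; pose l k : F := (v k)%:R.
(* If every [l k] were zero, P would have degree 0 and a nonzero constant would lie in the ideal of
   the first i variables. *)
have [k0 lk0|l0] := pickP (fun k => l k != 0); last first.
  have D0 : D = 0%N.
    case: D hP {gP} => // D hP; case/eqP: Pv.
    rewrite mevalE big_seq big1 // => m mP.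
    have [k mk] : exists k, m k != 0%N.
      apply/existsP; apply: contraT; rewrite negb_exists => /forallP m0.
      have := dhomogP _ _ _ hP _ mP; rewrite /= mdegE big1 // => k _.
      by apply/eqP/negbNE/m0.
    rewrite (bigD1 k) //= -/(l k) (eqP (negbFE (l0 k))) expr0n (negPf mk) mul0r.
    by rewrite mulr0.
  case/eqP: Pv; rewrite D0 in hP.
  have PC : P = (P@_0)%:MP.
    apply/mpolyP => m; rewrite mcoeffC; case: eqP => [->|/eqP m0]; first by rewrite mulr1.
    by rewrite mulr0 (dhomog_nemf_coeff hP) //= mdeg_eq0.
  rewrite PC csubC in gP; rewrite PC mevalC.
  have [h /(congr1 (mcoeff 0%MM))] := gP; rewrite mcoeffC eqxx mulr1 => ->.
  rewrite raddf_sum big1 // => j _; rewrite [LHS]rmorphM /kill.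
  case: ifP => _; last by rewrite rmorph0 mulr0.
  by rewrite [X in _ * X]mcoeffX mnm1_eq0 mulr0.
pose x := (l k0)^-1 *: g k0.
pose y k := g k - l k *: x.
have yk0 : y k0 = 0 by rewrite /y scalerA divff // scale1r subrr.
pose g' (k : 'I_r) := y (lift k0 k).
have hy k : y k \is d.-homog.
  by apply: rpredB => //; apply: rpredZ; apply: rpredZ.
have yg' k : gideal (mixed i g') (y k).
  case: (unliftP k0 k) => [k' ->|->]; last by rewrite yk0; exact: gideal0.
  exact: (gideal_gen (mixed i g') (inr k')).
have xD : gideal (mixed i g') (x ^+ D).
  have gPm : gideal (mixed i g') (csub g P).
    by apply: gideal_trans gP => j; exact: (gideal_gen (mixed i g') (inl j)).
  have := @gideal_mmap_congr _ _ _ _ (mixed i g') g (fun k => l k *: x) P yg'.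
  move/(gidealB gPm); rewrite opprB addrCA subrr addr0 (mmap_scale _ _ hP).
  move/(gidealMl (P.@[l]^-1%:MP)); rewrite mul_mpolyC scalerA mulVf ?scale1r //.
have [e {}ge] := ge.
have ge' : exists e, forall j, gideal (mixed i g') ('X_j ^+ e).
  exists (e * D)%N => j; have [h hE] := ge j.
  pose b := \sum_k h (inr k) * (l k)%:MP.
  have Xb : gideal (mixed i g') ('X_j ^+ e - b * x).
    rewrite hE big_sumType /= /b mulr_suml -addrA -sumrB; apply: gidealD.
      apply: gideal_sum => k _; apply: gidealMl.
      exact: (gideal_gen (mixed i g') (inl k)).
    apply: gideal_sum => k _; rewrite -mulrA -mulrBr mul_mpolyC.
    by apply: gidealMl; exact: yg'.
  have XbD : gideal (mixed i g') (('X_j ^+ e) ^+ D - (b * x) ^+ D).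
    by rewrite subrXX; exact: gidealMr.
  rewrite exprM -[X in gideal _ X](subrK ((b * x) ^+ D)); apply: gidealD => //.
  by rewrite exprMn; exact: gidealMl.
have [A' [e' Ae]] := IHr g' (fun k => hy _) ge'.
pose c k s : F := (s == lift k0 k)%:R - (l (lift k0 k) / l k0) * (s == k0)%:R.
have cE k : g' k = \sum_s c k s *: g s.
  under eq_bigr => s _ do rewrite scalerBl.
  rewrite sumrB (bigD1 (lift k0 k)) //= eqxx scale1r big1 ?addr0; last first.
    by move=> s /negPf ->; rewrite scale0r.
  rewrite (bigD1 k0) //= eqxx mulr1 big1 ?addr0; last first.
    by move=> s /negPf ->; rewrite mulr0 scale0r.
  by rewrite /g' /y /x scalerA.
exists (\matrix_(k, s) \sum_t A' k t * c t s), e' => j.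
apply: gideal_trans (Ae j) => k; set G := fun k : 'I_n => _.
have := gideal_gen G k; rewrite /G; case: ifP => // _.
suff -> : \sum_t A' k t *: g' t =
  \sum_s (\matrix_(k, s) \sum_t A' k t * c t s) k s *: g s by [].
under [RHS]eq_bigr => s _ do rewrite mxE scaler_suml.
rewrite exchange_big; apply: eq_bigr => t _ /=; rewrite cE scaler_sumr.
by apply: eq_bigr => s _; rewrite scalerA.
Qed.

End HSOP.

(** * Monomials outside the Jacobian ideal *)

Section PartialDegree.
Variable n : nat.
Implicit Types (i : nat) (a b : 'X_{1..n}).

Definition pdeg i a : nat := \sum_(j < n | (j < i)%N) a j.
Definition mlo i a : 'X_{1..n} := [multinom if (j < i)%N then a j else 0%N | j < n].
Definition mhi i a : 'X_{1..n} := [multinom if (j < i)%N then 0%N else a j | j < n].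

Lemma pdegD i a b : pdeg i (a + b) = (pdeg i a + pdeg i b)%N.
Proof. by rewrite -big_split; apply: eq_bigr => j _; rewrite mnmDE. Qed.

Lemma pdegU i (j : 'I_n) : pdeg i U_(j) = (j < i)%N.
Proof.
rewrite /pdeg big_mkcond (bigD1 j) //= mnm1E eqxx big1 ?addn0 => [|k kj].
  by case: ifP.
by rewrite mnm1E eq_sym (negPf kj); case: ifP.
Qed.

Lemma mlohi i a : a = (mlo i a + mhi i a)%MM.
Proof. by apply/mnmP => j; rewrite mnmDE !mnmE; case: ifP; rewrite ?addn0. Qed.

Lemma pdeg_mlo k i a : (k <= i)%N -> pdeg k (mlo i a) = pdeg k a.
Proof.
by move=> ki; apply: eq_bigr => j jk; rewrite mnmE (leq_trans jk ki).
Qed.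

Lemma mdeg_mlo i a : mdeg (mlo i a) = pdeg i a.
Proof. by rewrite mdegE [RHS]big_mkcond; apply: eq_bigr => j _; rewrite mnmE. Qed.

Lemma mdeg_pdeg i a : mdeg a = (pdeg i a + mdeg (mhi i a))%N.
Proof. by rewrite {1}(mlohi i a) mdegD mdeg_mlo. Qed.

Lemma pdeg_mdeg i a : (pdeg i a <= mdeg a)%N.
Proof. by rewrite (mdeg_pdeg i) leq_addr. Qed.

Lemma pdeg0P i a : pdeg i a = 0%N -> forall j : 'I_n, (j < i)%N -> a j = 0%N.
Proof. by move=> /eqP; rewrite sum_nat_eq0 => /forallP h j ji; apply/eqP; have := h j; rewrite ji. Qed.

Lemma pdeg_gt0 i a : (0 < pdeg i a)%N -> exists2 j : 'I_n, (j < i)%N & (0 < a j)%N.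
Proof.
rewrite lt0n sum_nat_eq0 => /forallPn[j]; rewrite negb_imply => /andP[ji aj].
by exists j; rewrite // lt0n.
Qed.

Lemma mhi_eq i a b : mlo i a = mlo i b -> mhi i a = mhi i b -> a = b.
Proof. by move=> lo hi; rewrite (mlohi i a) lo hi -mlohi. Qed.

End PartialDegree.

Lemma geometric_bound N n t : (t <= n)%N ->
  (\sum_(n - t <= k < n) N * N.+1 ^ (n - k) < N.+1 ^ t.+1)%N.
Proof.
elim: t => [|t IHt] tn; first by rewrite subn0 big_geq.
rewrite big_ltn ?ltn_subrL ?(leq_ltn_trans _ tn) // subnSK // subKn //.
by rewrite [(N.+1 ^ t.+2)%N]expnS mulSn addnC ltn_add2r IHt // ltnW.
Qed.

(** The digits after place i, each at most N, add up to less than one unit of place i, so they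
    cannot undo the increase there. *)
Lemma code_increase n N (brk : pred 'I_n) (u v : 'I_n -> nat) (i : 'I_n) :
    (forall k, u k <= N)%N -> brk i -> (u i < v i)%N ->
    (forall k : 'I_n, (k <= i)%N -> (u k <= v k)%N) ->
  (\sum_(k < n | brk k) u k * N.+1 ^ (n - k) <
   \sum_(k < n | brk k) v k * N.+1 ^ (n - k))%N.
Proof.
move=> uN bi uvi uv.
pose hi (c : 'I_n -> nat) := (\sum_(k < n | brk k && (i < k)%N) c k * N.+1 ^ (n - k))%N.
pose lo (c : 'I_n -> nat) := (\sum_(k < n | brk k && (k < i)%N) c k * N.+1 ^ (n - k))%N.
have E c : (\sum_(k < n | brk k) c k * N.+1 ^ (n - k) =
    lo c + (c i * N.+1 ^ (n - i) + hi c))%N.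
  rewrite (bigID (fun k : 'I_n => (k < i)%N)) /=; congr (_ + _)%N.
  rewrite (bigD1 i) /= ?bi ?ltnn //; congr (_ + _)%N; apply: eq_bigl => k.
  by rewrite -leqNgt -(inj_eq val_inj) /= [(i < k)%N]ltn_neqAle eq_sym -andbA; congr andb; rewrite andbC.
rewrite !E -addnS leq_add //.
  by apply: leq_sum => k /andP[_ ki]; rewrite leq_mul2r uv ?orbT // ltnW.
apply: leq_trans (leq_addr _ _); apply: (@leq_trans ((u i).+1 * N.+1 ^ (n - i))); last first.
  by rewrite leq_mul2r uvi orbT.
rewrite mulSn addnC -addSn leq_add2r.
have := @geometric_bound N n (n - i.+1) (leq_subr _ _).
rewrite subKn // subnSK //; apply: leq_ltn_trans.
rewrite big_geq_mkord /hi big_mkcond [X in (_ <= X)%N]big_mkcond leq_sum // => k _.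
case: (brk k) => //=; case: ifP => // _.
by rewrite leq_mul2r uN orbT.
Qed.

Section Stability.
Variables (n m : nat) (F : fieldType) (Q : {mpoly F[n]}).
Hypothesis m_ge3 : (3 <= m)%N.
Hypothesis F0 : char0 F.
Hypothesis Qh : Q \is m.-homog.
Local Notation S := {mpoly F[n]}.
Local Notation g := (fun j => Q^`M(j)).
Local Notation J := (gideal (fun j => Q^`M(j))).
Hypothesis Qfin : exists e, forall i, J ('X_i ^+ e).
Local Notation d := m.-1.
Local Notation N := (n * (m - 2))%N.
Implicit Types (p q h : S) (a b : 'X_{1..n}) (i : nat).

Lemma dE : d = (m - 2).+1.
Proof. by case: (m) m_ge3 => [|[|k]] //= _; rewrite subn2. Qed.

Lemma d0 : (0 < d)%N. Proof. by rewrite dE. Qed.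

Lemma pred_deg_neq0 : d%:R != 0 :> F. Proof. by rewrite dE. Qed.

Lemma jac_monomials p : (forall a, a \in msupp p -> J 'X_[a]) -> J p.
Proof.
move=> h; rewrite (mpolyE p) big_seq; apply: gideal_sum => a /h Ja.
by rewrite -mul_mpolyC; exact: gidealMl.
Qed.

Lemma jac_deg_lt k p : p \is k.-homog -> (k < d)%N -> J p -> p = 0.
Proof.
move=> hp kd Jp; have [h -> hh] := gideal_homogE (jac_homog Qh) hp Jp.
by rewrite big1 // => j _; rewrite (hh j).2 // mul0r.
Qed.

Lemma hsop_system i : (i <= n)%N -> exists (A : 'M[F]_n) (G : 'I_n -> S), [/\
    forall k, G k = if (k < i)%N then 'X_k else \sum_l A k l *: g l,
    forall k, G k \is (if (k < i)%N then 1%N else d).-homog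
  & exists e, forall j, gideal G ('X_j ^+ e)].
Proof.
move=> i_n; have [||A [e Ae]] := @hsop_reduce n F F0 i n d g i_n d0.
- exact: jac_homog.
- have [e Je] := Qfin; exists e => j; apply: gideal_trans (Je j) => k.
  exact: (gideal_gen (mixed i g) (inr k)).
exists A, (fun k : 'I_n => if (k < i)%N then 'X_k else \sum_l A k l *: g l).
split=> //; last by exists e.
move=> k; case: ifP => _; first by rewrite dhomogX /= mdeg1.
by apply: rpred_sum => l _; apply: rpredZ; exact: jac_homog.
Qed.

Lemma hsop_degree i : (i <= n)%N ->
  (\sum_(k < n) (if (k < i)%N then 1%N else d).-1 = (n - i) * (m - 2))%N.
Proof.
move=> i_n; rewrite (eq_bigr (fun k : 'I_n => if (k < i)%N then 0%N else (m - 2)%N)); last first.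
  by move=> k _; case: ifP => //=; rewrite dE.
rewrite -(big_mkord xpredT (fun k => if (k < i)%N then 0%N else (m - 2)%N)).
rewrite (big_cat_nat _ i_n) //= big_nat_cond big1 ?add0n; last first.
  by move=> k /andP[/andP[_ ->]].
rewrite big_nat_cond (eq_bigr (fun=> (m - 2)%N)) => [|k /andP[/andP[ik _] _]].
  by rewrite -big_nat_cond sum_nat_const_nat.
by rewrite ltnNge ik.
Qed.

(** The first i variables and n - i combinations of the partial derivatives are a complete
    intersection of socle degree (n - i)(m - 2). *)
Lemma mixed_high i k p : (i <= n)%N -> p \is k.-homog ->
  ((n - i) * (m - 2) < k)%N -> gideal (mixed i g) p.
Proof.
move=> i_n hp ik; have [A [G [GE hG Gfin]]] := hsop_system i_n.
have [|w [_ w2 _ _]] := square_residue hG _ Gfin.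
  by move=> j; case: ifP => // _; rewrite d0.
rewrite hsop_degree // in w2; apply: gideal_trans (w2 _ _ hp ik) => j.
rewrite GE; case: ifP => ji.
  by have := gideal_gen (mixed i g) (inl j); rewrite /= /kill ji.
apply: gideal_sum => l _; rewrite -mul_mpolyC; apply: gidealMl.
exact: (gideal_gen (mixed i g) (inr l)).
Qed.

Lemma mixed_kill_homog i s : mixed i g s \is
  (match s with inl _ => 1%N | inr _ => d end).-homog.
Proof.
case: s => [j|j] /=; last exact: jac_homog.
by rewrite /kill; case: ifP => _; rewrite ?dhomog0 // dhomogX /= mdeg1.
Qed.

(** The part of [a] in the last variables has degree above (n - i)(m - 2), hence lies in the ideal
    of the first i variables modulo J. After expansion, some monomial must stay outside J; it keeps
    the low part of [a] and gains a low variable. *)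
Lemma replacement i a : (i <= n)%N -> mdeg a = N -> ~ J 'X_[a] ->
    (pdeg i a < i * (m - 2))%N ->
  exists b, [/\ mdeg b = N, ~ J 'X_[b], (pdeg i a < pdeg i b)%N
    & forall k, (k <= i)%N -> (pdeg k a <= pdeg k b)%N].
Proof.
move=> i_n aN Ja ai.
have hd : ((n - i) * (m - 2) < mdeg (mhi i a))%N.
  rewrite mulnBl ltn_subLR ?leq_mul2r ?i_n ?orbT //.
  by rewrite -aN (mdeg_pdeg i a) ltn_add2r.
have hX : ('X_[mhi i a] : S) \is (mdeg (mhi i a)).-homog by rewrite dhomogX.
have [h hE hh] := gideal_homogE (mixed_kill_homog i) hX (mixed_high i_n hX hd).
apply: contrapT => H; apply: Ja.
rewrite (mlohi i a) mpolyXD hE big_sumType /= mulrDr; apply: gidealD; last first.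
  by apply: gidealMl; apply: gideal_sum => j _; apply: gidealMl; exact: (gideal_gen g).
rewrite mulr_sumr; apply: gideal_sum => j _; rewrite /kill; case: ifP => ji; last first.
  by rewrite !mulr0; exact: gideal0.
have /= [hj _] := hh (inl j); rewrite (mpolyE (h (inl j))) mulr_suml mulr_sumr big_seq.
apply: gideal_sum => c ch; rewrite -scalerAl -scalerAr -!mpolyXD -mul_mpolyC.
apply: gidealMl; apply: contrapT => Jb; apply: H.
exists (mlo i a + (c + U_(j)))%MM; split=> //.
- rewrite !mdegD mdeg1 mdeg_mlo (dhomogP _ _ _ hj _ ch) /= subnK.
    by rewrite -mdeg_pdeg.
  exact: leq_trans hd.
- by rewrite !pdegD pdegU ji pdeg_mlo // addn1 addnS ltnS leq_addr.
- by move=> k ki; rewrite pdegD pdeg_mlo // leq_addr.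
Qed.

(* Iterating the replacement increases the vector of partial degrees at the breakpoints
   lexicographically; this order is encoded in base [N + 1]. *)
Lemma balanced_monomial (brk : pred nat) a : (forall i, brk i -> (i < n)%N) ->
    mdeg a = N -> ~ J 'X_[a] ->
  exists b, [/\ mdeg b = N, ~ J 'X_[b], forall i, brk i -> (i * (m - 2) <= pdeg i b)%N
    & forall k, brk k -> (forall i, brk i -> (k <= i)%N) -> (pdeg k a <= pdeg k b)%N].
Proof.
move=> brk_n; pose V (c : 'X_{1..n}) := (\sum_(i < n | brk i) pdeg i c * N.+1 ^ (n - i))%N.
pose B := (\sum_(i < n) N * N.+1 ^ (n - i))%N.
have VB c : mdeg c = N -> (V c <= B)%N.
  move=> cN; rewrite /V big_mkcond leq_sum // => i _; case: ifP => // _.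
  by rewrite leq_mul2r -{2}cN pdeg_mdeg orbT.
elim: {a}_.+1 {-2}a (ltnSn (B - V a)%N) => // t IHt a at_ aN Ja.
have [ok|/existsNP[i /not_implyP[bi /negP]]] :=
  pselect (forall i, brk i -> (i * (m - 2) <= pdeg i a)%N); first by exists a.
rewrite -ltnNge => ai; have in_ := brk_n _ bi.
have [b [bN Jb ib kb]] := replacement (ltnW in_) aN Ja ai.
have Vab : (V a < V b)%N.
  apply: (@code_increase n N (fun k => brk k) _ _ (Ordinal in_)) => //= [k|k ki].
    by rewrite -aN pdeg_mdeg.
  exact: kb.
have [|c [cN Jc brkc kc]] := IHt b _ bN Jb.
  by rewrite -ltnS (leq_trans _ at_) // ltnS ltn_sub2l // (leq_trans Vab) ?VB.
exists c; split=> // k bk kmin; apply: leq_trans (kc k bk kmin).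
by apply: kb; exact: kmin.
Qed.

Lemma hess_homog : hess Q \is N.-homog.
Proof.
have := @det_homog n F n (\matrix_(i < n, j < n) Q^`M(i)^`M(j)) (fun=> (m - 2)%N).
rewrite sum_nat_const card_ord; apply=> i j; rewrite mxE.
by have := homog_deriv j (jac_homog Qh i); rewrite dE.
Qed.

(** By Euler's formula the gradient at v of the derivative of Q along v is m - 1 times the gradient
    of Q at v, and Q has no critical point but the origin. *)
Lemma deriv_dir_eq0 (v : 'I_n -> F) :
  (forall j, (\sum_k v k *: Q^`M(k))^`M(j).@[v] = 0) -> forall j, v j = 0.
Proof.
move=> Dv; have gv j : (g j).@[v] = 0.
  have /(congr1 (meval v)) := euler (jac_homog Qh j).
  rewrite mevalZ raddf_sum /= => E; apply/eqP.
  have/eqP : d%:R * (Q^`M(j)).@[v] = 0.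
    rewrite -E; apply: etrans (Dv j); rewrite (raddf_sum (mderiv j)) raddf_sum /=.
    by apply: eq_bigr => k _; rewrite mevalM mevalXU linearZ mevalZ /= mderiv_comm.
  by rewrite mulf_eq0 (negPf pred_deg_neq0).
have [e Je] := Qfin => j; have [h /(congr1 (meval v))] := Je j.
rewrite rmorphXn /= mevalXU raddf_sum big1 => [/eqP|k _]; last first.
  by rewrite /= mevalM gv mulr0.
by rewrite expf_eq0 => /andP[_ /eqP].
Qed.

(** * The case where no monomial outside the ideal exceeds the balanced degree *)

Section EqualityCase.
Variable i : nat.
Hypotheses (i_gt0 : (0 < i)%N) (i_lt_n : (i < n)%N).
Local Notation M := (i * (m - 2))%N.
Local Notation N' := ((n - i) * (m - 2))%N.
Hypothesis unbalanced : forall a, mdeg a = N -> (M < pdeg i a)%N -> J 'X_[a].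

Let i_n : (i <= n)%N. Proof. exact: ltnW. Qed.

Lemma equality_NE : N = (M + N')%N.
Proof. by rewrite -mulnDl subnKC. Qed.

(** By duality it is enough to multiply up to degree N, and multiplication does not lower the
    partial degree. *)
Lemma jac_high k p : p \is k.-homog -> (forall a, a \in msupp p -> (M < pdeg i a)%N) -> J p.
Proof.
move=> hp hi; have [w [w1 w2 w3 _]] := milnor_residue m_ge3 pred_deg_neq0 Qh Qfin.
have [Nk|kN] := ltnP N k; first exact: w2 Nk.
apply: (w3 k) => // q hq; have hpq : p * q \is N.-homog.
  by rewrite -(subnKC kN); exact: dhomogM.
apply/w1 => //; apply: jac_monomials => c cpq; apply: unbalanced.
  exact: (dhomogP _ _ _ hpq _ cpq).
have /allpairsP[[a b] /= [/hi ap _ ->]] := msuppM_le cpq.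
by rewrite pdegD (leq_trans ap) // leq_addr.
Qed.

Lemma low_mixed_J p q k : p \is k.-homog ->
  (forall j : 'I_n, (j < i)%N -> J (p * 'X_j)) -> gideal (mixed i g) q -> J (p * q).
Proof.
move=> hp pJ [h ->]; rewrite big_sumType /= mulrDr; apply: gidealD.
  rewrite mulr_sumr; apply: gideal_sum => j _; rewrite mulrCA; apply: gidealMl.
  by rewrite /kill; case: ifP => [/pJ //|_]; rewrite mulr0; exact: gideal0.
by apply: gidealMl; apply: gideal_sum => j _; apply: gidealMl; exact: (gideal_gen g).
Qed.

Lemma cut_kill0 p : gideal (kill F i) p -> cut i p = 0.
Proof.
move=> [h ->]; rewrite rmorph_sum big1 // => j _; rewrite rmorphM /= /kill.
by case: ifP => ji; rewrite ?rmorph0 ?mulr0 // /cut csubX ji mulr0.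
Qed.

Lemma cut_mhi a : cut i 'X_[mhi i a] = 'X_[mhi i a] :> S.
Proof.
apply/mpolyP => c; rewrite mcoeff_cut; case: ifP => // /negbT/forallPn[j].
rewrite negb_imply => /andP[ji cj]; rewrite mcoeffX; case: eqP => // E.
by move: cj; rewrite -E mnmE ji.
Qed.

(** The residue of a low monomial of degree M times a form of degree N' factors, as for a tensor
    product ([cE]). Testing elements of J against such products separates their components by
    partial degree: a derivative, once corrected to vanish where the first i variables are zero,
    involves only these variables. The correction lowers the rank by at most n - i. *)
Lemma jac_low_variables : exists C : 'M[F]_n, (i <= \rank C)%N /\
  forall k a, pdeg i a != d -> (\sum_l C k l *: g l)@_a = 0.
Proof.
have [w [w1 w2 w3 wH]] := milnor_residue m_ge3 pred_deg_neq0 Qh Qfin.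
have [A [G [GE hG Gfin]]] := hsop_system i_n.
have [|w' [w1' w2' w3' _]] := square_residue hG _ Gfin.
  by move=> j; case: ifP => // _; rewrite d0.
rewrite hsop_degree // in w1' w2' w3'.
have G_mixed p : gideal G p -> gideal (mixed i g) p.
  apply: gideal_trans => j; rewrite GE; case: ifP => ji.
    by have := gideal_gen (mixed i g) (inl j); rewrite /= /kill ji.
  apply: gideal_sum => l _; rewrite -mul_mpolyC; apply: gidealMl.
  exact: (gideal_gen (mixed i g) (inr l)).
have [b0 [b0N Jb0 pb0]] : exists b, [/\ mdeg b = N, ~ J 'X_[b] & pdeg i b = M].
  have [a0 [a0N Ja0]] : exists a, mdeg a = N /\ ~ J 'X_[a].
    apply: contrapT => H; case/eqP: wH; apply/w1; first exact: hess_homog.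
    apply: jac_monomials => a /(dhomogP _ _ _ hess_homog) aN; apply: contrapT => Ja.
    by apply: H; exists a.
  have [|b [bN Jb ib _]] := @balanced_monomial (pred1 i) a0 _ a0N Ja0.
    by move=> _ /eqP ->.
  exists b; split=> //; apply/eqP; rewrite eqn_leq ib /= ?eqxx // andbT leqNgt.
  by apply/negP => /(unbalanced bN).
pose h : S := 'X_[mlo i b0]; pose q0 : S := 'X_[mhi i b0].
have hq0 : h * q0 = 'X_[b0] by rewrite -mpolyXD -mlohi.
have q0h : q0 \is N'.-homog.
  by rewrite dhomogX /= -(eqn_add2l M) -equality_NE -b0N -{1}pb0 -mdeg_pdeg.
have low_kill a (j : 'I_n) : pdeg i a = M -> (j < i)%N -> J ('X_[a] * 'X_j).
  move=> aM ji; rewrite -mpolyXD; apply: (@jac_high (mdeg (a + U_(j)))).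
    by rewrite dhomogX.
  by move=> c; rewrite msuppX inE => /eqP ->; rewrite pdegD pdegU ji aM addn1.
have low_J a q : pdeg i a = M -> gideal (mixed i g) q -> J ('X_[a] * q).
  move=> aM; apply: (@low_mixed_J _ _ (mdeg a)); first by rewrite dhomogX.
  by move=> j; exact: low_kill.
have hM : pdeg i (mlo i b0) = M by rewrite pdeg_mlo.
have w'q0 : w' q0 != 0.
  by apply/eqP => /w1' H; apply: Jb0; rewrite -hq0; apply: low_J => //; apply/G_mixed/H.
(* The quotient by [G] is one-dimensional in degree N', spanned by [q0]. *)
have red q : q \is N'.-homog -> gideal (mixed i g) (q - (w' q / w' q0) *: q0).
  move=> hq; apply: G_mixed; apply/w1'.
    by apply: rpredB => //; exact: rpredZ.
  by rewrite raddfB /= linearZ /= divfK // subrr.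
(* Otherwise [q0] would be proportional to a multiple of [g k] modulo the mixed ideal, and ['X_[b0]]
   would lie in J. *)
have jac_G k : gideal G (g k).
  apply: contrapT => nG.
  have [q [qh qnz]] : exists q, g k * q \is N'.-homog /\ w' (g k * q) != 0.
    have [dN'|N'd] := leqP d N'; last by case: nG; exact: w2' (jac_homog Qh k) N'd.
    apply: contrapT => H; apply: nG; apply: (w3' _ _ dN' (jac_homog Qh k)) => q hq.
    apply: contrapT => /eqP nz; apply: H; exists q; split=> //.
    by rewrite -(subnKC dN'); apply: dhomogM => //; exact: jac_homog.
  apply: Jb0; rewrite -hq0; apply: low_J => //.
  have gq : gideal (mixed i g) (g k * q).
    by apply: gidealMr; exact: (gideal_gen (mixed i g) (inr k)).
  have := red _ qh; move/(gidealB gq); rewrite opprB addrCA subrr addr0.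
  move/(gidealMl ((w' (g k * q) / w' q0)^-1%:MP)).
  by rewrite mul_mpolyC scalerA mulVf ?scale1r // mulf_neq0 ?invr_eq0.
pose c a := w ('X_[a] * q0) / w 'X_[b0].
have wb0 : w 'X_[b0] != 0.
  by apply/eqP => /w1 H; apply/Jb0/H; rewrite dhomogX; apply/eqP.
have wN' a q : pdeg i a = M -> mdeg a = M -> q \is N'.-homog ->
    w ('X_[a] * q) = w' q / w' q0 * w ('X_[a] * q0).
  move=> aM aM' hq; apply/eqP; rewrite -subr_eq0 -(linearZ_LR w) -raddfB; apply/eqP/w1.
    have hX p : p \is N'.-homog -> 'X_[a] * p \is N.-homog.
      by move=> hp; rewrite equality_NE; apply: dhomogM => //; rewrite dhomogX; apply/eqP.
    by apply: rpredB; [exact: hX | apply: rpredZ; exact: hX].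
  by rewrite scalerAr -mulrBr; apply: low_J => //; exact: red.
have cE a q : pdeg i a = M -> mdeg a = M -> q \is N'.-homog ->
    w ('X_[a] * q) = c a * w (h * q).
  move=> aM aM' hq; rewrite wN' // [w (h * q)]wN' ?mdeg_mlo // hq0 /c.
  by rewrite mulrCA divfK.
have wJ p : p \is N.-homog -> J p -> w p = 0 by move=> hp /w1; exact.
(* Induction on the partial degree p; for p = 0 the claim is that [g0] vanishes where the first i
   variables are zero. *)
have lowvars g0 : g0 \is d.-homog -> J g0 -> gideal (kill F i) g0 ->
    forall (p : nat) (a : 'X_{1..n}), (p < d)%N -> pdeg i a = p -> g0@_a = 0.
  move=> hg0 Jg0 kg0; elim/ltn_ind => p IHp a pd ap.
  have [p0|p_gt0] := posnP p.
    have /mpolyP/(_ a) := cut_kill0 kg0; rewrite mcoeff_cut mcoeff0.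
    rewrite ifT //; apply/forallP => j; apply/implyP => ji.
    by apply/eqP; apply: (@pdeg0P _ i) => //; rewrite ap.
  have p_le : (p <= m - 2)%N by rewrite -ltnS -dE.
  have pM : (p <= M)%N by apply: leq_trans p_le _; rewrite leq_pmull.
  have dpN' : (d - p <= N')%N.
    apply: (@leq_trans (m - 2)); last by rewrite leq_pmull // subn_gt0.
    by rewrite dE leq_subLR -addn1 addnC leq_add2r.
  have NE' (t : 'X_{1..n}) : mdeg t = (M - p)%N -> (d + mdeg t + (N' - (d - p)) = N)%N.
    move=> ->; rewrite equality_NE; move: pM dpN' (ltnW pd).
    by move: M N' d => x y z; clear; lia.
  pose g1 := \sum_(u <- msupp g0 | pdeg i u == p) g0@_u *: 'X_[u].
  have hg1 : g1 \is d.-homog.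
    rewrite /g1 big_seq_cond; apply: rpred_sum => u /andP[/(dhomogP _ _ _ hg0) ud _].
    by apply: rpredZ; rewrite dhomogX; apply/eqP.
  (* The components of [g0] of partial degree below p vanish by induction; those above p are pushed
     beyond M by [t], hence into J. *)
  have Jg1 t q : mdeg t = (M - p)%N -> pdeg i t = (M - p)%N ->
      q \is (N' - (d - p))%N.-homog -> w (g1 * ('X_[t] * q)) = 0.
    move=> mt pt hq.
    have hN p' : p' \is d.-homog -> p' * ('X_[t] * q) \is N.-homog.
      move=> hp'; rewrite -(NE' t mt) -addnA; apply: dhomogM => //; apply: dhomogM => //.
      by rewrite dhomogX.
    have J2 : J ((g0 - g1) * ('X_[t] * q)).
      have -> : g0 - g1 = \sum_(u <- msupp g0 | pdeg i u != p) g0@_u *: 'X_[u].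
        by rewrite {1}(mpolyE g0) (bigID (fun u => pdeg i u == p)) /= addrAC subrr add0r.
      rewrite mulr_suml; apply: gideal_sum => u up.
      rewrite -scalerAl mulrA -mpolyXD -mul_mpolyC.
      have [pu|pu] := ltnP (pdeg i u) p.
        by rewrite (IHp _ pu u (ltn_trans pu pd) erefl) mpolyC0 mul0r; exact: gideal0.
      apply: gidealMl; apply: gidealMr; apply: (@jac_high (mdeg (u + t))).
        by rewrite dhomogX.
      move=> e; rewrite msuppX inE => /eqP ->; rewrite pdegD pt.
      by rewrite -{1}(subnKC pM) ltn_add2r ltn_neqAle eq_sym up.
    have -> : g1 = g0 - (g0 - g1) by rewrite opprB addrCA subrr addr0.
    rewrite mulrBl raddfB /= !wJ ?subrr //; first by apply: hN; rewrite rpredB.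
      exact: hN.
    exact: gidealMr.
  (* The low part of [g1] is contracted against [t] through [c], which leaves a form in the last n -
     i variables. *)
  pose sig t := \sum_(u <- msupp g0 | pdeg i u == p)
    (g0@_u * c (mlo i u + t)%MM) *: 'X_[mhi i u].
  have mhiu u : u \in msupp g0 -> pdeg i u = p -> mdeg (mhi i u) = (d - p)%N.
    by move=> /(dhomogP _ _ _ hg0) <- <-; rewrite /= (mdeg_pdeg i u) addKn.
  have hsig t : sig t \is (d - p)%N.-homog.
    rewrite /sig big_seq_cond; apply: rpred_sum => u /andP[ug /eqP up].
    by apply: rpredZ; rewrite dhomogX /= mhiu.
  have lot (u t : 'X_{1..n}) : mdeg t = (M - p)%N -> pdeg i t = (M - p)%N -> pdeg i u = p ->
      pdeg i (mlo i u + t) = M /\ mdeg (mlo i u + t) = M.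
    by move=> mt pt up; rewrite pdegD mdegD mdeg_mlo pdeg_mlo // up pt mt subnKC.
  have sig0 t : mdeg t = (M - p)%N -> pdeg i t = (M - p)%N -> sig t = 0.
    move=> mt pt; have Gs : gideal G (sig t).
      apply: (w3' _ _ dpN' (hsig t)) => q hq.
      have hsq : sig t * q \is N'.-homog by rewrite -(subnKC dpN'); exact: dhomogM.
      have hm : mdeg (mlo i b0) = M by rewrite mdeg_mlo pb0.
      have := wN' _ _ hM hm hsq; rewrite hq0.
      have -> : w ('X_[mlo i b0] * (sig t * q)) = 0.
        rewrite -(Jg1 t q mt pt hq) -/h /sig /g1 !mulr_suml mulr_sumr !raddf_sum /=.
        rewrite big_seq_cond [RHS]big_seq_cond; apply: eq_bigr => u /andP[ug /eqP up].
        have [pl ml] := lot u t mt pt up.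
        have hq' : 'X_[mhi i u] * q \is N'.-homog.
          rewrite -(subnKC dpN'); apply: dhomogM => //.
          by rewrite dhomogX /= mhiu.
        rewrite -!scalerAl -scalerAr !(linearZ_LR w) -mulrA -cE //; congr (_ * w _).
        by rewrite [in RHS](mlohi i u) !mpolyXD mulrACA.
      move/esym/eqP; rewrite !mulf_eq0 (negPf wb0) orbF invr_eq0 (negPf w'q0) orbF.
      by move/eqP.
    (* The degree d - p is below d, so only the variables among the [G j] contribute; but [sig t]
       does not involve them. *)
    have [e se he] := gideal_homogE hG (hsig t) Gs.
    have ks : gideal (kill F i) (sig t).
      rewrite se; apply: gideal_sum => j _; have := he j; rewrite GE; case: ifP => ji [_ he0].
        by apply: gidealMl; have := gideal_gen (kill F i) j; rewrite /kill ji.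
      by rewrite he0 ?mul0r ?ltn_subrL ?p_gt0 ?d0 //; exact: gideal0.
    rewrite -(cut_kill0 ks) /sig rmorph_sum; apply: eq_bigr => u _ /=.
    by rewrite /cut csubZ -/(cut i _) cut_mhi.
  (* The coefficient in [g0] of a fixed monomial in the last variables, as a form of degree p in the
     first ones. *)
  pose tau := \sum_(u <- msupp g0 | (pdeg i u == p) && (mhi i u == mhi i a))
    g0@_u *: 'X_[mlo i u].
  have htau : tau \is p.-homog.
    apply: rpred_sum => u /andP[/eqP up _]; apply: rpredZ.
    by rewrite dhomogX /= mdeg_mlo up.
  have Jtau t : mdeg t = (M - p)%N -> pdeg i t = (M - p)%N -> J (tau * 'X_[t]).
    move=> mt pt; have hT : tau * 'X_[t] \is M.-homog.
      by rewrite -(subnKC pM) -mt; apply: dhomogM => //; rewrite dhomogX.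
    apply: (w3 M) => //; first by rewrite equality_NE leq_addr.
    rewrite equality_NE addKn => q hq.
    have <- : (sig t)@_(mhi i a) * w (h * q) = w (tau * 'X_[t] * q).
      rewrite /tau !mulr_suml /sig !raddf_sum mulr_suml /=.
      rewrite [RHS]big_mkcondr /=; apply: eq_bigr => u /eqP up.
      have [pl ml] := lot u t mt pt up.
      rewrite mcoeffZ mcoeffX; case: eqP => [_|]; last by rewrite mulr0 mul0r.
      by rewrite mulr1n mulr1 -mulrA -cE // mpolyXD -!scalerAl (linearZ_LR w).
    by rewrite sig0 // mcoeff0 mul0r.
  (* Descent from [t] of degree M - p to [t] = 1. A form killed by the first i variables modulo J is
     killed by the mixed ideal, which contains every form of degree above N'; duality then puts it
     in J. *)
  have Jtau' k t : (k <= M - p)%N -> mdeg t = (M - p - k)%N ->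
      pdeg i t = (M - p - k)%N -> J (tau * 'X_[t]).
    elim: k t => [|k IHk] t kM mt pt; first by apply: Jtau; rewrite ?mt ?pt subn0.
    have hT : tau * 'X_[t] \is (M - k.+1)%N.-homog.
      have -> : (M - k.+1 = p + mdeg t)%N.
        by rewrite mt subnAC [RHS]subnKC // leq_subRL ?(leq_trans kM) ?leq_subr // addnC -leq_subRL.
      by apply: dhomogM => //; rewrite dhomogX.
    have kM' : (k.+1 <= M)%N by apply: leq_trans kM (leq_subr _ _).
    apply: (w3 _ _ _ hT).
      by rewrite equality_NE (leq_trans (leq_subr _ _)) // leq_addr.
    move=> q hq; apply: wJ.
      rewrite -[X in X.-homog](@subnKC (M - k.+1)); first exact: dhomogM.
      by rewrite equality_NE (leq_trans (leq_subr _ _)) // leq_addr.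
    apply: (low_mixed_J hT) => [j ji|].
      rewrite -mulrA -mpolyXD; apply: IHk; first exact: ltnW.
        by rewrite mdegD mdeg1 mt addn1 subnSK.
      by rewrite pdegD pdegU ji pt addn1 subnSK.
    apply/G_mixed/(w2' _ _ hq); rewrite equality_NE; move: kM'.
    by move: M N' => x y; clear; lia.
  have tau0 : tau = 0.
    apply: (jac_deg_lt htau pd); rewrite -[tau]mulr1 -mpolyX0.
    by apply: (Jtau' (M - p)%N) => //; rewrite subnn ?mdeg0 // /pdeg big1 // => j _; rewrite mnm0E.
  have [ag|/memN_msupp_eq0 //] := boolP (a \in msupp g0).
  have /(congr1 (mcoeff (mlo i a))) := tau0; rewrite mcoeff0 raddf_sum /=.
  rewrite -big_filter (bigD1_seq a) /= ?filter_uniq ?msupp_uniq //; last first.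
    by rewrite mem_filter ap !eqxx ag.
  rewrite mcoeffZ mcoeffX eqxx mulr1 big_filter_cond big1 ?addr0 // => u.
  case/andP=> /andP[/eqP up /eqP uhi] ua; rewrite mcoeffZ mcoeffX.
  by case: eqP => [ulo|]; rewrite ?mulr0 //; case/eqP: ua; apply: (@mhi_eq _ i).
have /choice[L LE] : forall k, exists l : 'I_n -> F, gideal (kill F i)
    (g k - \sum_(j < n) (if (j < i)%N then 0 else l j) *: G j).
  move=> k.
  have [e ge he] := gideal_homogE hG (jac_homog Qh k) (jac_G k).
  exists (fun j => (e j)@_0); rewrite {1}ge -sumrB; apply: gideal_sum => j _.
  have := he j; rewrite GE; case: ifP => ji [hj _].
    rewrite scale0r subr0; apply: gidealMl.
    by have := gideal_gen (kill F i) j; rewrite /kill ji.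
  rewrite subnn in hj; have ej0 : e j = mpolyC n (e j)@_0%MM.
    apply/mpolyP => a; rewrite mcoeffC; case: eqP => [->|/eqP a0]; first by rewrite mulr1.
    by rewrite mulr0 (dhomog_nemf_coeff hj) //= mdeg_eq0.
  by rewrite {1}ej0 mul_mpolyC subrr; exact: gideal0.
(* Only the n - i columns from i on can be nonzero, which bounds the rank of [L' *m A]. *)
pose L' : 'M[F]_n := \matrix_(k, j) (if (j < i)%N then 0 else L k j).
exists (1%:M - L' *m A); split.
  have L'E : L' = L' *m copid_mx i.
    apply/matrixP => k j; rewrite [RHS]mxE (bigD1 j) //= big1 ?addr0 => [|l lj].
      rewrite !mxE eqxx /=; case: (j < i)%N; rewrite ?mul0r //.
      by rewrite andbF subr0 mulr1.
    have lj' : (l == j :> nat) = false by apply/negbTE.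
    by rewrite !mxE (negPf lj) lj' /= subrr mulr0.
  have rL : (\rank (L' *m A) <= n - i)%N.
    rewrite L'E -mulmxA -(rank_copid_mx F i_n).
    by apply: leq_trans (mxrankM_maxr _ _) _; exact: mxrankM_maxl.
  have := mxrank_add (1%:M - L' *m A) (L' *m A); rewrite subrK mxrank1 => nC.
  by rewrite -(leq_add2r (n - i)) subnKC // (leq_trans nC) // leq_add2l.
move=> k.
have E : \sum_l (1%:M - L' *m A) k l *: g l =
    g k - \sum_(j < n) (if (j < i)%N then 0 else L k j) *: G j.
  under eq_bigr => l _ do rewrite mxE [X in _ + X]mxE scalerBl.
  rewrite sumrB; congr (_ - _).
    rewrite (bigD1 k) //= mxE eqxx scale1r big1 ?addr0 // => l lk.
    by rewrite mxE eq_sym (negPf lk) scale0r.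
  under eq_bigr => l _ do rewrite mxE scaler_suml.
  rewrite exchange_big; apply: eq_bigr => j _ /=; rewrite GE.
  case: ifP => ji.
    by rewrite scale0r big1 // => l _; rewrite !mxE ji mul0r scale0r.
  by rewrite scaler_sumr; apply: eq_bigr => l _; rewrite !mxE ji scalerA.
set gk := \sum_l _ *: _.
have hgk : gk \is d.-homog by apply: rpred_sum => l _; apply: rpredZ; exact: jac_homog.
have Jgk : J gk.
  apply: gideal_sum => l _; rewrite -mul_mpolyC; apply: gidealMl; exact: (gideal_gen g).
have kgk : gideal (kill F i) gk by rewrite /gk E; exact: LE.
move=> a pa; have [ma|ma] := eqVneq (mdeg a) d; last exact: dhomog_nemf_coeff hgk ma.
apply: (lowvars _ hgk Jgk kgk (pdeg i a)) => //.
by rewrite ltn_neqAle pa -ma pdeg_mdeg.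
Qed.
End EqualityCase.

(* In the equality case [n] independent derivatives of [Q] split between two complementary
   sets of variables, and [Q] is a sum of forms in disjoint variables. *)
Lemma strict_monomial i : (0 < i < n)%N ->
    (forall q, q \is m.-homog -> (forall k, J q^`M(k)) -> exists c, q = c *: Q) ->
  exists a, [/\ mdeg a = N, ~ J 'X_[a] & (i * (m - 2) < pdeg i a)%N].
Proof.
move=> /andP[i_gt0 i_n] irr; apply: contrapT => H.
have [|C [rC Cg]] := jac_low_variables i_gt0 i_n.
  by move=> a aN ai; apply: contrapT => Ja; apply: H; exists a.
pose pr : 'M[F]_(n, i) := \matrix_(k, j) (k == j :> nat)%:R.
have widE (j : 'I_i) : (widen_ord (ltnW i_n) j < i)%N by rewrite /=.
have CprE (u : 'rV[F]_n) (j : 'I_i) : (u *m pr) 0 j = u 0 (widen_ord (ltnW i_n) j).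
  rewrite mxE (bigD1 (widen_ord (ltnW i_n) j)) //= mxE eqxx mulr1 big1 ?addr0 // => k kj.
  by rewrite mxE; case: eqP => [E|]; rewrite ?mulr0 //; case/eqP: kj; apply: val_inj.
have comb (x : 'rV[F]_n) a : pdeg i a != d -> (\sum_l (x *m C) 0 l *: g l)@_a = 0.
  move=> pa; have -> : \sum_l (x *m C) 0 l *: g l = \sum_k x 0 k *: \sum_l C k l *: g l.
    under eq_bigr => l _ do rewrite mxE scaler_suml.
    rewrite exchange_big; apply: eq_bigr => k _ /=; rewrite scaler_sumr.
    by apply: eq_bigr => l _; rewrite scalerA.
  by rewrite raddf_sum big1 // => k _ /=; rewrite mcoeffZ Cg // mulr0.
have homD (u : 'rV[F]_n) : \sum_l u 0 l *: g l \is d.-homog.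
  by apply: rpred_sum => l _; apply: rpredZ; exact: jac_homog.
(* Along a direction [x *m C] whose first i coordinates are zero, the derivative of Q involves only
   the first i variables, so its gradient vanishes at that very direction. *)
have injC (x : 'rV[F]_n) : x *m C *m pr = 0 -> x *m C = 0.
  move=> /rowP x0; apply/rowP => j; rewrite [RHS]mxE.
  have vlow (k : 'I_n) : (k < i)%N -> (x *m C) 0 k = 0.
    move=> ki; have := x0 (Ordinal ki); rewrite CprE [RHS]mxE => E.
    by rewrite -[RHS]E; congr (_ 0 _); apply: val_inj.
  apply: (deriv_dir_eq0 (v := (x *m C) 0)) => {j} j.
  rewrite mevalE big1 // => a _; rewrite mcoeff_deriv.
  have [pa|pa] := eqVneq (pdeg i (a + U_(j))) d; last by rewrite comb // mul0rn mul0r.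
  have [|l li al] := @pdeg_gt0 n i a.
    have := leq_b1 (j < i)%N; move: pa; rewrite pdegD pdegU dE.
    by move: m_ge3; case: (j < i)%N; move: (pdeg i a) => y; lia.
  by rewrite [X in _ * X](bigD1 l) //= (vlow l li) expr0n eqn0Ngt al mul0r mulr0.
have [X XE] : exists X : 'M[F]_(i, n), X *m (C *m pr) = 1%:M.
  apply/row_fullP; rewrite /row_full eqn_leq rank_leq_col /=.
  rewrite -(mxrank_mul_ker C pr) in rC; suff E0 : (C :&: kermx pr)%MS = 0.
    by move: rC; rewrite E0 mxrank0 addn0.
  apply/eqP; rewrite -submx0; apply/rV_subP => v; rewrite sub_capmx.
  case/andP=> /submxP[x ->] /sub_kermxP /injC ->; exact: sub0mx.
(* For j < i, row j is a direction that agrees with the j-th unit vector in the first i coordinates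
   and along which the derivative of Q involves only the first i variables; the later rows are
   zero. *)
pose W : 'M[F]_n := pr *m X *m C.
have WhiE (j l : 'I_n) : (i <= j)%N -> W j l = 0.
  move=> ij; rewrite /W -mulmxA mxE big1 // => k _; rewrite mxE.
  case: eqP => [E|]; rewrite ?mul0r //.
  by have := ltn_ord k; rewrite -E ltnNge ij.
have WloE (j l : 'I_n) : (j < i)%N -> (l < i)%N -> W j l = (j == l)%:R.
  move=> ji li; transitivity ((pr *m (X *m (C *m pr))) j (Ordinal li)); last by rewrite XE mulmx1 mxE.
  rewrite !mulmxA -/W [RHS]mxE (bigD1 l) //= [pr _ _]mxE eqxx mulr1 big1 ?addr0 // => k kl.
  by rewrite [pr _ _]mxE; case: eqP => [E|]; rewrite ?mulr0 //; case/eqP: kl; apply: val_inj.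
pose D j : S := \sum_l W j l *: g l.
have hD j : D j \is d.-homog by apply: rpred_sum => l _; apply: rpredZ; exact: jac_homog.
have Dcoef j a : pdeg i a != d -> (D j)@_a = 0.
  move=> pa; rewrite -(comb (row j (pr *m X)) a pa) -row_mul; congr mcoeff.
  by apply: eq_bigr => l _; rewrite [row _ _ _ _]mxE.
have Dhi j (k : 'I_n) : (i <= k)%N -> (D j)^`M(k) = 0.
  move=> ik; apply/mpolyP => a; rewrite mcoeff_deriv mcoeff0.
  have [pa|pa] := eqVneq (pdeg i (a + U_(k))) d; last by rewrite Dcoef // mul0rn.
  rewrite (dhomog_nemf_coeff (hD j)) ?mul0rn //=; move: pa.
  by rewrite pdegD pdegU mdegD mdeg1 ltnNge ik addn0 => <-; have := pdeg_mdeg i a; lia.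
have DW j k : (D j)^`M(k) = \sum_l W k l *: (D j)^`M(l).
  have [ki|ik] := ltnP k i; last first.
    by rewrite Dhi // big1 // => l _; rewrite WhiE // scale0r.
  rewrite (bigD1 k) //= WloE // eqxx scale1r big1 ?addr0 // => l lk.
  have [li|il] := ltnP l i; last by rewrite Dhi // scaler0.
  by rewrite WloE // eq_sym (negPf lk) scale0r.
have DC j k : (D j)^`M(k) = (D k)^`M(j).
  rewrite DW [RHS]DW /D; under eq_bigr => l _ do rewrite (raddf_sum (mderiv l)) scaler_sumr.
  under [RHS]eq_bigr => l _ do rewrite (raddf_sum (mderiv l)) scaler_sumr.
  rewrite exchange_big; apply: eq_bigr => r _; apply: eq_bigr => l _ /=.
  by rewrite !linearZ /= !scalerA mulrC mderiv_comm.
(* Up to a factor, the summand of Q in the first i variables. Its partial derivatives are multiples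
   of the [D k], hence lie in J, so [irr] makes it a multiple of Q. *)
pose Q' : S := \sum_j 'X_j * D j.
have hQ' : Q' \is m.-homog.
  apply: rpred_sum => j _; have -> : m = (1 + d)%N by rewrite dE; lia.
  by apply: dhomogM => //; rewrite dhomogX /= mdeg1.
have dQ' k : Q'^`M(k) = m%:R *: D k.
  have XU (j : 'I_n) : ('X_j : S)^`M(k) = (j == k)%:R.
    rewrite mderivX mnm1E; case: eqP => [->|_]; last by rewrite scale0r.
    have -> : (U_(k) - U_(k))%MM = 0%MM by apply/mnmP => l; rewrite mnmBE mnm0E subnn.
    by rewrite scale1r mpolyX0.
  rewrite /Q' (raddf_sum (mderiv k)) /=.
  under eq_bigr => j _ do rewrite mderivM XU DC.
  rewrite big_split /= (euler (hD k)) (bigD1 k) //= eqxx mul1r big1 ?addr0.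
    have -> : m = d.+1 by rewrite dE; lia.
    by rewrite mulrS scalerDl scale1r.
  by move=> j jk; rewrite (negPf jk) mul0r.
have [|c Qc] := irr Q' hQ'.
  move=> k; rewrite dQ' -mul_mpolyC; apply: gidealMl; apply: gideal_sum => l _.
  rewrite -mul_mpolyC; apply: gidealMl; exact: (gideal_gen g).
have Dc k : m%:R *: D k = c *: g k by rewrite -dQ' Qc linearZ.
have m0 : m%:R != 0 :> F by case: (m) m_ge3 => // m' _; exact: F0.
(* [Q'] does not depend on the variable of index i, whereas Q does. *)
have c0 : c = 0.
  pose k := Ordinal i_n; have /esym/eqP := Dc k.
  have -> : D k = 0 by rewrite /D big1 // => l _; rewrite WhiE ?scale0r.
  rewrite scaler0 scaler_eq0 => /orP[/eqP // |/eqP gk0].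
  have := @deriv_dir_eq0 (fun j => (j == k)%:R) _ k; rewrite eqxx => E.
  have E1 : 1 = 0 :> F.
    apply: E => j; rewrite (bigD1 k) //= eqxx scale1r gk0 add0r big1 ?linear0 ?meval0 // => l lk.
    by rewrite (negPf lk) scale0r.
  by move/eqP: E1; rewrite oner_eq0.
pose k := Ordinal (leq_ltn_trans (leq0n i) i_n).
have D0 : D k = 0.
  by have /eqP := Dc k; rewrite c0 scale0r scaler_eq0 (negPf m0) => /eqP.
have := deriv_dir_eq0 (v := W k) _ k; rewrite -/(D k) D0 WloE // eqxx => E.
have E1 : 1 = 0 :> F by apply: E => j; rewrite linear0 meval0.
by move/eqP: E1; rewrite oner_eq0.
Qed.

End Stability.

(** * From monomials outside the ideal to elementary divisors *)

Section DiagonalStability.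
Variables (n m : nat) (F K : fieldType) (Q : {mpoly F[n]}) (O : K -> Prop).
Hypothesis m_ge3 : (3 <= m)%N.
Hypothesis F0 : char0 F.
Hypothesis Qh : Q \is m.-homog.
Local Notation J := (gideal (fun j => Q^`M(j))).
Hypothesis Qfin : exists e, forall i, J ('X_i ^+ e).
Hypothesis irr : forall q, q \is m.-homog -> (forall k, J q^`M(k)) -> exists c, q = c *: Q.
Hypotheses (O1 : O 1) (OM : forall x y, O x -> O y -> O (x * y)).

Lemma mult_closed_exp x k : O x -> O (x ^+ k).
Proof. by move=> Ox; elim: k => [|k IHk]; rewrite ?expr0 // exprS; exact: OM. Qed.

(** Each [D j] is the last entry divided by the successive quotients from j on. The quotient between
    i and i + 1 occurs for every j <= i, so its exponent is a partial degree. *)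
Lemma prod_telescope (D : nat -> K) (c : 'I_n -> nat) :
    (forall j, (j < n)%N -> D j != 0) ->
  \prod_(j < n) D j ^+ c j *
    \prod_(i < n.-1) (D i.+1 / D i) ^+ (\sum_(j < n | (j < i.+1)%N) c j) =
  D n.-1 ^+ \sum_(j < n) c j.
Proof.
move=> D0; have T (j : 'I_n) : D n.-1 = D j * \prod_(i < n.-1 | (j < i.+1)%N) (D i.+1 / D i).
  have H k : (j <= k < n)%N -> D k = D j * \prod_(i < k | (j < i.+1)%N) (D i.+1 / D i).
    elim: k => [|k IHk] /andP[jk kn].
      by rewrite big_ord0 mulr1; move: jk; rewrite leqn0 => /eqP ->.
    move: jk; rewrite leq_eqVlt => /orP[/eqP jk|jk].
      rewrite big1 => [|i]; first by rewrite mulr1 jk.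
      by rewrite ltnS jk leqNgt ltn_ord.
    rewrite big_mkcond big_ord_recr /= -big_mkcond /= jk mulrA.
    rewrite -IHk; first by rewrite mulrC divfK // D0 // ltnW.
    by rewrite -ltnS jk ltnW.
  by apply: H; have := ltn_ord j; move: (j : nat) => x; clear; lia.
rewrite -prodrXr.
under [RHS]eq_bigr => j _ do rewrite (T j) exprMn -prodrXl.
rewrite big_split /=; congr (_ * _).
under [RHS]eq_bigr => j _ do rewrite big_mkcond.
rewrite exchange_big; apply: eq_bigr => i _ /=.
by rewrite -prodrXr big_mkcond.
Qed.

(** A break is an index where the quotient of consecutive entries is not a unit. A monomial balanced
    at all breaks and strictly above balance at the first one gives x in O, and x times nonnegative
    powers of the non-unit quotients and units is 1. The strict excess then puts the inverse of the
    first non-unit quotient in O. *)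
Lemma diagonal_stable (D : nat -> K) : (forall j, (j < n)%N -> D j != 0) ->
    (forall j, (j.+1 < n)%N -> O (D j.+1 / D j)) ->
    (forall a, mdeg a = (n * (m - 2))%N -> ~ J 'X_[a] ->
      O (\prod_(j < n) D j ^+ a j / (\prod_(j < n) D j) ^+ (m - 2))) ->
  forall j, (j.+1 < n)%N -> O (D j / D j.+1).
Proof.
move=> D0 DO DJ.
pose brk i := [&& (0 < i)%N, (i < n)%N & `[< ~ O (D i.-1 / D i) >]].
suff nobrk : forall i, ~~ brk i.
  move=> j jn; apply: contrapT => H; case/negP: (nobrk j.+1).
  by rewrite /brk jn /=; apply/asboolP.
move=> i0; apply/negP => bi0.
have [i [bi imin]] : exists i, brk i /\ forall k, brk k -> (i <= k)%N.
  by exists (ex_minn (ex_intro _ i0 bi0)); case: ex_minnP.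
have /and3P[i_gt0 i_n /asboolP nOi] := bi.
have [|a [aN Ja ia]] := strict_monomial m_ge3 F0 Qh Qfin (i := i) _ irr.
  by rewrite i_gt0.
have [|b [bN Jb brkb ib]] := balanced_monomial m_ge3 F0 Qh Qfin (brk := brk) _ aN Ja.
  by move=> k /and3P[].
(* Balancing does not lower the partial degree at the first break, so the inequality stays strict
   there. *)
have {}ib := leq_trans ia (ib i bi imin).
pose E k := D k.+1 / D k.
have E0 (k : 'I_n.-1) : E k != 0.
  have kn : (k.+1 < n)%N by rewrite -ltn_predRL.
  by apply: mulf_neq0; rewrite ?invr_eq0; apply: D0 => //; exact: ltnW.
have := prod_telescope (fun j => b j) D0; rewrite -mdegE bN.
have := prod_telescope (fun=> (m - 2)%N) D0; rewrite sum_nat_const card_ord prodrXl => <- eqE.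
pose t k := (k.+1 * (m - 2))%N.
have tE (k : 'I_n.-1) : (\sum_(j < n | (j < k.+1)%N) (m - 2) = t k)%N.
  have kn : (k.+1 < n)%N by rewrite -ltn_predRL.
  rewrite -(big_mkord (fun j => (j < k.+1)%N) (fun=> (m - 2)%N)).
  by rewrite -(big_nat_widen _ _ _ xpredT) ?sum_nat_const_nat ?subn0 // ltnW.
have OE (k : 'I_n.-1) : O (E k) by apply: DO; rewrite -ltn_predRL.
have unitE (k : 'I_n.-1) : ~~ brk k.+1 -> O (E k)^-1.
  rewrite /brk /= -ltn_predRL ltn_ord /= => /asboolP; rewrite invf_div.
  exact: contrapT.
(* The net exponent is nonnegative at a break; elsewhere [E k] is a unit and the exponent may have
   any sign. *)
pose f (k : 'I_n.-1) := E k ^+ pdeg k.+1 b / E k ^+ t k.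
have Of k : O (f k).
  have [bk|nbk] := boolP (brk k.+1).
    by rewrite /f -expfB_cond ?(negPf (E0 k)) //; [exact: mult_closed_exp | exact: brkb].
  by rewrite /f -exprVn; apply: OM; apply: mult_closed_exp => //; exact: unitE.
have iP : (i.-1 < n.-1)%N by rewrite -ltnS !prednK // (leq_ltn_trans _ i_n).
pose i' := Ordinal iP; apply: nOi.
have fi : O (f i' / E i').
  rewrite /f /= prednK // /t /= prednK // -mulrA -invfM -exprSr -expfB_cond ?(negPf (E0 i')) //.
  by apply: mult_closed_exp; exact: (OE i').
have Px := DJ b bN Jb; set x := _ / _ in Px.
have x1 : x * \prod_k f k = 1.
  rewrite /f prodf_div /x mulrACA -invfM; rewrite eqE.
  rewrite (eq_bigr (fun k : 'I_n.-1 => E k ^+ t k)) ?divff //.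
    rewrite mulf_neq0 ?expf_neq0 //; apply/prodf_neq0 => k _; first exact: D0.
    exact: expf_neq0.
  by move=> k _; rewrite tE.
have -> : D i.-1 / D i = (E i')^-1 by rewrite invf_div /= prednK.
have -> : (E i')^-1 = x * (f i' / E i' * \prod_(k < n.-1 | k != i') f k).
  by rewrite -[LHS]mul1r -[X in X * _]x1 (bigD1 i') //= -[LHS]mulrA [X in x * X]mulrAC.
by apply: OM => //; apply: OM => //; elim/big_ind: (\prod_(k | _) _).
Qed.

End DiagonalStability.

(** * The Nullstellensatz over an uncountable field *)

Definition is_ideal (S : comNzRingType) (I : set S) :=
  [/\ I 0, forall p q, I p -> I q -> I (p + q) & forall p q, I q -> I (p * q)].

Lemma maximal_ideal (S : comNzRingType) (I : set S) : is_ideal I -> ~ I 1 ->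
  exists M : set S, [/\ is_ideal M, forall x, I x -> M x, ~ M 1
    & forall x, ~ M x -> exists y, M (y * x - 1)].
Proof.
move=> idI I1; pose P (A : set S) := [/\ is_ideal A, forall x, I x -> A x & ~ A 1].
have [|A [PA Amax]] := @Zorn_bigcup S (fun A => A = classical_sets.set0 \/ P A).
  move=> F FP tF; have [[A FA [a Aa]]|H] := pselect (exists2 A, F A & exists a, A a); last first.
    left; apply/seteqP; split=> x // [A FA Ax]; case: H; exists A => //; by exists x.
  right; have FQ B : F B -> (exists b, B b) -> P B.
    by move=> FB [b Bb]; have [B0|//] := FP B FB; rewrite B0 in Bb.
  have [[A0 AD AM] IA A1] := FQ A FA (ex_intro _ a Aa).
  split; [split|..]; first by exists A.
  - move=> p q [B FB Bp] [B' FB' B'q].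
    have [BB|BB] := tF B B' FB FB'.
      have [[_ D _] _ _] := FQ B' FB' (ex_intro _ q B'q).
      by exists B' => //; apply: D => //; exact: BB.
    have [[_ D _] _ _] := FQ B FB (ex_intro _ p Bp).
    by exists B => //; apply: D => //; exact: BB.
  - move=> p q [B FB Bq]; have [[_ _ M] _ _] := FQ B FB (ex_intro _ q Bq).
    by exists B => //; exact: M.
  - by move=> x Ix; exists A => //; exact: IA.
  - by move=> [B FB B1]; have [_ _] := FQ B FB (ex_intro _ _ B1).
have [idI0 ID IM] := idI.
case: PA => [A0|[[A0 AD AM] IA A1]].
  exfalso; apply: (Amax I); last by right.
  by rewrite A0; split=> // H; have := H 0 idI0.
exists A; split=> // x Ax; apply: contrapT => H.
pose B : set S := [set z | exists y a, A a /\ z = y * x + a]%classic.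
apply: (Amax B); first split.
- by move=> a Aa; exists 0, a; rewrite mul0r add0r.
- by move=> H'; apply: Ax; apply: H'; exists 1, 0; rewrite mul1r addr0.
right; split; [split|..].
- by exists 0, 0; rewrite mul0r addr0.
- move=> p q [y [a [Aa ->]]] [y' [a' [Aa' ->]]]; exists (y + y'), (a + a').
  by split; [exact: AD | rewrite mulrDl addrACA].
- move=> p q [y [a [Aa ->]]]; exists (p * y), (p * a); split; first exact: AM.
  by rewrite mulrDr mulrA.
- by move=> z /IA Az; exists 0, z; rewrite mul0r add0r.
move=> [y [a [Aa E]]]; apply: H; exists y; have -> : y * x - 1 = -1 * a.
  by rewrite mulN1r [X in _ - X]E opprD addrA subrr add0r.
exact: AM.
Qed.

Section Uncountability.
Variables (R : realType) (E : nat -> R -> Prop) (M : nat -> nat).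
Hypothesis E_small : forall k (f : 'I_(M k).+1 -> R), injective f -> ~ forall j, E k (f j).

(** The interval is cut into 2(M k + 1) equal pieces and every other one is kept: M k + 1 disjoint
    closed pieces cannot all meet a set of at most M k points. *)
Lemma avoid_one k (a b : R) : a < b ->
  exists a' b', [/\ a <= a', a' < b', b' <= b & forall x, a' <= x <= b' -> ~ E k x].
Proof.
move=> ab; pose N : R := (M k).+1.*2%:R.
have N0 : 0 < N by rewrite ltr0n double_gt0.
pose e := (b - a) / N; have e0 : 0 < e by rewrite divr_gt0 // subr_gt0.
pose l (j : nat) := a + e * j.*2%:R.
have lE j : l j + e = a + e * j.*2.+1%:R by rewrite /l -addrA -natr1 mulrDr mulr1.
apply: contrapT => H.
have /choice[f Ef] : forall j : 'I_(M k).+1, exists x, l j <= x <= l j + e /\ E k x.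
  move=> j; apply: contrapT => Hj; apply: H; exists (l j), (l j + e); split.
  - by rewrite /l lerDl mulr_ge0 // ltW.
  - by rewrite ltrDl.
  - have -> : b = a + e * N by rewrite /e divfK ?gt_eqF // addrC subrK.
    rewrite lE lerD2l ler_wpM2l ?ltW // ltr_nat.
    by have := ltn_ord j; move: (j : nat) => x; move: (M k) => y; clear; lia.
  - by move=> x xj Ex; apply: Hj; exists x.
apply: (@E_small k f) => [i j fij|j]; last by have [] := Ef j.
have lt_f (p q : 'I_(M k).+1) : (p < q)%N -> f p < f q.
  move=> pq; have [/andP[_ fp] _] := Ef p; have [/andP[fq _] _] := Ef q.
  apply: le_lt_trans fp _; apply: lt_le_trans fq; rewrite lE ltrD2l.
  by rewrite ltr_pM2l // ltr_nat; move: (p : nat) (q : nat) pq => x y; clear; lia.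
apply: val_inj; case: (ltngtP i j) => // /lt_f; by rewrite fij ltxx.
Qed.

(* Nested intervals. *)
Lemma not_union_of_small : exists s, forall k, ~ E k s.
Proof.
pose T := {ab : R * R | ab.1 < ab.2}.
have /choice[F FE] : forall kt : nat * T, exists t : T,
    [/\ (val kt.2).1 <= (val t).1, (val t).2 <= (val kt.2).2 &
      forall x, (val t).1 <= x <= (val t).2 -> ~ E kt.1 x].
  move=> [k [[a b] /= ab]]; have [a' [b' [aa ab' bb H]]] := avoid_one k ab.
  by exists (exist _ (a', b') ab').
have ab01 : ((0, 1) : R * R).1 < ((0, 1) : R * R).2 by rewrite /= ltr01.
pose t := fix t k : T := if k is k'.+1 then F (k', t k') else exist _ (0, 1) ab01.
have tS k : t k.+1 = F (k, t k) by [].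
have mono_a k j : (k <= j)%N -> (val (t k)).1 <= (val (t j)).1.
  elim: j => [|j IHj]; first by rewrite leqn0 => /eqP ->.
  rewrite leq_eqVlt => /orP[/eqP -> //|kj]; apply: le_trans (IHj kj) _.
  by rewrite tS; have [] := FE (j, t j).
have mono_b k j : (k <= j)%N -> (val (t j)).2 <= (val (t k)).2.
  elim: j => [|j IHj]; first by rewrite leqn0 => /eqP ->.
  rewrite leq_eqVlt => /orP[/eqP -> //|kj]; apply: le_trans (IHj kj).
  by rewrite tS; have [] := FE (j, t j).
have ab k j : (val (t k)).1 <= (val (t j)).2.
  apply: le_trans (mono_a k (maxn k j) (leq_maxl _ _)) _.
  by apply: le_trans (ltW (valP (t (maxn k j)))) (mono_b _ _ (leq_maxr _ _)).
pose A : set R := [set x | exists k, x = (val (t k)).1]%classic.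
have supA : has_sup A.
  split; first by exists (val (t 0%N)).1, 0%N.
  by exists (val (t 0%N)).2 => _ [k ->].
exists (sup A) => k; have [_ _] := FE (k, t k); apply; rewrite -tS; apply/andP; split.
  by apply: sup_upper_bound => //; exists k.+1.
by apply: sup_le_ub; [case: supA | move=> _ [j ->]].
Qed.

End Uncountability.

Section Nullstellensatz.
Variables (R : realType) (n : nat).
Local Notation C := R[i].
Local Notation S := {mpoly C[n]}.

Lemma maximal_ideal_prime (I : set S) : is_ideal I ->
    (forall x, ~ I x -> exists y, I (y * x - 1)) ->
  forall x y, I (x * y) -> I x \/ I y.
Proof.
move=> [I0 ID IM] Imax x y Ixy; have [|nx] := pselect (I x); first by left.
have [z Iz] := Imax x nx; right.
have -> : y = z * (x * y) + (- y) * (z * x - 1).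
  by rewrite mulrBr mulr1 opprK mulNr mulrA [y * _]mulrC addrA subrr add0r.
by apply: ID; exact: IM.
Qed.

(* Otherwise the inverses of ['X_k - c] modulo [I], for [c] in the uncountable field [C], would
   be uncountably many linearly independent elements. *)
Lemma maximal_ideal_point (I : set S) : is_ideal I -> ~ I 1 ->
    (forall x, ~ I x -> exists y, I (y * x - 1)) ->
  exists c : 'I_n -> C, forall k, I ('X_k - (c k)%:MP).
Proof.
move=> idI I1 Imax; have [I0 ID IM] := idI.
have Isum (T : finType) (P : pred T) (F : T -> S) :
    (forall j, P j -> I (F j)) -> I (\sum_(j | P j) F j).
  by move=> IF; elim/big_ind: _.
suff /choice[c Hc] : forall k, exists c : C, I ('X_k - c%:MP) by exists c.
move=> k.
apply: contrapT => /forallNP H.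
(* Inverses are sorted by size so that each class is finite: more inverses than monomials of that
   size are linearly dependent. *)
pose E D (r : R) := exists y : S, (msize y <= D)%N /\ I (y * ('X_k - (r%:C)%C%:MP) - 1).
have [|s Es] := @not_union_of_small R E (fun D => #|{: 'X_{1..n < D}}|); last first.
  have [y Iy] := Imax _ (H (s%:C)%C).
  by apply: (Es (msize y)); exists y.
move=> D f inj_f /choice[y Ey].
pose A := \matrix_(j < (#|{: 'X_{1..n < D}}|).+1, l < #|{: 'X_{1..n < D}}|)
  (y j)@_(enum_val l : 'X_{1..n < D}).
have [u u0 uA] : exists2 u : 'rV[C]_(#|{: 'X_{1..n < D}}|).+1, u != 0 & u *m A = 0.
  have : kermx A != 0.
    rewrite -mxrank_eq0 mxrank_ker subn_eq0 -ltnNge ltnS; exact: rank_leq_col.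
  by case/rowV0Pn=> u /sub_kermxP uA u0; exists u.
have uy : \sum_j u 0 j *: y j = 0.
  apply/mpolyP => a; rewrite mcoeff0 raddf_sum /=.
  have [aD|aD] := ltnP (mdeg a) D; last first.
    rewrite big1 // => j _; rewrite mcoeffZ memN_msupp_eq0 ?mulr0 //.
    by apply: contraTN aD => /msize_mdeg_lt aj; rewrite -ltnNge (leq_trans aj) //; case: (Ey j).
  have := congr1 (fun B : 'rV_ _ => B 0 (enum_rank (BMultinom aD))) uA.
  rewrite mxE [RHS]mxE => E0; rewrite -[RHS]E0; apply: eq_bigr => j _; by rewrite mxE enum_rankK mcoeffZ.
pose c j : C := (f j)%:C%C.
(* The linear relation between the inverses, with denominators cleared; at [c j] only the j-th term
   survives. *)
pose P : {poly C} := \sum_j u 0 j *: \prod_(l | l != j) ('X - (c l)%:P).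
have inj_c : injective c by move=> i j /complexI /inj_f.
have P0 : P != 0.
  have /rV0Pn[j uj] := u0; apply: contraNneq uj => /(congr1 (fun p => p.[c j])).
  rewrite horner0 /P horner_sum (bigD1 j) //= [X in _ + X]big1 ?addr0 => [|l lj].
    rewrite hornerZ horner_prod => /eqP; rewrite mulf_eq0 => /orP[//|/prodf_eq0[l lj]].
    by rewrite !hornerE subr_eq0 (inj_eq inj_c) eq_sym (negPf lj).
  rewrite hornerZ horner_prod (bigD1 j) /=; first by rewrite hornerXsubC subrr mul0r mulr0.
  by rewrite eq_sym.
pose phi := horner_alg ('X_k : S).
have phiE r : phi ('X - r%:P) = 'X_k - r%:MP.
  by rewrite /phi rmorphB /= horner_algX horner_algC -mul_mpolyC mulr1.
have phiZ (a : C) (p : {poly C}) : phi (a *: p) = a *: phi p :> S.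
  by rewrite -mul_polyC /phi rmorphM /= horner_algC -scalerAl mul1r.
have IP : I (phi P).
  have -> : phi P = \sum_j u 0 j *: (- (\prod_(l | l != j) ('X_k - (c l)%:MP)) *
      (y j * ('X_k - (c j)%:MP) - 1)).
    under [RHS]eq_bigr => j _.
      rewrite mulrBr mulr1 opprK mulNr mulrCA [_ * ('X_k - _)]mulrC scalerDr scalerN.
      have <- : \prod_l ('X_k - (c l)%:MP) =
          ('X_k - (c j)%:MP) * \prod_(l | l != j) ('X_k - (c l)%:MP) by rewrite (bigD1 j).
      rewrite scalerAl; over.
    rewrite big_split sumrN /= -mulr_suml uy mul0r oppr0 add0r /phi rmorph_sum.
    apply: eq_bigr => j _ /=; apply: etrans (phiZ _ _) _; congr (_ *: _).
    rewrite /phi rmorph_prod /=.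
    by apply: eq_bigr => l _; rewrite -phiE.
  apply: Isum => j _; rewrite -mul_mpolyC; apply: (IM); apply: (IM).
  by case: (Ey j).
have lP : lead_coef P != 0 by rewrite lead_coef_eq0.
have [rs Prs] := closed_field_poly_normal P.
have : I (\prod_(r <- rs) ('X_k - r%:MP)).
  have -> : \prod_(r <- rs) ('X_k - r%:MP) = (lead_coef P)^-1%:MP * phi P.
    rewrite {2}Prs phiZ /phi rmorph_prod -mul_mpolyC mulrA -mpolyCM mulVf // mul1r.
    by apply: eq_bigr => r _; rewrite -phiE.
  exact: IM.
elim: rs {Prs} => [|r rs IHrs]; rewrite ?big_nil // big_cons.
by move/(maximal_ideal_prime idI Imax) => [/H|].
Qed.

(** If no power of ['X_i] lies in the ideal, adding ['X_i - 1] keeps it proper, and a point of a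
    maximal ideal above it is a common zero with i-th coordinate 1. *)
Lemma homogeneous_nullstellensatz r (g : 'I_r -> S) (d : 'I_r -> nat) :
    (forall j, g j \is (d j).-homog) ->
    (forall z : 'I_n -> C, (forall j, (g j).@[z] = 0) -> forall k, z k = 0) ->
  exists e, forall i, gideal g ('X_i ^+ e).
Proof.
move=> hg gz; suff /choice[e He] : forall i, exists e, gideal g ('X_i ^+ e).
  exists (\max_i e i) => i; rewrite -(subnK (leq_bigmax i : (e i <= _)%N)) exprD.
  exact: gidealMl.
move=> i; apply: contrapT => /forallNP H.
pose I : set S := [set p | exists a b, gideal g a /\ p = a + b * ('X_i - 1)]%classic.
have idI : is_ideal I.
  split; first by exists 0, 0; rewrite mul0r addr0; split=> //; exact: gideal0.
  - move=> p q [a [b [ga ->]]] [a' [b' [ga' ->]]]; exists (a + a'), (b + b').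
    by split; [exact: gidealD | rewrite mulrDl addrACA].
  - move=> p q [a [b [ga ->]]]; exists (p * a), (p * b); split; first exact: gidealMl.
    by rewrite mulrDr mulrA.
have gI p : gideal g p -> I p by move=> gp; exists p, 0; rewrite mul0r addr0.
have I1 : ~ I 1.
  (* D bounds the degree of [b * ('X_i - 1)]. The map [h] homogenizes with ['X_i] up to degree D: it
     kills that product, maps [a] into the ideal and sends 1 to ['X_i ^+ D]. *)
  move=> [a [b [ga E1]]]; pose D := (msize b).
  pose h (p : S) := \sum_(k < D.+1) pihomog mdeg k p * 'X_i ^+ (D - k).
  apply: (H D).
  have hD p q : h (p + q) = h p + h q.
    by rewrite /h -big_split; apply: eq_bigr => k _; rewrite raddfD mulrDl.
  have h1 : h 1 = 'X_i ^+ D.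
    rewrite /h big_ord_recl subn0 big1 ?addr0 => [|k _].
      by rewrite pihomog_dE ?mul1r // dhomog1.
    have -> : pihomog mdeg (lift ord0 k) (1 : S) = 0; last by rewrite mul0r.
    by apply/mpolyP => u; rewrite mcoeff_pihomog mcoeff1 mcoeff0; case: eqP => // uk; case: eqP uk => // ->; rewrite mdeg0.
  have hXb : h (b * ('X_i - 1)) = 0.
    have hX : ('X_i : S) \is 1%N.-homog by rewrite dhomogX /= mdeg1.
    rewrite /h; under eq_bigr => k _ do rewrite mulrBr mulr1 raddfB mulrBl.
    rewrite sumrB /= big_ord_recl (pihomogMr _ _ hX) /= mul0r add0r [X in _ - X]big_ord_recr /=.
    have -> : pihomog mdeg D b = 0.
      apply/mpolyP => u; rewrite mcoeff_pihomog mcoeff0; case: eqP => // uD.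
      by apply: memN_msupp_eq0; apply/negP => /msize_mdeg_lt; rewrite uD ltnn.
    rewrite mul0r addr0; apply/eqP; rewrite subr_eq0; apply/eqP; apply: eq_bigr => k _.
    by rewrite (pihomogMr _ _ hX) /= subn1 /= -mulrA -exprS subnSK.
  rewrite -h1 E1 hD hXb addr0; apply: gideal_sum => k _; apply: gidealMr.
  exact: gideal_pihomog hg ga.
have [M [idM IM M1 Mmax]] := maximal_ideal idI I1.
have [c Mc] := maximal_ideal_point idM M1 Mmax.
have [M0 MD MM] := idM.
have Mev p : M (p - p.@[c]%:MP).
  elim/mpoly_ring_ind: p => [a|j|p q IHp IHq|p q IHp IHq].
  - by rewrite mevalC subrr.
  - by rewrite mevalXU.
  - by rewrite mevalD mpolyCD opprD addrACA; exact: MD.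
  - rewrite mevalM mpolyCM.
    have -> : p * q - p.@[c]%:MP * q.@[c]%:MP = q * (p - p.@[c]%:MP) + p.@[c]%:MP * (q - q.@[c]%:MP).
      by rewrite !mulrBr addrA [p * q]mulrC [p.@[c]%:MP * q]mulrC subrK.
    by apply: (MD); exact: (MM).
have Mz p : M p -> p.@[c] = 0.
  move=> Mp; apply: contrapT => /eqP pc; apply: M1.
  have -> : 1 = (p.@[c])^-1%:MP * (p + (-1) * (p - p.@[c]%:MP)).
    by rewrite mulN1r opprB addrCA subrr addr0 -mpolyCM mulVf.
  by apply: (MM); apply: (MD) => //; exact: (MM).
have c0 := gz c (fun j => Mz _ (IM _ (gI _ (gideal_gen g j)))) i.
have := Mz ('X_i - 1); rewrite mevalB mevalXU c0 sub0r meval1 => E.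
have /eqP : - (1 : C) = 0.
  by apply: E; apply: IM; exists 0, 1; rewrite add0r mul1r; split=> //; exact: gideal0.
by rewrite oppr_eq0 oner_eq0.
Qed.

End Nullstellensatz.

(** * The associated form *)

Lemma mpoly_eval_inj n (K : fieldType) (p q : {mpoly K[n]}) : char0 K ->
  (forall v : 'I_n -> K, p.@[v] = q.@[v]) -> p = q.
Proof.
move=> K0 pq; apply/eqP; rewrite -subr_eq0; apply/negP => /negP/(mpoly_nat_nonzero K0)[v].
by rewrite mevalB pq subrr eqxx.
Qed.

(** The bridge between the values of a form, by which the associated form is defined, and
    apolarity. *)
Lemma apolar_power n (K : fieldType) (v : 'I_n -> K) d (q : {mpoly K[n]}) :
  q \is d.-homog -> apolar ((\sum_j v j *: 'X_j) ^+ d) q = d`!%:R * q.@[v].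
Proof.
elim: d q => [|d IHd] q hq.
  rewrite expr0 apolar1 fact0 mul1r; have {2}-> : q = mpolyC n q@_0%MM.
    apply/mpolyP => a; rewrite mcoeffC; case: eqP => [->|/eqP a0]; first by rewrite mulr1.
    by rewrite mulr0 (dhomog_nemf_coeff hq) //= mdeg_eq0.
  by rewrite mevalC.
rewrite exprS mulr_suml apolar_suml.
under eq_bigr => j _ do rewrite -scalerAl apolarZl apolarXU (IHd _ (homog_deriv j hq)) mulrCA.
rewrite -mulr_sumr factS mulnC natrM -mulrA; congr (_ * _).
have := congr1 (meval v) (euler hq); rewrite mevalZ raddf_sum /= => <-.
by apply: eq_bigr => j _; rewrite mevalM mevalXU.
Qed.

Section AssociatedForm.
Variables (n m : nat) (K : fieldType).
Hypothesis m_ge3 : (3 <= m)%N.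
Hypothesis n_gt0 : (0 < n)%N.
Hypothesis K0 : char0 K.
Variable Q : Qform K n m.
Local Notation S := {mpoly K[n]}.
Local Notation J := (gideal (fun j => (Q : S)^`M(j))).
Hypothesis Qfin : exists e, forall i, J ('X_i ^+ e).
Local Notation N := (n * (m - 2))%N.
Local Notation cls := (milnor_class m_ge3 Q).

Let Qh : (Q : S) \is m.-homog. Proof. exact: dhomog_is_dhomog. Qed.

Lemma milnor_class_eq p q : cls p = cls q <-> J (p - q).
Proof.
rewrite /milnor_class; split.
  move=> E; have : p - q \in jacobian_ideal m_ge3 Q by rewrite Quotient.idealrBE; apply/eqP.
  by move/asboolP.
move=> [h hE]; apply/eqP; rewrite -Quotient.idealrBE; apply/asboolP; by exists h.
Qed.

Lemma milnor_classD p q : cls (p + q) = cls p + cls q.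
Proof. exact: rmorphD. Qed.
Lemma milnor_classM p q : cls (p * q) = cls p * cls q.
Proof. exact: rmorphM. Qed.
Lemma milnor_class1 : cls 1 = 1.
Proof. exact: rmorph1. Qed.
Lemma milnor_class0 p : cls p = 0 <-> J p.
Proof. have -> : 0 = cls 0 by symmetry; exact: rmorph0. by rewrite milnor_class_eq subr0. Qed.
Lemma milnor_class_sum (I : Type) (r : seq I) (P : pred I) (F : I -> S) :
  cls (\sum_(i <- r | P i) F i) = \sum_(i <- r | P i) cls (F i).
Proof. exact: rmorph_sum. Qed.
Lemma milnor_classX p k : cls (p ^+ k) = cls p ^+ k.
Proof. exact: rmorphXn. Qed.
Lemma milnor_class_surj x : exists p, x = cls p.
Proof. by exists (repr x); rewrite /milnor_class reprK. Qed.

Lemma jac_const0 p : J p -> p@_0 = 0.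
Proof.
move=> Jp; have := gideal_pihomog 0%N (jac_homog Qh) Jp => H.
have /(congr1 (mcoeff 0%MM)) := jac_deg_lt Qh (pihomogP _ 0%N p) (d0 m_ge3) H.
by rewrite mcoeff_pihomog mdeg0 eqxx mcoeff0.
Qed.

Lemma max_idealE p : max_ideal (cls p) <-> p@_0 = 0.
Proof.
split=> [Mp|p0 [y]].
  apply: contrapT => /eqP p0; apply: Mp; pose c := p@_0.
  have [|k Jk] := @gideal_nilp n K _ (1 - c^-1 *: p) Qfin.
    by rewrite mcoeffB mcoeff1 eqxx mcoeffZ mulVf ?subrr.
  exists (cls (c^-1 *: \sum_(i < k) (1 - c^-1 *: p) ^+ i)).
  rewrite -milnor_classM -milnor_class1; apply/milnor_class_eq.
  rewrite -scalerAl scalerAr mulrC.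
  have {1}-> : c^-1 *: p = - (1 - c^-1 *: p - 1) by rewrite addrAC subrr add0r opprK.
  by rewrite mulNr -subrX1 opprB addrAC subrr add0r; exact: gidealN.
have [q ->] := milnor_class_surj y; rewrite -milnor_classM -milnor_class1.
move/milnor_class_eq/jac_const0/eqP; rewrite mcoeffB mcoeff1 eqxx.
rewrite -mevalz mevalM !mevalz p0 mulr0 sub0r oppr_eq0; exact/negP/oner_neq0.
Qed.

Lemma socle_form p : p \is N.-homog -> socle (cls p).
Proof.
move=> hp; have N0 : (0 < N)%N by rewrite muln_gt0 n_gt0 subn_gt0.
split; first by apply/max_idealE; apply: (dhomog_nemf_coeff hp); rewrite /= mdeg0 eq_sym -lt0n.
move=> y; have [q ->] := milnor_class_surj y => /max_idealE q0.
rewrite -milnor_classM; apply/milnor_class0.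
have [w [_ w2 _ _]] := milnor_residue m_ge3 (pred_deg_neq0 m_ge3 K0) Qh Qfin.
rewrite (mpolyE q) big_seq mulr_sumr; apply: gideal_sum => a aq.
rewrite -scalerAr -mul_mpolyC; apply: gidealMl; apply: (w2 (N + mdeg a)%N).
  by apply: dhomogM => //; rewrite dhomogX.
rewrite -[X in (X < _)%N]addn0 ltn_add2l lt0n mdeg_eq0; apply: contraTneq aq => ->.
by rewrite mcoeff_msupp q0 eqxx.
Qed.

(** A component of degree below N is killed modulo J by every form of positive degree, hence lies in
    J by duality; components above N lie in J anyway. *)
Lemma socleE x : socle x -> exists2 p, p \is N.-homog & x = cls p.
Proof.
have [p ->] := milnor_class_surj x => -[_ pM].
have [w [w1 w2 w3 _]] := milnor_residue m_ge3 (pred_deg_neq0 m_ge3 K0) Qh Qfin.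
exists (pihomog mdeg N p); first exact: pihomogP.
apply/milnor_class_eq; rewrite {1}(pihomog_partitionE (leqnn (mmeasure mdeg p))).
have pX k q : q@_0 = 0 -> J (pihomog mdeg k p * q).
  move=> q0; rewrite (mpolyE q) big_seq mulr_sumr; apply: gideal_sum => a aq.
  have ha : ('X_[a] : S) \is (mdeg a).-homog by rewrite dhomogX.
  rewrite -scalerAr -mul_mpolyC; apply: gidealMl.
  have -> : pihomog mdeg k p * 'X_[a] = pihomog mdeg (k + mdeg a)%N (p * 'X_[a]).
    by rewrite (pihomogMr _ _ ha) leq_addl addnK.
  apply: gideal_pihomog (jac_homog Qh) _; apply/milnor_class0; rewrite milnor_classM; apply: pM.
  by apply/max_idealE; rewrite mcoeffX; case: eqP aq => // ->; rewrite mcoeff_msupp q0 eqxx.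
have Jk k : k != N -> J (pihomog mdeg k p).
  move=> kN; have hk : pihomog mdeg k p \is k.-homog by exact: pihomogP.
  have [Nk|kN'] := ltnP N k; first exact: w2 Nk.
  have {kN kN'}kN : (k < N)%N by rewrite ltn_neqAle kN.
  apply: (w3 _ _ (ltnW kN) hk) => q hq; apply/w1.
    by rewrite -(subnKC (ltnW kN)); exact: dhomogM.
  by apply: pX; apply: (dhomog_nemf_coeff hq); rewrite /= mdeg0 eq_sym -lt0n subn_gt0.
set k := mmeasure mdeg p; have [Nk|kN] := ltnP N k.
  rewrite (bigD1 (Ordinal Nk)) //= addrAC subrr add0r; apply: gideal_sum => j jN; exact: Jk.
have -> : pihomog mdeg N p = 0.
  apply/mpolyP => u; rewrite mcoeff_pihomog mcoeff0; case: eqP => // uN.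
  by apply: memN_msupp_eq0; apply/negP => /msize_mdeg_lt; rewrite uN ltnNge kN.
by rewrite subr0; apply: gideal_sum => j _; apply: Jk; rewrite ltn_eqF // (leq_trans (ltn_ord j)).
Qed.

Lemma socle_iso_exists : exists (w : {linear S -> K | *%R}) (w' : milnor_algebra m_ge3 Q -> K),
  [/\ forall h, h \is N.-homog -> J h <-> w h = 0, w (hess Q) = 1, socle_iso w' &
    forall p, p \is N.-homog -> w' (cls p) = w p].
Proof.
have [w0 [w1 _ _ wH]] := milnor_residue m_ge3 (pred_deg_neq0 m_ge3 K0) Qh Qfin.
pose c a := w0 'X_[a] / w0 (hess Q).
pose w : {linear S -> K | *%R} := lfunc c.
have wE p : w p = w0 p / w0 (hess Q).
  rewrite {2}(mpolyE p) raddf_sum mulr_suml; apply: eq_bigr => a _ /=.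
  by rewrite (linearZ_LR w0) mulrA.
have wJ h : h \is N.-homog -> J h <-> w h = 0.
  move=> hh; rewrite w1 // wE; split=> [->|/eqP]; first by rewrite mul0r.
  by rewrite mulf_eq0 invr_eq0 (negPf wH) orbF => /eqP.
have wh : w (hess Q) = 1 by rewrite wE divff.
pose w' (x : milnor_algebra m_ge3 Q) :=
  w (pihomog mdeg N (repr (x : {ideal_quot (jacobian_ideal m_ge3 Q)}))).
have w'E p : p \is N.-homog -> w' (cls p) = w p.
  move=> hp; apply/eqP; rewrite -subr_eq0 /w' -raddfB; apply/eqP/wJ.
    by rewrite rpredB ?pihomogP.
  have -> : pihomog mdeg N (repr (cls p)) - p = pihomog mdeg N (repr (cls p) - p).
    by rewrite raddfB /= (pihomog_dE hp).
  by apply: gideal_pihomog (jac_homog Qh) _; apply/milnor_class_eq; rewrite /milnor_class reprK.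
exists w, w'; split=> //; split.
- move=> a x y /socleE[p hp ->] /socleE[q hq ->].
  rewrite -milnor_classM -milnor_classD mul_mpolyC !w'E //; last first.
    by apply: rpredD => //; exact: rpredZ.
  by rewrite raddfD /= (linearZ_LR w).
- split=> //.
  + move=> x y /set_mem/socleE[p hp ->] /set_mem/socleE[q hq ->].
    rewrite !w'E // => /eqP; rewrite -subr_eq0 -raddfB => /eqP/wJ H.
    by apply/milnor_class_eq/H; rewrite rpredB.
  + move=> a _; exists (cls (a *: hess Q)).
      by apply: socle_form; apply: rpredZ; exact: hess_homog.
    rewrite w'E; first by rewrite (linearZ_LR w) wh mulr1.
    by apply: rpredZ; exact: hess_homog.
- by rewrite w'E //; exact: hess_homog.
Qed.

Lemma linear_form_power_homog (z : 'I_n -> K) : (\sum_j z j *: 'X_j : S) ^+ N \is N.-homog.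
Proof.
have := dhomogMn N (_ : (\sum_j z j *: 'X_j : S) \is 1%N.-homog); rewrite mul1n; apply.
by apply: rpred_sum => j _; apply: rpredZ; rewrite dhomogX /= mdeg1.
Qed.

Lemma associated_formE (w' : milnor_algebra m_ge3 Q -> K) (z : 'I_n -> K) :
  w' ((\sum_j cls (z j)%:MP * cls 'X_j) ^+ N) = w' (cls ((\sum_j z j *: 'X_j) ^+ N)).
Proof.
rewrite milnor_classX milnor_class_sum; congr (w' (_ ^+ _)); apply: eq_bigr => j _.
by rewrite -milnor_classM mul_mpolyC.
Qed.

Lemma associated_form_exists : exists B, [/\ is_associated_form m_ge3 Q B,
    forall p, p \is N.-homog -> J p <-> apolar p (B : S) = 0
  & apolar (hess Q) (B : S) = N`!%:R].
Proof.
have [w [w' [wJ wh isow' w'E]]] := socle_iso_exists.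
have mf (a : 'X_{1..n}) : (mfact a)%:R != 0 :> K.
  rewrite -[mfact a]prednK ?K0 //; elim/big_ind: (mfact a) => // [x y|i _]; last exact: fact_gt0.
  by move=> x0 y0; rewrite muln_gt0 x0.
have Nf : N`!%:R != 0 :> K by rewrite -[_`!]prednK ?fact_gt0.
(* The coefficients cancel the factorials of the pairing, so that [apolar p B0] is N! w(p). *)
pose B0 : S := \sum_(a : 'X_{1..n < N.+1} | mdeg a == N)
  (N`!%:R * w 'X_[a] / (mfact a)%:R) *: 'X_[a].
have hB0 : B0 \is N.-homog.
  by apply: rpred_sum => a /eqP aN; apply: rpredZ; rewrite dhomogX /= aN.
have B0E p : p \is N.-homog -> apolar p B0 = N`!%:R * w p.
  move=> hp; rewrite (mpolyE p) apolar_suml raddf_sum mulr_sumr big_seq [RHS]big_seq.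
  apply: eq_bigr => a /(dhomogP _ _ _ hp) /= aN.
  rewrite apolarZl (linearZ_LR w) mulrCA; congr (_ * _); rewrite apolarX /B0.
  have aN' : (mdeg a < N.+1)%N by rewrite aN.
  rewrite raddf_sum (bigD1 (BMultinom aN')) /= ?aN // mcoeffZ mcoeffX eqxx mulr1.
  rewrite big1 ?addr0 => [|b /andP[_ ba]]; last first.
    by rewrite mcoeffZ mcoeffX; case: eqP => [E|_]; rewrite ?mulr0 //; case/eqP: ba; exact: val_inj.
  by rewrite -[LHS]mulr_natr divfK.
exists (DHomog hB0); split=> /=.
- exists w' => // z; rewrite associated_formE w'E ?linear_form_power_homog //=.
  by apply: (mulfI Nf); rewrite -B0E ?linear_form_power_homog // apolar_power.
- move=> p hp; rewrite B0E // wJ //; split=> [->|/eqP]; first by rewrite mulr0.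
  by rewrite mulf_eq0 (negPf Nf) => /eqP.
- by rewrite B0E ?wh ?mulr1 //; exact: hess_homog.
Qed.

Lemma associated_form_unique B B' : is_associated_form m_ge3 Q B ->
  is_associated_form m_ge3 Q B' -> B = B'.
Proof.
have [w0 [_ [wJ wh _ _]]] := socle_iso_exists.
have wE w p : socle_iso w -> p \is N.-homog -> w (cls p) = w0 p.
  move=> [wl _ w1] hp; have soc0 : socle (0 : milnor_algebra m_ge3 Q).
    by rewrite -(milnor_class0 0).2; [apply: socle_form; exact: rpred0 | exact: gideal0].
  have sh : socle (cls (hess Q)) by apply: socle_form; exact: hess_homog.
  have w00 : w 0 = 0.
    have /eqP := wl 1 _ _ soc0 soc0; rewrite mulr0 add0r mul1r -[X in X == _]addr0.
    by rewrite (inj_eq (addrI _)) eq_sym => /eqP.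
  have := wl (w0 p) _ _ sh soc0; rewrite addr0 w00 addr0.
  rewrite -/(hess Q) w1 mulr1 => <-; congr w; rewrite -milnor_classM; apply/milnor_class_eq.
  rewrite mul_mpolyC; apply/wJ.
    by apply: rpredB => //; apply: rpredZ; exact: hess_homog.
  by rewrite raddfB /= (linearZ_LR w0) wh mulr1 subrr.
move=> [w isow BE] [w' isow' B'E]; apply/val_inj/(mpoly_eval_inj K0) => z /=.
by rewrite BE B'E !associated_formE !wE ?linear_form_power_homog.
Qed.

Lemma Phi_spec : [/\ is_associated_form m_ge3 Q (Phi m_ge3 Q),
    forall p, p \is N.-homog -> J p <-> apolar p (Phi m_ge3 Q : S) = 0
  & apolar (hess Q) (Phi m_ge3 Q : S) = N`!%:R].
Proof.
have [B [aB BJ Bh]] := associated_form_exists.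
suff -> : Phi m_ge3 Q = B by [].
by apply: xget_unique => // B' aB'; exact: associated_form_unique.
Qed.

End AssociatedForm.

(** * Places and the Smith normal form *)

Section DominatingPairs.
Variable K : fieldType.
Implicit Types (A M : K -> Prop) (x y : K) (p q : {poly K}).

Lemma exprB_inv x a b : x != 0 -> (a <= b)%N -> x ^+ b * x^-1 ^+ a = x ^+ (b - a).
Proof. by move=> x0 ab; rewrite exprVn -[in LHS](subnK ab) exprD mulfK // expf_neq0. Qed.

Definition ring_ideal_pair A M :=
  [/\ A 1, forall x y, A x -> A y -> A (x - y), forall x y, A x -> A y -> A (x * y),
      forall x, M x -> A x & [/\ M 0, forall x y, M x -> M y -> M (x + y),
      forall x y, A x -> M y -> M (x * y) & ~ M 1]].

Definition dominant_pair A M := ring_ideal_pair A M /\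
  forall A' M', ring_ideal_pair A' M' -> (forall x, A x -> A' x) ->
    (forall x, M x -> M' x) -> (forall x, A' x -> A x) /\ (forall x, M' x -> M x).

Lemma dominant_pair_exists A0 M0 : ring_ideal_pair A0 M0 ->
  exists A M, [/\ dominant_pair A M, forall x, A0 x -> A x & forall x, M0 x -> M x].
Proof.
(* A pair is coded as one subset of [bool * K], so that Zorn's lemma for unions treats both
   components at once. *)
move=> g0; pose ring (X : set (bool * K)) x := X (true, x).
pose ideal (X : set (bool * K)) x := X (false, x).
pose P X := [/\ ring_ideal_pair (ring X) (ideal X), forall x, A0 x -> ring X x
  & forall x, M0 x -> ideal X x].
have [|X [PX Xmax]] := @Zorn_bigcup (bool * K) (fun X => X = classical_sets.set0 \/ P X).
  move=> F FP tF; have [[X FX [a Xa]]|H] := pselect (exists2 X, F X & exists a, X a); last first.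
    left; apply/seteqP; split=> x // [X FX Xx]; case: H; exists X => //; by exists x.
  right; have FQ Y : F Y -> (exists b, Y b) -> P Y.
    by move=> FY [b Yb]; have [Y0|//] := FP Y FY; rewrite Y0 in Yb.
  have [[X1 XB XM XI [X0 XD XAM XN1]] XA0 XM0] := FQ X FX (ex_intro _ a Xa).
  have two Y Y' u v : F Y -> F Y' -> Y u -> Y' v -> exists Z, [/\ F Z, P Z, Z u & Z v].
    move=> FY FY' Yu Y'v; have [YY|YY] := tF Y Y' FY FY'.
      exists Y'; split=> //; [by apply: FQ => //; exists v|exact: YY].
    exists Y; split=> //; [by apply: FQ => //; exists u|exact: YY].
  split; [split; [| | | |split]|..]; first by exists X.
  - move=> x y [Y FY Yx] [Y' FY' Yy]; have [Z [FZ [[_ B _ _ _] _ _] Zx Zy]] := two _ _ _ _ FY FY' Yx Yy.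
    by exists Z => //; exact: B.
  - move=> x y [Y FY Yx] [Y' FY' Yy]; have [Z [FZ [[_ _ B _ _] _ _] Zx Zy]] := two _ _ _ _ FY FY' Yx Yy.
    by exists Z => //; exact: B.
  - move=> x [Y FY Yx]; have [[_ _ _ B _] _ _] := FQ Y FY (ex_intro _ _ Yx).
    by exists Y => //; exact: B.
  - by exists X.
  - move=> x y [Y FY Yx] [Y' FY' Yy]; have [Z [FZ [[_ _ _ _ [_ B _ _]] _ _] Zx Zy]] := two _ _ _ _ FY FY' Yx Yy.
    by exists Z => //; exact: B.
  - move=> x y [Y FY Yx] [Y' FY' Yy]; have [Z [FZ [[_ _ _ _ [_ _ B _]] _ _] Zx Zy]] := two _ _ _ _ FY FY' Yx Yy.
    by exists Z => //; exact: B.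
  - move=> [Y FY Y1]; have [[_ _ _ _ [_ _ _ B]] _ _] := FQ Y FY (ex_intro _ _ Y1).
    exact: B.
  - by move=> x /XA0 Xx; exists X.
  - by move=> x /XM0 Xx; exists X.
pose mk A M : set (bool * K) := fun u => if u.1 then A u.2 else M u.2.
case: PX => [X0|[gX XA XM]].
  exfalso; apply: (Xmax (mk A0 M0)); last by right; split.
  rewrite X0; split=> // H; have [A1 _ _ _ _] := g0.
  exact: (H (true, 1) A1).
exists (ring X), (ideal X); split=> //; split=> // A' M' g' AA MM.
have H : ~ (X `<` mk A' M')%classic.
  by move=> /Xmax; apply; right; split=> // x ?; [apply/AA/XA|apply/MM/XM].
have sub : (X `<=` mk A' M')%classic by move=> [[] x]; [exact: AA|exact: MM].
have sub' : (mk A' M' `<=` X)%classic by apply: contrapT => nsub; apply: H.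
by split=> x H'; [apply: (sub' (true, x))|apply: (sub' (false, x))].
Qed.

Definition coef_in (D : K -> Prop) p := forall i, D p`_i.

Section Dominant.
Variables A M : K -> Prop.
Hypothesis domAM : dominant_pair A M.

Let A1 : A 1. Proof. by case: domAM => [[]]. Qed.
Let AB x y : A x -> A y -> A (x - y). Proof. by case: domAM => [[_ h _ _ _] _]; exact: h. Qed.
Let AM x y : A x -> A y -> A (x * y). Proof. by case: domAM => [[_ _ h _ _] _]; exact: h. Qed.
Let MA x : M x -> A x. Proof. by case: domAM => [[_ _ _ h _] _]; exact: h. Qed.
Let M0 : M 0. Proof. by case: domAM => [[_ _ _ _ []]]. Qed.
Let MD x y : M x -> M y -> M (x + y). Proof. by case: domAM => [[_ _ _ _ [_ h _ _]] _]; exact: h. Qed.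
Let MM x y : A x -> M y -> M (x * y). Proof. by case: domAM => [[_ _ _ _ [_ _ h _]] _]; exact: h. Qed.
Let M1 : ~ M 1. Proof. by case: domAM => [[_ _ _ _ []]]. Qed.
Let A0 : A 0. Proof. exact: MA. Qed.
Let AN x : A x -> A (- x). Proof. by move=> Ax; rewrite -sub0r; exact: AB. Qed.
Let AD x y : A x -> A y -> A (x + y). Proof. by move=> Ax Ay; rewrite -[y]opprK; exact/AB/AN. Qed.

Lemma coef_inM p q : coef_in A p -> coef_in M q -> coef_in M (p * q).
Proof.
by move=> hp hq i; rewrite coefM; elim/big_ind: _ => // j _; exact: MM.
Qed.

(** A[x] with the ideal generated by M is a larger pair unless that ideal contains 1, so maximality
    puts x in A. *)
Lemma extension_trivial x : (forall p, coef_in M p -> p.[x] != 1) -> A x.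
Proof.
move=> nx; have [_ dom] := domAM.
pose A' y := exists2 p, coef_in A p & y = p.[x].
pose M' y := exists2 p, coef_in M p & y = p.[x].
have A'C y : A y -> A' y by move=> Ay; exists y%:P; [move=> i; rewrite coefC; case: eqP|rewrite hornerC].
have gA : ring_ideal_pair A' M'.
  split; [exact: A'C| | | |split].
  - by move=> y z [p hp ->] [q hq ->]; exists (p - q); [move=> i; rewrite coefB; exact: AB|rewrite !hornerE].
  - move=> y z [p hp ->] [q hq ->]; exists (p * q); last by rewrite hornerM.
    by move=> i; rewrite coefM; elim/big_ind: _ => // j _; exact: AM.
  - by move=> y [p hp ->]; exists p => // i; exact: MA.
  - by exists 0; [move=> i; rewrite coef0|rewrite horner0].
  - by move=> y z [p hp ->] [q hq ->]; exists (p + q); [move=> i; rewrite coefD; exact: MD|rewrite !hornerE].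
  - by move=> y z [p hp ->] [q hq ->]; exists (p * q); [exact: coef_inM|rewrite hornerM].
  - by move=> [p hp /esym/eqP]; apply/negP/nx.
have [|AA _] := dom A' M' gA A'C.
  by move=> y My; exists y%:P; [move=> i; rewrite coefC; case: eqP|rewrite hornerC].
by apply: AA; exists 'X; [move=> i; rewrite coefX; case: eqP|rewrite hornerX].
Qed.

Let AX x k : A x -> A (x ^+ k).
Proof. by move=> Ax; elim: k => [|k IHk]; rewrite ?expr0 // exprS; exact: AM. Qed.

(** An equation 1 = p(y) for the inverse y of 1 - x, with coefficients in M, would put a power of 1
    - x in M; as 1 - x is 1 modulo M, it would put 1 there. *)
Lemma dominant_one_sub x : M x -> A (1 - x)^-1.
Proof.
move=> Mx; have Ax : A (1 - x) by apply: AB => //; exact: MA.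
have x0 : 1 - x != 0 by apply/eqP => /eqP; rewrite subr_eq0 => /eqP E; apply: M1; rewrite E.
apply: extension_trivial => p hp; apply/eqP => px; apply: M1.
have H : M ((1 - x) ^+ size p).
  rewrite -[X in M X]mulr1 -[X in _ * X]px horner_coef mulr_sumr; elim/big_ind: _ => // i _.
  rewrite mulrCA mulrC exprB_inv //; last exact: ltnW.
  by apply: MM => //; exact: AX.
have AM1 k : A (1 - x) -> M ((1 - x) ^+ k) -> M 1.
  elim: k => [|k IHk] // h; rewrite exprS mulrBl mul1r => H'; apply: IHk => //.
  rewrite -[X in M X](subrK (x * (1 - x) ^+ k)); apply: MD => //.
  by rewrite mulrC; apply: MM => //; exact: AX.
exact: AM1 H.
Qed.

(** Adjoining x to M cannot give a larger pair, so 1 = y + xa with y in M, and 1 - y is a unit. *)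
Lemma dominant_inv x : A x -> ~ M x -> A x^-1.
Proof.
move=> Ax nMx; have [_ dom] := domAM.
have [a Aa [y My E]] : exists2 a, A a & exists2 y, M y & 1 = y + x * a.
  apply: contrapT => H; apply: nMx.
  pose M' z := exists2 a, A a & exists2 y, M y & z = y + x * a.
  have gA : ring_ideal_pair A M'.
    split=> //.
      move=> z [a Aa [y My ->]]; apply: AD; [exact: MA|exact: AM].
    split.
    + by exists 0 => //; exists 0; rewrite // mulr0 addr0.
    + move=> z z' [a Aa [y My ->]] [a' Aa' [y' My' ->]]; exists (a + a'); first exact: AD.
      by exists (y + y'); [exact: MD|rewrite mulrDr addrACA].
    + move=> z z' Az [a Aa [y My ->]]; exists (z * a); first exact: AM.
      by exists (z * y); [exact: MM|rewrite mulrDr mulrCA].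
    + by [].
  have [||_ MM'] // := dom A M' gA; last apply: MM'.
    by move=> z Mz; exists 0 => //; exists z; rewrite // mulr0 addr0.
  by exists 1 => //; exists 0; rewrite // mulr1 add0r.
have xa : x * a = 1 - y by rewrite E addrAC subrr add0r.
have y0 : 1 - y != 0 by apply/eqP => /eqP; rewrite subr_eq0 => /eqP E'; apply: M1; rewrite E'.
have -> : x^-1 = a * (1 - y)^-1.
  have x0 : x != 0 by apply: contraNneq y0 => x0; rewrite -xa x0 mul0r.
  by rewrite -xa invfM mulrCA mulfV ?mulr1 //; apply: contraNneq y0 => a0; rewrite -xa a0 mulr0.
by apply: AM => //; exact: dominant_one_sub.
Qed.

(** If neither x nor its inverse were in A, both would satisfy equations 1 = p with coefficients in
    M. The equation of lower degree rewrites the leading power in the other one and shortens it: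
    descent on the sum of the degrees. *)
Lemma dominant_valuation x : x != 0 -> A x \/ A x^-1.
Proof.
move=> x0; apply: contrapT => /not_orP[nx ny].
have rep z : ~ A z -> exists k, exists p, [/\ (size p <= k.+1)%N, coef_in M p & p.[z] = 1].
  move=> nz; apply: contrapT => H; apply: nz; apply: extension_trivial => p hp.
  by apply/eqP => pz; apply: H; exists (size p), p.
suff desc k l y z : z = y^-1 -> y != 0 -> (l <= k)%N ->
    (exists p, [/\ (size p <= k.+1)%N, coef_in M p & p.[y] = 1]) ->
    (exists p, [/\ (size p <= l.+1)%N, coef_in M p & p.[z] = 1]) ->
    (exists p, [/\ (size p <= k)%N, coef_in M p & p.[y] = 1]).
  have no0 z p : (size p <= 0)%N -> p.[z] <> 1.
    by rewrite leqn0 size_poly_eq0 => /eqP -> /eqP; rewrite horner0 eq_sym oner_eq0.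
  have [k] := rep _ nx; have [l] := rep _ ny.
  have [t tE] : exists t, t = (k + l)%N by exists (k + l)%N.
  elim/ltn_ind: t k l tE => t IHt k l tE hl hk.
  have [lk|/ltnW kl] := leqP l k.
    have [p [pk hp px]] := desc _ _ _ _ erefl x0 lk hk hl.
    case: k pk tE hk lk => [/no0/(_ px) //|k] pk tE hk lk.
    by apply: (IHt (k + l)%N _ k l) => //; [rewrite tE|exists p].
  have [p [pl hp px]] := desc _ _ _ _ (esym (invrK x)) (invr_neq0 x0) kl hl hk.
  case: l pl tE hl kl => [/no0/(_ px) //|l] pl tE hl kl.
  by apply: (IHt (k + l)%N _ k l) => //; [rewrite tE addnS|exists p].
move=> -> y0 lk [p [pk hp py]] [q [ql hq qy]].
pose u := (1 - q`_0)^-1; have Au : A u by exact: dominant_one_sub.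
have u0 : 1 - q`_0 != 0 by apply/eqP => /eqP; rewrite subr_eq0 => /eqP E; apply: M1; rewrite E.
pose b j := u * q`_j.+1.
have bM j : M (b j) by apply: MM.
(* Dividing the equation for the inverse of y by the unit 1 - q_0 and multiplying by y^l expresses
   y^l by lower powers with coefficients in M. *)
have E1 : y ^+ l = \sum_(j < l) b j * y ^+ (l - j.+1).
  have : 1 - q`_0 = \sum_(j < l) q`_j.+1 * y^-1 ^+ j.+1.
    by rewrite -{1}qy (horner_coef_wide _ ql) big_ord_recl expr0 mulr1 addrAC subrr add0r.
  move/(congr1 (fun t => u * t * y ^+ l)); rewrite {1}/u mulVf // mul1r => ->.
  rewrite mulr_sumr mulr_suml; apply: eq_bigr => j _.
  by rewrite mulrA -[LHS]mulrA; congr (_ * _); rewrite mulrC exprB_inv.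
pose r : {poly K} := \sum_(j < l) (p`_k * b j) *: 'X^(k - j.+1).
exists (take_poly k p + r); split.
- rewrite (leq_trans (size_polyD _ _)) // geq_max size_take_poly /=.
  apply: (leq_trans (size_sum _ _ _)); apply/bigmax_leqP => j _.
  rewrite (leq_trans (size_scale_leq _ _)) // size_polyXn; have := ltn_ord j.
  by move: (j : nat) lk => i; clear; lia.
- move=> i; rewrite coefD; apply: MD.
    by rewrite coef_take_poly; case: ifP.
  rewrite coef_sum; elim/big_ind: _ => // j _; rewrite coefZ coefXn.
  by case: eqP => _; rewrite ?mulr1 ?mulr0 //; apply: MM => //; exact: MA.
rewrite hornerD -[RHS]py (horner_coef_wide _ pk) big_ord_recr /=; congr (_ + _).
  rewrite (horner_coef_wide _ (size_take_poly k p)); apply: eq_bigr => i _.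
  by rewrite coef_take_poly ltn_ord.
rewrite -[in y ^+ k](subnK lk) exprD E1 !mulr_sumr horner_sum; apply: eq_bigr => j _.
rewrite hornerZ hornerXn; move: (b j) => c.
have -> : y ^+ (k - j.+1) = y ^+ (k - l) * y ^+ (l - j.+1).
  rewrite -exprD; congr (y ^+ _); have := ltn_ord j.
  by move: (j : nat) lk => i; clear; lia.
by rewrite -mulrA; congr (_ * _); rewrite mulrCA.
Qed.

End Dominant.
End DominatingPairs.

Section ValuationRing.
Variable K : fieldType.

Record dominant := Dominant {
  dom_ring : {pred K}; dom_ideal : {pred K};
  domP : dominant_pair (fun x => x \in dom_ring) (fun x => x \in dom_ideal) }.

Lemma dom_ring_closed (d : dominant) : subring_closed (dom_ring d).
Proof.
by have [[A1 AB AM _ _] _] := domP d; split.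
Qed.

HB.instance Definition _ (d : dominant) :=
  GRing.isSubringClosed.Build K (dom_ring d) (dom_ring_closed d).

Definition val_ring (d : dominant) := {x : K | x \in dom_ring d}.
HB.instance Definition _ d := SubChoice.on (val_ring d).
HB.instance Definition _ d := [SubChoice_isSubComNzRing of val_ring d by <:].

Definition val_ideal (d : dominant) : {pred val_ring d} := fun x => val x \in dom_ideal d.
Arguments val_ideal : clear implicits.

Lemma val_ideal_closed d : idealr_closed (val_ideal d).
Proof.
have [[_ _ _ _ [M0 MD MM M1]] _] := domP d; split; rewrite ?inE /in_mem /= /val_ideal.
- by rewrite rmorph0.
- by rewrite rmorph1; apply/negP.
- move=> a x y Mx My; suff : val a * val x + val y \in dom_ideal d by [].
  by apply: MD => //; apply: MM => //; exact: (valP a).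
Qed.

HB.instance Definition _ d := isIdealr.Build (val_ring d) (val_ideal d) (val_ideal_closed d).

Definition residue_field d := {ideal_quot (val_ideal d)}.
HB.instance Definition _ d := GRing.ComNzRing.on (residue_field d).

Lemma val_ring_inv d (x : val_ring d) : ~~ val_ideal d x -> exists y, y * x = 1.
Proof.
move=> /negP Mx; have Ax := dominant_inv (domP d) (valP x) Mx.
exists (exist (fun z => z \in dom_ring d) _ Ax : val_ring d); apply: val_inj; rewrite rmorphM rmorph1 /= mulVf //.
apply: contra_notN Mx => /eqP x0; have [[_ _ _ _ [M0 _ _ _]] _] := domP d.
suff : val x \in dom_ideal d by [].
by rewrite [val x]x0.
Qed.

Definition to_residue d (x : val_ring d) : residue_field d := \pi_({ideal_quot (val_ideal d)})%qT x.
HB.instance Definition _ d := GRing.RMorphism.copy (@to_residue d) (\pi_({ideal_quot (val_ideal d)})%qT).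

Lemma to_residue_eq0 d (x : val_ring d) : to_residue x = 0 <-> val_ideal d x.
Proof.
have -> : 0 = to_residue (0 : val_ring d) by rewrite rmorph0.
have E : (x \in val_ideal d) = val_ideal d x by [].
by rewrite -E -[x in x \in _]subr0 Quotient.idealrBE; split=> [/eqP|/eqP].
Qed.

Lemma to_residue_repr d (x : residue_field d) : exists y, x = to_residue y.
Proof. by exists (repr x); rewrite /to_residue reprK. Qed.

Lemma residue_inv_exists d (x : residue_field d) : exists y, (x != 0 -> y * x = 1) /\ (x = 0 -> y = 0).
Proof.
have [->|x0] := eqVneq x 0; first by exists 0.
have [z xE] := to_residue_repr x.
have [|y yx] := @val_ring_inv d z; last first.
  exists (to_residue y); split=> [_|x0']; last by rewrite x0' eqxx in x0.
  by rewrite xE -rmorphM yx rmorph1.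
by apply: contra_neqN x0 => /to_residue_eq0; rewrite -xE.
Qed.

Definition residue_inv d (x : residue_field d) : residue_field d := sval (cid (residue_inv_exists x)).

Lemma residue_mulVf d (x : residue_field d) : x != 0 -> residue_inv x * x = 1.
Proof. by rewrite /residue_inv; case: cid => y [] /=. Qed.

Lemma residue_inv0 d : residue_inv (0 : residue_field d) = 0.
Proof. by rewrite /residue_inv; case: cid => y [] /= _; apply. Qed.

HB.instance Definition _ d := GRing.ComNzRing_isField.Build (residue_field d)
  (@residue_mulVf d) (@residue_inv0 d).

(** The pair is repackaged as rings and morphisms, so that matrices and polynomials can be
    transported by [map_mx] and [map_mpoly]. *)
Lemma place_exists (A0 M0 : K -> Prop) : ring_ideal_pair A0 M0 ->
  exists (V : comNzRingType) (iota : {rmorphism V -> K}) (k : fieldType) (pi : {rmorphism V -> k}),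
  [/\ injective iota, forall x, A0 x -> exists v, iota v = x,
      forall v, M0 (iota v) -> pi v = 0,
      forall x, x != 0 -> (exists v, iota v = x) \/ (exists v, iota v = x^-1)
    & forall v, pi v != 0 -> exists v', v' * v = 1].
Proof.
move=> /dominant_pair_exists[A [M [dAM AA MM]]].
have dAM' : dominant_pair (fun x => x \in [pred x | `[< A x >]]) (fun x => x \in [pred x | `[< M x >]]).
  have -> : (fun x => is_true (x \in [pred x | `[< A x >]])) = A.
    by apply: funext => x; rewrite inE asboolE.
  have -> // : (fun x => is_true (x \in [pred x | `[< M x >]])) = M.
  by apply: funext => x; rewrite inE asboolE.
pose d := Dominant dAM'.
have inA x : A x -> exists v : val_ring d, val v = x.
  by move=> Ax; exists (exist (fun z => z \in dom_ring d) x (asboolT Ax)).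
exists (val_ring d), val, (residue_field d), (@to_residue d); split.
- exact: val_inj.
- by move=> x /AA/inA.
- by move=> v /MM Mv; apply/to_residue_eq0/asboolP.
- by move=> x /(dominant_valuation dAM)[/inA|/inA]; [left|right].
- move=> v v0; have [|y yv] := @val_ring_inv d v; last by exists y.
  by apply: contraNN v0 => Mv; apply/eqP/to_residue_eq0.
Qed.

End ValuationRing.

(** * Elementary divisors over a valuation ring *)

Section Smith.
Variables (K : fieldType) (V : comNzRingType) (iota : {rmorphism V -> K}).
Hypothesis valV : forall x, x != 0 -> (exists v, iota v = x) \/ (exists v, iota v = x^-1).
Local Notation "A ^i" := (map_mx iota A) (at level 2, format "A ^i").

Definition inverse_mx n (A B : 'M[V]_n) := A *m B = 1%:M /\ B *m A = 1%:M.

Lemma inverse_mxM n (A A' B B' : 'M[V]_n) : inverse_mx A A' -> inverse_mx B B' ->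
  inverse_mx (A *m B) (B' *m A').
Proof.
move=> [h1 h2] [h3 h4]; split.
  by rewrite mulmxA -(mulmxA A) h3 mulmx1.
by rewrite mulmxA -(mulmxA B') h2 mulmx1.
Qed.

(** Divisibility with quotient in V between elements of K that need not be integral. *)
Definition vdvd (x y : K) := exists v, y = iota v * x.

Lemma vdvd_trans y x z : vdvd x y -> vdvd y z -> vdvd x z.
Proof. by move=> [v ->] [w ->]; exists (w * v); rewrite rmorphM mulrA. Qed.

Lemma vdvd_total x y : vdvd x y \/ vdvd y x.
Proof.
have [->|x0] := eqVneq x 0; first by right; exists 0; rewrite rmorph0 mul0r.
have [->|y0] := eqVneq y 0; first by left; exists 0; rewrite rmorph0 mul0r.
have [|[v vE]|[v vE]] := valV (x := y / x); first by rewrite mulf_neq0 ?invr_eq0.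
  by left; exists v; rewrite vE divfK.
by right; exists v; rewrite vE invf_div divfK.
Qed.

Lemma vdvd_min (T : eqType) (f : T -> K) (s : seq T) (x0 : T) :
  exists2 x, x \in x0 :: s & forall y, y \in x0 :: s -> vdvd (f x) (f y).
Proof.
elim: s x0 => [|t s IHs] x0.
  exists x0; first by rewrite inE.
  by move=> y; rewrite inE => /eqP ->; exists 1; rewrite rmorph1 mul1r.
have [x xs xd] := IHs t.
have [xx|xx] := vdvd_total (f x) (f x0).
  exists x; first by rewrite inE xs orbT.
  by move=> y; rewrite inE => /orP[/eqP -> //|]; exact: xd.
exists x0; first by rewrite inE eqxx.
move=> y; rewrite inE => /orP[/eqP ->|/xd]; last exact: vdvd_trans.
by exists 1; rewrite rmorph1 mul1r.
Qed.

Lemma vdvd_mulmx n c (A B : 'M[V]_n) (u : 'M[K]_n) :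
  (forall i j, vdvd c (u i j)) -> forall i j, vdvd c ((A^i *m u *m B^i) i j).
Proof.
have D x y : vdvd c x -> vdvd c y -> vdvd c (x + y).
  by move=> [v ->] [w ->]; exists (v + w); rewrite rmorphD mulrDl.
have M v x : vdvd c x -> vdvd c (iota v * x).
  by move=> [w ->]; exists (v * w); rewrite rmorphM mulrA.
have Z : vdvd c 0 by exists 0; rewrite rmorph0 mul0r.
move=> hu i j; rewrite mxE; elim/big_ind: _ => // k _; rewrite mulrC [B^i _ _]mxE; apply: (M).
rewrite mxE; elim/big_ind: _ => // l _; rewrite [A^i _ _]mxE; exact: (M).
Qed.

Lemma inverse_mx_lblock n (A B : 'M[V]_n) : inverse_mx A B ->
  inverse_mx (block_mx (1%:M : 'M_1) 0 0 A) (block_mx 1%:M 0 0 B).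
Proof.
by move=> [h1 h2]; split; rewrite mulmx_block !mul0mx !mulmx0 mulmx1 ?h1 ?h2 !addr0 !add0r
  -scalar_mx_block.
Qed.

Lemma inverse_mx_lower n (c : 'cV[V]_n) :
  inverse_mx (block_mx (1%:M : 'M_1) 0 c 1%:M) (block_mx 1%:M 0 (- c) 1%:M).
Proof.
by split; rewrite mulmx_block !mul0mx !mulmx0 !mulmx1 !mul1mx !addr0 ?add0r ?subrr ?addNr
  -scalar_mx_block.
Qed.

Lemma inverse_mx_upper n (r : 'rV[V]_n) :
  inverse_mx (block_mx (1%:M : 'M_1) r 0 1%:M) (block_mx 1%:M (- r) 0 1%:M).
Proof.
by split; rewrite mulmx_block !mul0mx !mulmx0 !mulmx1 !mul1mx !addr0 ?add0r ?subrr ?addNr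
  -scalar_mx_block.
Qed.

Lemma inverse_mx_tperm n (i j : 'I_n) : inverse_mx (tperm_mx i j) (tperm_mx i j).
Proof. by split; rewrite -perm_mxM tperm2 perm_mx1. Qed.

(** An entry of least valuation divides all others and serves as pivot; elimination keeps the
    remaining entries divisible by it, which gives the divisibility chain. *)
Lemma valuation_smith n (u : 'M[K]_n) : exists (L L' R R' : 'M[V]_n) (D : nat -> K),
  [/\ inverse_mx L L', inverse_mx R R', u = L^i *m diag_mx (\row_(j < n) D j) *m R^i
    & forall j, (j.+1 < n)%N -> vdvd (D j) (D j.+1)].
Proof.
elim: n u => [|n IHn] u.
  exists 1%:M, 1%:M, 1%:M, 1%:M, (fun=> 0).
  by split=> //; [split; rewrite mulmx1 | split; rewrite mulmx1 | apply/matrixP => -[]].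
have [[i0 j0] _ dv] := @vdvd_min _ (fun ij => u ij.1 ij.2) (enum {: 'I_n.+1 * 'I_n.+1}) (ord0, ord0).
have {}dv i j : vdvd (u i0 j0) (u i j).
  by apply: (dv (i, j)); rewrite inE mem_enum orbT.
pose P : 'M[V]_n.+1 := tperm_mx i0 ord0; pose Q : 'M[V]_n.+1 := tperm_mx j0 ord0.
pose u1 : 'M[K]_(1 + n) := P^i *m u *m Q^i; pose c := u i0 j0.
have du1 i j : vdvd c (u1 i j) by exact: vdvd_mulmx.
have uE : u = P^i *m u1 *m Q^i.
  rewrite /u1 -!mulmxA -map_mxM (inverse_mx_tperm _ _).1 map_mx1 mulmx1 mulmxA -map_mxM.
  by rewrite (inverse_mx_tperm _ _).1 map_mx1 mul1mx.
have u1c : ulsubmx u1 = c%:M.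
  apply/matrixP => i j; rewrite !ord1 mxE mxE /u1 /P /Q !map_perm_mx.
  rewrite -/(tperm_mx i0 ord0) -/(tperm_mx j0 ord0) -xrowE -xcolE !mxE.
  by rewrite !lshift0 !tpermR.
clearbody u1.
have /choice[r rE] : forall j, exists v, ursubmx u1 0 j = iota v * c.
  by move=> j; rewrite mxE mxE; exact: du1.
have /choice[l lE] : forall i, exists v, dlsubmx u1 i 0 = iota v * c.
  by move=> i; rewrite mxE mxE; exact: du1.
pose rv : 'rV[V]_n := \row_j r j; pose lv : 'cV[V]_n := \col_i l i.
pose u2 := drsubmx u1 - c *: (lv^i *m rv^i).
have u1E : u1 = (block_mx 1%:M 0 lv 1%:M)^i *m block_mx c%:M 0 0 u2 *m (block_mx 1%:M rv 0 1%:M)^i.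
  rewrite -[LHS]submxK u1c !map_block_mx !mulmx_block !map_mx1 !map_mx0.
  rewrite !mul0mx !mulmx0 !mulmx1 !mul1mx !addr0 !add0r !mul_mx_scalar !mul_scalar_mx.
  congr block_mx.
  - by apply/rowP => j; rewrite rE !mxE mulrC.
  - by apply/colP => i; rewrite lE !mxE mulrC.
  - by rewrite -scalemxAl addrC subrK.
have du2 i j : vdvd c (u2 i j).
  have [v vE] := du1 (rshift 1 i) (rshift 1 j); exists (v - l i * r j).
  rewrite /u2 !mxE big_ord1 !mxE vE rmorphB rmorphM mulrBl; congr (_ - _).
  by rewrite mulrC.
have [L [L' [R [R' [D [hL hR u2E Ddv]]]]]] := IHn u2.
have hL1 := inverse_mxM (inverse_mxM (inverse_mx_tperm i0 (ord0 : 'I_n.+1)) (inverse_mx_lower lv))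
  (inverse_mx_lblock hL).
have hR1 := inverse_mxM (inverse_mxM (inverse_mx_lblock hR) (inverse_mx_upper rv))
  (inverse_mx_tperm j0 (ord0 : 'I_n.+1)).
do 4!eexists; exists (fun j => if j is j'.+1 then D j' else c).
split; [exact: hL1|exact: hR1|..].
- rewrite uE u1E !map_mxM -!mulmxA; do 2!congr (_ *m _); rewrite !mulmxA; do 2!congr (_ *m _).
  have dE : diag_mx (\row_(j < 1 + n) (if (j : nat) is j'.+1 then D j' else c)) =
      block_mx c%:M 0 0 (diag_mx (\row_j D j)).
    rewrite -diag_const_mx -diag_mx_row; congr diag_mx.
    apply/rowP => j; rewrite !mxE; case: splitP => k jk; rewrite !mxE jk //.
    by rewrite ord1.
  have blockE : block_mx c%:M 0 0 u2 = (block_mx 1%:M 0 0 L)^i *m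
      diag_mx (\row_(j < 1 + n) (if (j : nat) is j'.+1 then D j' else c)) *m (block_mx 1%:M 0 0 R)^i.
    rewrite dE !map_block_mx !mulmx_block !map_mx1 !map_mx0.
    by rewrite !(mul0mx, mulmx0, mulmx1, mul1mx, addr0, add0r) -u2E.
  exact: blockE.
- move=> [n0|j jn]; last exact: Ddv.
  have := vdvd_mulmx L' R' du2; rewrite u2E !mulmxA -map_mxM hL.2 map_mx1 mul1mx.
  rewrite -mulmxA -map_mxM hR.1 map_mx1 mulmx1 => /(_ (Ordinal (n0 : 0 < n)%N) (Ordinal (n0 : 0 < n)%N)).
  by rewrite !mxE eqxx.
Qed.

End Smith.

(** * A nondegenerate base form *)

Section BaseForm.
Variables (n m : nat).

(** The coefficients are integers, so the form makes sense over every residue field. The sum of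
    powers alone would split into separate variables; the power of the total sum couples them, and
    the large factor keeps the form nondegenerate. *)
Definition base_form (R : comNzRingType) : {mpoly R[n]} :=
  (n ^ m.-1).+1%:R *: \sum_j 'X_j ^+ m + (\sum_j 'X_j) ^+ m.

Lemma base_form_homog (R : comNzRingType) : base_form R \is m.-homog.
Proof.
have hX d (p : {mpoly R[n]}) : p \is 1%N.-homog -> p ^+ d \is d.-homog.
  by move=> hp; have := dhomogMn d hp; rewrite mul1n.
have h1 j : ('X_j : {mpoly R[n]}) \is 1%N.-homog by rewrite dhomogX /= mdeg1.
apply: rpredD; first by apply: rpredZ; apply: rpred_sum => j _; exact: hX.
by apply: hX; apply: rpred_sum => j _.
Qed.

Lemma base_form_map (R S : comNzRingType) (f : {rmorphism R -> S}) :
  map_mpoly f (base_form R) = base_form S.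
Proof.
rewrite rmorphD /= map_mpolyZ rmorph_nat rmorph_sum rmorphXn rmorph_sum /=.
congr (_ *: _ + _ ^+ _); apply: eq_bigr => j _; rewrite ?rmorphXn /= map_mpolyX //.
Qed.

Lemma deriv_varX (R : comNzRingType) (j k : 'I_n) d :
  ('X_j ^+ d : {mpoly R[n]})^`M(k) = (d * (j == k))%:R *: 'X_j ^+ d.-1.
Proof.
have -> : 'X_j ^+ d = 'X_[U_(j) *+ d] :> {mpoly R[n]} by rewrite mpolyXn.
rewrite mderivX mulmnE mnm1E; case: eqP => [<-|_]; last by rewrite mul0n muln0 !scale0r.
rewrite mul1n muln1 mpolyXn; congr (_ *: 'X_[_]); apply/mnmP => l.
by rewrite mnmBE !mulmnE mnm1E; case: eqP; rewrite ?mul0n ?mul1n ?subn1.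
Qed.

Lemma deriv_sumX (R : comNzRingType) (k : 'I_n) d :
  ((\sum_j 'X_j) ^+ d : {mpoly R[n]})^`M(k) = d%:R *: (\sum_j 'X_j) ^+ d.-1.
Proof.
have D1 : (\sum_j 'X_j : {mpoly R[n]})^`M(k) = 1.
  rewrite (raddf_sum (mderiv k)) (bigD1 k) //= big1 ?addr0 => [|j jk].
    by have := deriv_varX R k k 1; rewrite expr1 eqxx scale1r expr0.
  by have := deriv_varX R j k 1; rewrite expr1 (negPf jk) scale0r.
elim: d => [|d IHd]; first by rewrite expr0 -mpolyC1 mderivC scale0r.
rewrite exprS mderivM D1 mul1r IHd -scalerAr [in RHS]mulrS scalerDl scale1r; congr (_ + _).
by case: d {IHd} => [|d]; rewrite ?scale0r // -exprS.
Qed.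

Lemma base_form_deriv (R : comNzRingType) (k : 'I_n) :
  (base_form R)^`M(k) = m%:R *: ((n ^ m.-1).+1%:R *: 'X_k ^+ m.-1 + (\sum_j 'X_j) ^+ m.-1).
Proof.
rewrite mderivD mderivZ deriv_sumX scalerDr scalerA mulrC -scalerA; congr (_ *: _ + _).
rewrite (raddf_sum (mderiv k)) (bigD1 k) //= big1 ?addr0 => [|j jk].
  by rewrite deriv_varX eqxx muln1.
by rewrite deriv_varX (negPf jk) muln0 scale0r.
Qed.

Lemma base_form_deriv2 (R : comNzRingType) (k l : 'I_n) :
  (base_form R)^`M(k)^`M(l) = (m * m.-1)%:R *:
    (((n ^ m.-1).+1 * (k == l))%:R *: 'X_k ^+ (m - 2) + (\sum_j 'X_j) ^+ (m - 2)).
Proof.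
rewrite base_form_deriv mderivZ mderivD mderivZ deriv_sumX deriv_varX -subn2 (natrM _ m m.-1) -scalerA.
congr (_ *: _); rewrite [RHS]scalerDr; congr (_ + _); rewrite !natrM !scalerA.
by rewrite mulrA [_ * m.-1%:R]mulrC mulrA.
Qed.

(** At a critical point all [z j] have the same modulus r, and their sum l satisfies |l|^(m-1) = T
    r^(m-1) and |l| <= n r. As T = n^(m-1) + 1, this forces r = 0. *)
Lemma base_form_nondegenerate (C : numFieldType) (z : 'I_n -> C) : (2 <= m)%N ->
  (forall j, ((base_form C)^`M(j)).@[z] = 0) -> forall j, z j = 0.
Proof.
move=> m2 gz; pose T : C := (n ^ m.-1).+1%:R; pose l := \sum_j z j.
have m1 : (0 < m.-1)%N by rewrite -ltnS prednK // ltnW.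
have T0 : T != 0 by rewrite pnatr_eq0.
have zl j : T * z j ^+ m.-1 = - l ^+ m.-1.
  have /eqP := gz j; rewrite base_form_deriv mevalZ mulf_eq0 pnatr_eq0 -[m == 0%N]negbK -lt0n.
  rewrite (ltnW m2) /= mevalD mevalZ !rmorphXn /= mevalXU raddf_sum /=.
  by under eq_bigr => k _ do rewrite mevalXU; rewrite addr_eq0 => /eqP.
suff l0 : l = 0.
  move=> j; have /eqP := zl j; rewrite l0 expr0n eqn0Ngt m1 oppr0 mulf_eq0 (negPf T0) /=.
  by rewrite expf_eq0 m1 => /eqP.
apply/eqP; apply: contraT => l0.
have nl : 0 < `|l| by rewrite normr_gt0.
have nz j : T * `|z j| ^+ m.-1 = `|l| ^+ m.-1.
  by have := congr1 Num.norm (zl j); rewrite normrN normrM !normrX normr_nat.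
case: (posnP n) => [n0|n0].
  move: nl; rewrite /l big1 ?normr0 ?ltxx // => j _.
  by have := leq_ltn_trans (leq0n j) (ltn_ord j); rewrite n0.
pose j0 := Ordinal n0.
have eqz j : `|z j| = `|z j0|.
  apply/eqP; rewrite -(eqrXn2 m1) ?normr_ge0 //; apply/eqP; apply: (mulfI T0).
  by rewrite !nz.
have le : `|l| <= n%:R * `|z j0|.
  apply: le_trans (ler_norm_sum _ _ _) _.
  by under eq_bigr => j _ do rewrite eqz; rewrite sumr_const card_ord mulr_natl.
have : `|l| ^+ m.-1 <= (n ^ m.-1)%:R * `|z j0| ^+ m.-1.
  by rewrite natrX -exprMn lerXn2r // ?nnegrE ?mulr_ge0.
rewrite -(nz j0) /T -natr1 mulrDl mul1r gerDl => le0.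
have := nz j0.
have /eqP -> : `|z j0| ^+ m.-1 == 0 by rewrite eq_le le0 exprn_ge0.
by rewrite mulr0 => /esym/eqP; rewrite expf_eq0 m1 /= normr_eq0 (negPf l0).
Qed.

(** By degree, the derivatives of q are constant combinations of those of the base form. The
    symmetry of second derivatives, evaluated at well-chosen points, makes the matrix of these
    constants scalar. *)
Lemma base_form_irreducible (F : fieldType) (q : {mpoly F[n]}) : char0 F ->
    (3 <= m)%N -> (1 < n)%N -> (3 < m)%N || (2 < n)%N -> q \is m.-homog ->
    (forall k, gideal (fun j => (base_form F)^`M(j)) q^`M(k)) ->
  exists c, q = c *: base_form F.
Proof.
move=> F0 m3 n2 mn hq Jq; pose g j := (base_form F)^`M(j).
have hg j : g j \is m.-1.-homog by apply: homog_deriv; exact: base_form_homog.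
have F0n k : (0 < k)%N -> k%:R != 0 :> F by case: k => // k _; exact: F0.
pose T : F := (n ^ m.-1).+1%:R; have T0 : T != 0 by exact: F0.
have /choice[A AE] : forall k, exists a : 'I_n -> F, q^`M(k) = \sum_j a j *: g j.
  move=> k; have [h -> hh] := gideal_homogE hg (homog_deriv k hq) (Jq k).
  exists (fun j => (h j)@_0%MM); apply: eq_bigr => j _; have [hj _] := hh j.
  rewrite subnn in hj; have {1}-> : h j = mpolyC n (h j)@_0%MM; last by rewrite mul_mpolyC.
  apply/mpolyP => a; rewrite mcoeffC; case: eqP => [->|/eqP a0]; first by rewrite mulr1.
  by rewrite mulr0 (dhomog_nemf_coeff hj) //= mdeg_eq0.
pose a k := \sum_j A k j.
have D2 k l : q^`M(k)^`M(l) = (m * m.-1)%:R *: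
    ((T * A k l) *: 'X_l ^+ (m - 2) + a k *: (\sum_j 'X_j) ^+ (m - 2)).
  rewrite AE (raddf_sum (mderiv l)) /=.
  under eq_bigr => j _ do rewrite mderivZ base_form_deriv2 scalerA mulrC -scalerA scalerDr.
  rewrite -scaler_sumr big_split /= -scaler_suml; congr (_ *: (_ + _)).
  rewrite (bigD1 l) //= eqxx muln1 big1 ?addr0 => [|j jl]; first by rewrite scalerA mulrC.
  by rewrite (negPf jl) muln0 scale0r scaler0.
have sym k l (v : 'I_n -> F) : T * A k l * v l ^+ (m - 2) + a k * (\sum_j v j) ^+ (m - 2) =
    T * A l k * v k ^+ (m - 2) + a l * (\sum_j v j) ^+ (m - 2).
  have /(congr1 (meval v)) : q^`M(k)^`M(l) = q^`M(l)^`M(k) by rewrite mderiv_comm.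
  have mm : (m * m.-1)%:R != 0 :> F by apply: F0n; rewrite muln_gt0; case: (m) m3 => [|[]].
  rewrite !D2 !mevalZ => /(mulfI mm); rewrite !mevalD !mevalZ !rmorphXn /= !mevalXU raddf_sum /=.
  by under eq_bigr => j _ do rewrite mevalXU.
have m2 : (0 < m - 2)%N by rewrite subn_gt0.
pose e (p j : 'I_n) : F := (j == p)%:R.
have sume p : \sum_j e p j = 1.
  by rewrite (bigD1 p) //= /e eqxx big1 ?addr0 // => j /negPf ->.
have e0 (p j : 'I_n) : j != p -> e p j ^+ (m - 2) = 0.
  by move=> /negPf jp; rewrite /e jp expr0n eqn0Ngt m2.
have e1 (p : 'I_n) : e p p ^+ (m - 2) = 1 by rewrite /e eqxx expr1n.
have off k l : k != l -> a k = a l /\ A l k = 0.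
  move=> kl; have lk : l != k by rewrite eq_sym.
  have Ek := sym k l (e k); rewrite sume !expr1n (e0 k l lk) e1 !mulr1 mulr0 add0r in Ek.
  have El := sym k l (e l); rewrite sume !expr1n (e0 l k kl) e1 !mulr1 mulr0 add0r in El.
  suff akl : a k = a l.
    split=> //; move/eqP: Ek; rewrite akl -[X in X == _]add0r (inj_eq (addIr _)) eq_sym.
    by rewrite mulf_eq0 (negPf T0) => /eqP.
  (* A third unit vector compares [a k] and [a l] directly. With two variables the point [e k + e l]
     yields the factor 2^(m-2) - 2, which is nonzero only for m > 3: this excludes (2, 3). *)
  have [n3|n3] := ltnP 2 n.
    have [p pk pl] : exists2 p : 'I_n, p != k & p != l.
      have : (0 < #|~: [set k; l]|)%N.
        rewrite cardsCs setCK card_ord subn_gt0 (leq_ltn_trans _ n3) //.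
        by rewrite cards2; case: (k != l).
      case/card_gt0P=> p; rewrite !inE negb_or => /andP[pk pl]; by exists p.
    have := sym k l (e p); rewrite sume !expr1n !mulr1 !e0 ?mulr0 ?add0r //; by rewrite eq_sym.
  have m4 : (3 < m)%N by case/orP: mn => //; rewrite ltnNge n3.
  have := sym k l (fun j => e k j + e l j); rewrite big_split /= !sume.
  have -> : e k l = 0 by rewrite /e (negPf lk).
  have -> : e l k = 0 by rewrite /e (negPf kl).
  have ekk (p : 'I_n) : e p p = 1 by rewrite /e eqxx.
  rewrite !ekk add0r addr0 expr1n !mulr1 => H.
  have TA : T * A l k = a k - a l by rewrite Ek addrK.
  have TA' : T * A k l = a l - a k by rewrite -El addrK.
  move: H; rewrite TA TA' => H; apply/eqP; rewrite -subr_eq0.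
  have : (2 ^ (m - 2) - 2)%:R * (a k - a l) = 0.
    rewrite natrB; last by rewrite -{1}(expn1 2) leq_exp2l.
    rewrite natrX; set p := 2 ^+ (m - 2) in H *.
    have -> : (p - 2) * (a k - a l) = (a l - a k + a k * p) - (a k - a l + a l * p) by ring.
    by rewrite H subrr.
  move/eqP; rewrite mulf_eq0 => /orP[|//]; rewrite (negPf (F0n _ _)) // subn_gt0.
  by rewrite -{1}(expn1 2) ltn_exp2l // ltn_subRL.
pose k0 : 'I_n := Ordinal (ltnW n2).
have aE k : a k = A k k.
  by rewrite /a (bigD1 k) //= big1 ?addr0 // => j jk; have [] := off j k jk.
exists (a k0); have m0 : m%:R != 0 :> F by apply: F0n; exact: ltnW (ltnW m3).
apply: (scalerI m0); rewrite -(euler hq) scalerA mulrC -scalerA -(euler (base_form_homog F)).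
rewrite scaler_sumr; apply: eq_bigr => k _; rewrite AE (bigD1 k) //= big1 ?addr0 => [|j jk].
  rewrite -scalerAr -aE; congr (_ *: _); have [<- //|kk0] := eqVneq k k0.
  by have [] := off k k0 kk0.
by have [_ ->] := off _ _ jk; rewrite scale0r.
Qed.

End BaseForm.

(** * The coefficient space *)

Section CoefficientCoordinates.
Variables (n d : nat).

Definition fmon (i : 'I_(ncoef n d)) : 'X_{1..n} := bmnm (val (enum_val i : monom n d)).

Lemma fmon_deg i : mdeg (fmon i) = d.
Proof. by apply/eqP; exact: (valP (enum_val i : monom n d)). Qed.

Lemma fmon_inj : injective fmon.
Proof. by move=> i j /val_inj/val_inj/enum_val_inj. Qed.

Lemma fmon_surj a : mdeg a = d -> exists i, fmon i = a.
Proof.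
move=> ad; have ad1 : (mdeg a < d.+1)%N by rewrite ad.
have ad2 : mdeg (BMultinom ad1) == d by apply/eqP.
exists (enum_rank (exist (fun u : 'X_{1..n < d.+1} => mdeg u == d) (BMultinom ad1) ad2 : monom n d)).
by rewrite /fmon enum_rankK.
Qed.

Definition fgen (L : comNzRingType) (c : 'I_(ncoef n d) -> L) : {mpoly L[n]} :=
  \sum_i c i *: 'X_[fmon i].

Lemma fgen_homog (L : comNzRingType) (c : 'I_(ncoef n d) -> L) : fgen c \is d.-homog.
Proof. by apply: rpred_sum => i _; apply: rpredZ; rewrite dhomogX /= fmon_deg. Qed.

Lemma mcoeff_fgen (L : comNzRingType) (c : 'I_(ncoef n d) -> L) i : (fgen c)@_(fmon i) = c i.
Proof.
rewrite raddf_sum (bigD1 i) //= mcoeffZ mcoeffX eqxx mulr1 big1 ?addr0 // => j ji.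
by rewrite mcoeffZ mcoeffX (inj_eq fmon_inj) (negPf ji) mulr0.
Qed.

Lemma homog_eq (L : comNzRingType) (p q : {mpoly L[n]}) : p \is d.-homog -> q \is d.-homog ->
  (forall i, p@_(fmon i) = q@_(fmon i)) -> p = q.
Proof.
move=> hp hq pq; apply/mpolyP => a; have [/fmon_surj[i <-] //|ad] := eqVneq (mdeg a) d.
by rewrite !(dhomog_nemf_coeff _ ad).
Qed.

Lemma fgen_coef (L : comNzRingType) (p : {mpoly L[n]}) : p \is d.-homog ->
  p = fgen (fun i => p@_(fmon i)).
Proof. by move=> hp; apply: homog_eq (fgen_homog _) _ => // i; rewrite mcoeff_fgen. Qed.

Definition feval (C L : comNzRingType) (f : C -> L) (s : {mpoly C[ncoef n d]}) (B : {mpoly L[n]}) : L :=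
  mmap f (fun i => B@_(fmon i)) s.

Lemma feval_map (C L L' : comNzRingType) (f : {rmorphism C -> L}) (g : {rmorphism L -> L'}) s B :
  g (feval f s B) = feval (g \o f) s (map_mpoly g B).
Proof.
rewrite /feval /mmap rmorph_sum; apply: eq_bigr => a _; rewrite rmorphM; congr (_ * _).
by rewrite /mmap1 rmorph_prod; apply: eq_bigr => i _; rewrite rmorphXn mcoeff_map_mpoly.
Qed.

Lemma fevalE (K : fieldType) (s : formpoly K n d) (Q : Qform K n d) :
  evalf s Q = feval idfun s Q.
Proof. by []. Qed.

End CoefficientCoordinates.

Section ScalarExtension.
Variables (n : nat) (R S : comNzRingType) (f : {rmorphism R -> S}).
Local Notation ext := (map_mpoly f).
Implicit Types p q : {mpoly R[n]}.

Lemma mderiv_map p j : ext p^`M(j) = (ext p)^`M(j).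
Proof.
by apply/mpolyP => a; rewrite mcoeff_map_mpoly !mcoeff_deriv mcoeff_map_mpoly raddfMn.
Qed.

Lemma homog_map d p : p \is d.-homog -> ext p \is d.-homog.
Proof.
by move=> /homogP_coeff hp; apply/homogP_coeff => a ad; rewrite mcoeff_map_mpoly hp // raddf0.
Qed.

Lemma msub_map M p : ext (sub M p) = sub (map_mx f M) (ext p).
Proof.
elim/mpoly_ring_ind: p => [c|i|p q IHp IHq|p q IHp IHq].
- by rewrite subC !map_mpolyC subC.
- rewrite subX map_mpolyX subX rmorph_sum; apply: eq_bigr => j _ /=.
  by rewrite map_mpolyZ map_mpolyX mxE.
- by rewrite rmorphD !rmorphD /= IHp IHq.
- by rewrite rmorphM !rmorphM /= IHp IHq.
Qed.

Lemma apolar_map p q : f (apolar p q) = apolar (ext p) (ext q).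
Proof.
rewrite (mpolyE p) apolar_suml !rmorph_sum apolar_suml /=; apply: eq_bigr => a _.
by rewrite map_mpolyZ map_mpolyX !apolarZl !apolarX rmorphM rmorphMn mcoeff_map_mpoly.
Qed.

Lemma hess_map p : ext (hess p) = hess (ext p).
Proof.
rewrite /hess -det_map_mx; congr (\det _); apply/matrixP => i j.
by rewrite !mxE -!mderiv_map.
Qed.

End ScalarExtension.

Section LinearChange.
Variables (n : nat) (F : fieldType).
Implicit Types (Q p B : {mpoly F[n]}) (A : 'M[F]_n).
Local Notation J Q := (gideal (fun j => Q^`M(j))).

Lemma jac_subW A Q p : A \in unitmx -> J Q p -> J (sub A Q) (sub A p).
Proof.
move=> uA [h ->]; rewrite rmorph_sum; apply: gideal_sum => i _ /=; rewrite rmorphM.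
apply: gidealMl => /=; have -> : sub A Q^`M(i) = \sum_j invmx A j i *: (sub A Q)^`M(j).
  under eq_bigr => j _ do rewrite sub_deriv scaler_sumr.
  rewrite exchange_big (bigD1 i) //= [X in _ + X]big1 ?addr0 => [|k ki].
    under eq_bigr => j _ do rewrite scalerA.
    rewrite -scaler_suml; have := congr1 (fun M : 'M_n => M i i) (mulmxV uA).
    rewrite !mxE eqxx; under eq_bigr => j _ do rewrite mulrC.
    by move=> ->; rewrite scale1r.
  under eq_bigr => j _ do rewrite scalerA.
  rewrite -scaler_suml; have := congr1 (fun M : 'M_n => M k i) (mulmxV uA).
  rewrite !mxE (negPf ki); under eq_bigr => j _ do rewrite mulrC.
  by move=> ->; rewrite scale0r.
by apply: gideal_sum => j _; rewrite -mul_mpolyC; apply: gidealMl; exact: gideal_gen.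
Qed.

Lemma subK A p : A \in unitmx -> sub (invmx A) (sub A p) = p.
Proof. by move=> uA; rewrite sub_sub mulmxV // sub1. Qed.

Lemma subVK A p : A \in unitmx -> sub A (sub (invmx A) p) = p.
Proof. by move=> uA; rewrite sub_sub mulVmx // sub1. Qed.

Lemma jac_sub A Q p : A \in unitmx -> J (sub A Q) (sub A p) <-> J Q p.
Proof.
move=> uA; split; last exact: jac_subW.
by rewrite -unitmx_inv in uA *; move/(jac_subW uA); rewrite unitmx_inv in uA; rewrite !subK.
Qed.

Lemma jac_sub_fin A Q : A \in unitmx -> (exists e, forall i, J Q ('X_i ^+ e)) ->
  exists e, forall i, J (sub A Q) ('X_i ^+ e).
Proof.
move=> uA Qfin; have /choice[e He] : forall i, exists e, J (sub A Q) ('X_i ^+ e).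
  move=> i; have [|e He] := @gideal_nilp n F _ (sub (invmx A) 'X_i) Qfin.
    by rewrite -mevalz sub_meval mevalXU big1 // => j _; rewrite mulr0.
  by exists e; have := jac_subW uA He; rewrite rmorphXn /= subVK.
exists (\max_i e i) => i; rewrite -(subnK (leq_bigmax i : (e i <= _)%N)) exprD.
exact: gidealMl.
Qed.

Variable m : nat.
Local Notation N := (n * (m - 2))%N.

Definition annihilates Q B := forall p, p \is N.-homog -> J Q p <-> apolar p B = 0.

Lemma annihilates_sub A Q B : A \in unitmx -> annihilates Q B ->
  annihilates (sub (invmx A)^T Q) (sub A B).
Proof.
move=> uA QB p hp; have uA' : (invmx A)^T \in unitmx by rewrite unitmx_tr unitmx_inv.
have -> : p = sub (invmx A)^T (sub A^T p) by rewrite sub_sub -trmx_mul mulVmx // trmx1 sub1.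
rewrite jac_sub // -apolar_sub sub_sub -trmx_mul mulmxV // trmx1 sub1.
by apply: QB; exact: sub_homog.
Qed.

(** In degree N the Hessian spans a complement of the ideal. The hypotheses on [B] are finitely many
    equations and one inequality, so they survive an extension of scalars. *)
Lemma annihilates_crit Q B : (3 <= m)%N -> char0 F -> Q \is m.-homog ->
    (exists e, forall i, J Q ('X_i ^+ e)) ->
    (forall a j, mdeg a = (N - m.-1)%N -> apolar ('X_[a] * Q^`M(j)) B = 0) ->
    apolar (hess Q) B != 0 -> annihilates Q B.
Proof.
move=> m_ge3 F0 Qh Qfin JB hB p hp.
have JB' q : q \is N.-homog -> J Q q -> apolar q B = 0.
  move=> hq Jq; have [h -> hh] := gideal_homogE (jac_homog Qh) hq Jq.
  rewrite apolar_suml big1 // => j _; have [hj _] := hh j.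
  rewrite (mpolyE (h j)) mulr_suml apolar_suml big_seq big1 // => a aj.
  by rewrite -scalerAl apolarZl JB ?mulr0 //; exact: (dhomogP _ _ _ hj _ aj).
split=> [|p0]; first exact: JB'.
have [w [w1 _ _ wH]] := milnor_residue m_ge3 (pred_deg_neq0 m_ge3 F0) Qh Qfin.
have hH := hess_homog m_ge3 Qh.
have hpH : p - (w p / w (hess Q)) *: hess Q \is N.-homog by apply: rpredB => //; exact: rpredZ.
have : J Q (p - (w p / w (hess Q)) *: hess Q).
  apply/w1 => //.
  by rewrite raddfB /= (linearZ_LR w) divfK // subrr.
move/(JB' _ hpH)/eqP; rewrite apolarDl -scaleNr apolarZl p0 add0r.
rewrite mulf_eq0 (negPf hB) orbF oppr_eq0 mulf_eq0 invr_eq0 (negPf wH) orbF => /eqP wp.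
exact/w1.
Qed.

End LinearChange.

(** * Regular functions *)

Section GenericForm.
Variables (n d : nat) (K : fieldType).

Definition generic_form : {mpoly (formpoly K n d)[n]} := fgen (fun i => 'X_i).

Definition evalf_at (Q : Qform K n d) (P : formpoly K n d) : K := evalf P Q.
HB.instance Definition _ Q := GRing.RMorphism.copy (evalf_at Q) (meval (coefs Q)).

Lemma generic_form_homog : generic_form \is d.-homog. Proof. exact: fgen_homog. Qed.

Lemma coefsE (Q : Qform K n d) i : coefs Q i = (Q : {mpoly K[n]})@_(fmon i).
Proof. by []. Qed.

Lemma generic_form_eval (Q : Qform K n d) : map_mpoly (evalf_at Q) generic_form = Q.
Proof.
apply: (@homog_eq n d); [exact/homog_map/generic_form_homog|exact: dhomog_is_dhomog|].
move=> i; rewrite mcoeff_map_mpoly mcoeff_fgen.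
exact: etrans (mevalXU _ _) _.
Qed.

Definition mkform (c : 'I_(ncoef n d) -> K) : Qform K n d := DHomog (fgen_homog c).

Lemma coefs_mkform c : coefs (mkform c) =1 c.
Proof. by move=> i; rewrite coefsE /= mcoeff_fgen. Qed.

Lemma evalf_mkform c P : evalf P (mkform c) = P.@[c].
Proof. by apply: meval_eq; exact: coefs_mkform. Qed.

Lemma formpoly_nonzero (P : formpoly K n d) : char0 K -> P != 0 -> exists Q, evalf P Q != 0.
Proof.
move=> K0 /(mpoly_nat_nonzero K0)[v Pv].
by exists (mkform (fun i => (v i)%:R)); rewrite evalf_mkform.
Qed.

End GenericForm.

Lemma rowsubM (R : pzRingType) p p' q r (g : 'I_p' -> 'I_p) (A : 'M[R]_(p, q)) (B : 'M_(q, r)) :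
  rowsub g (A *m B) = rowsub g A *m B.
Proof. by apply/matrixP => i j; rewrite !mxE; apply: eq_bigr => k _; rewrite mxE. Qed.

Section FullRank.
Variables (n d : nat) (K : fieldType).
Local Notation at_ Q := (map_mx (@evalf_at n d K Q)).

Lemma full_rank_inj p q (E : 'M[K]_(p, q)) :
  (forall v : 'cV_q, E *m v = 0 -> v = 0) -> row_full E.
Proof.
move=> inj; rewrite /row_full eqn_leq rank_leq_col -subn_eq0 -mxrank_coker mxrank_eq0.
apply/eqP/matrixP => i j; have := inj (col j (cokermx E)).
rewrite {1}colE mulmxA mulmx_coker mul0mx => /(_ erefl) H; have /colP/(_ i) : col j (cokermx E) = 0.
  exact: H.
by rewrite !mxE.
Qed.

Lemma full_rank_minor p q (E : 'M[formpoly K n d]_(p, q)) (Q0 : Qform K n d) :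
  (forall v : 'cV_q, at_ Q0 E *m v = 0 -> v = 0) ->
  exists g : 'I_q -> 'I_p, evalf (\det (rowsub g E)) Q0 != 0.
Proof.
move=> /full_rank_inj fE; exists (fullrankfun fE).
rewrite -[evalf _ _]/(evalf_at Q0 _) -det_map_mx map_mxsub -unitfE -unitmxE.
exact: fullrowsub_unit.
Qed.

End FullRank.

Section Regular.
Variables (n m : nat) (K : fieldType).
Local Notation X := (@Defs.nondegenerate K n m).
Implicit Types (f g : Qform K n m -> K) (Q : Qform K n m).

Lemma regular_evalf P : regular_function (fun Q => evalf P Q).
Proof.
move=> Q0 _; exists P, 1; rewrite /evalf rmorph1 oner_eq0; split=> // Q _ _.
by rewrite rmorph1 divr1.
Qed.

Lemma regularD f g : regular_function f -> regular_function g ->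
  regular_function (fun Q => f Q + g Q).
Proof.
move=> rf rg Q0 XQ0; have [P [S [S0 fE]]] := rf Q0 XQ0; have [P' [S' [S0' gE]]] := rg Q0 XQ0.
exists (P * S' + P' * S), (S * S'); rewrite /evalf rmorphM; split; first exact: mulf_neq0.
move=> Q XQ; rewrite !rmorphD !rmorphM mulf_eq0 negb_or => /andP[SQ SQ'] /=.
by rewrite fE // gE // addf_div.
Qed.

Lemma regularM f g : regular_function f -> regular_function g ->
  regular_function (fun Q => f Q * g Q).
Proof.
move=> rf rg Q0 XQ0; have [P [S [S0 fE]]] := rf Q0 XQ0; have [P' [S' [S0' gE]]] := rg Q0 XQ0.
exists (P * P'), (S * S'); rewrite /evalf rmorphM; split; first exact: mulf_neq0.
move=> Q XQ; rewrite !rmorphM mulf_eq0 negb_or => /andP[SQ SQ'] /=.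
by rewrite fE // gE // mulf_div.
Qed.

Lemma regular_ext f g : (forall Q, X Q -> f Q = g Q) -> regular_function f -> regular_function g.
Proof.
move=> fg rf Q0 XQ0; have [P [S [S0 fE]]] := rf Q0 XQ0; exists P, S; split=> // Q XQ SQ.
by rewrite -fg // fE.
Qed.

Lemma regular_const c : regular_function (fun _ : Qform K n m => c).
Proof.
by apply: regular_ext (regular_evalf c%:MP) => Q _; rewrite /evalf mevalC.
Qed.

(** Near each point some maximal minor does not vanish, and Cramer's rule writes the solution as a
    quotient. *)
Lemma regular_linear_solution p q (E : 'M[formpoly K n m]_(p, q)) (e : 'cV[formpoly K n m]_p)
    (b : Qform K n m -> 'cV[K]_q) :
    (forall Q, X Q -> map_mx (evalf_at Q) E *m b Q = map_mx (evalf_at Q) e) ->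
    (forall Q, X Q -> forall v : 'cV_q, map_mx (evalf_at Q) E *m v = 0 -> v = 0) ->
  forall i, regular_function (fun Q => b Q i 0).
Proof.
move=> Eb injE i Q0 XQ0; have [g Sg] := full_rank_minor (injE _ XQ0).
exists ((\adj (rowsub g E) *m rowsub g e) i 0), (\det (rowsub g E)); split=> // Q XQ SQ.
have /(congr1 (rowsub g)) := Eb Q XQ; rewrite rowsubM => /(congr1 (mulmx (\adj (rowsub g (map_mx (evalf_at Q) E))))).
rewrite mulmxA mul_adj_mx mul_scalar_mx => /(congr1 (fun v : 'cV_q => v i 0)).
rewrite [LHS]mxE -map_mxsub det_map_mx => E1.
apply: (canRL (mulfK SQ)); rewrite mulrC E1 -map_mxsub -map_mx_adj -map_mxM mxE.
by [].
Qed.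

End Regular.

Section Openness.
Variables (n m : nat) (K : fieldType).
Hypothesis K0 : char0 K.
Hypothesis Null : forall Q : Qform K n m, Defs.nondegenerate Q ->
  exists e, forall i, gideal (fun j => (Q : {mpoly K[n]})^`M(j)) ('X_i ^+ e).
Local Notation X := (@Defs.nondegenerate K n m).

(** Nondegeneracy follows once the Jacobian ideal contains all monomials of some degree k, and this
    holds where a maximal minor of the matrix of multiples of the derivatives does not vanish. *)
Lemma nondegenerate_open (Q0 : Qform K n m) : X Q0 ->
  exists E : formpoly K n m, evalf E Q0 != 0 /\ forall Q, evalf E Q != 0 -> X Q.
Proof.
move=> XQ0; have [e Je] := Null XQ0; pose k := (n * e.-1).+1.
pose row_t := ('X_{1..n < k.+1} * 'I_n)%type; pose G := @generic_form n m K.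
pose rowp (Q : {mpoly K[n]}) (t : row_t) := 'X_[t.1] * Q^`M(t.2).
pose E : 'M[formpoly K n m]_(#|{: row_t}|, ncoef n k) :=
  \matrix_(t, c) ('X_[(enum_val t : row_t).1] * G^`M((enum_val t : row_t).2))@_(fmon c).
have EE Q : map_mx (evalf_at Q) E = \matrix_(t, c) (rowp Q (enum_val t : row_t))@_(fmon c).
  apply/matrixP => t c; rewrite !mxE -mcoeff_map_mpoly rmorphM /= map_mpolyX mderiv_map.
  by rewrite generic_form_eval.
have [|g gQ0] := @full_rank_minor n m K _ _ E Q0.
  move=> v Ev; apply/colP => c; rewrite [RHS]mxE.
  have Jc : gideal (fun j => (Q0 : {mpoly K[n]})^`M(j)) 'X_[fmon c].
    by apply: (gideal_highdeg Je) => u; rewrite msuppX inE => /eqP ->; rewrite fmon_deg.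
  (* The kernel vector read as a functional on forms of degree k: it kills the ideal, hence every
     monomial of degree k. *)
  pose L (p : {mpoly K[n]}) := \sum_c p@_(fmon c) * v c 0.
  have LX : L 'X_[fmon c] = v c 0.
    rewrite /L (bigD1 c) //= mcoeffX eqxx mul1r big1 ?addr0 // => j jc.
    by rewrite mcoeffX (inj_eq (@fmon_inj n k)) eq_sym (negPf jc) mul0r.
  have LD p q : L (p + q) = L p + L q.
    by rewrite /L -big_split; apply: eq_bigr => j _; rewrite mcoeffD mulrDl.
  have L0 : L 0 = 0 by rewrite /L big1 // => j _; rewrite mcoeff0 mul0r.
  have LZ a p : L (a *: p) = a * L p.
    by rewrite /L mulr_sumr; apply: eq_bigr => j _; rewrite mcoeffZ mulrA.
  rewrite -LX; case: Jc => h ->; elim/big_ind: _ => // [p q Lp Lq|j _].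
    by rewrite LD Lp Lq addr0.
  rewrite (mpolyE (h j)) mulr_suml; elim/big_ind: _ => // [p q Lp Lq|a _].
    by rewrite LD Lp Lq addr0.
  rewrite -scalerAl LZ; have [ak|ak] := ltnP (mdeg a) k.+1; last first.
    rewrite /L big1 ?mulr0 // => c' _; rewrite memN_msupp_eq0 ?mul0r //; apply/negP.
    case/msuppM_le/allpairsP=> -[u v'] /= [+ _ /(congr1 mdeg)]; rewrite msuppX inE => /eqP ->.
    rewrite mdegD fmon_deg => kE; by move: ak; rewrite kE -addnS -[X in (_ <= X)%N]addn0 leq_add2l.
  have /(congr1 (fun w : 'cV_ _ => w (enum_rank ((BMultinom ak, j) : row_t)) 0)) := Ev.
  rewrite EE mxE [RHS]mxE => E1; rewrite -[RHS](mulr0 (h j)@_a) -[in RHS]E1; congr (_ * _).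
  by apply: eq_bigr => c' _; rewrite mxE enum_rankK.
exists (\det (rowsub g E)); split=> // Q.
rewrite -[evalf _ _]/(evalf_at Q _) -det_map_mx map_mxsub EE -unitfE -unitmxE => uE.
have JQ c : gideal (fun j => (Q : {mpoly K[n]})^`M(j)) 'X_[@fmon n k c].
  set M := rowsub g _ in uE; pose r := row c (invmx M).
  have -> : 'X_[fmon c] = \sum_i r 0 i *: pihomog mdeg k (rowp Q (enum_val (g i) : row_t)).
    apply: (@homog_eq n k).
    - by rewrite dhomogX /= fmon_deg.
    - by apply: rpred_sum => i _; apply: rpredZ; exact: pihomogP.
    - move=> c'; rewrite mcoeffX raddf_sum /= (inj_eq (@fmon_inj n k)).
      have := congr1 (fun A : 'M_(ncoef n k) => A c c') (mulVmx uE); rewrite mxE [RHS]mxE => <-.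
      apply: eq_bigr => i _; rewrite mcoeffZ mcoeff_pihomog fmon_deg eqxx; congr (_ * _).
        by rewrite mxE.
      by rewrite !mxE.
  apply: gideal_sum => i _; rewrite -mul_mpolyC; apply: gidealMl.
  apply: gideal_pihomog (_ : forall j, (Q : {mpoly K[n]})^`M(j) \is m.-1.-homog) _.
    by move=> j; apply: homog_deriv; exact: dhomog_is_dhomog.
  by apply: gidealMl; exact: (gideal_gen (fun j => (Q : {mpoly K[n]})^`M(j))).
move=> z gz j; have [|c cE] := @fmon_surj n k (U_(j) *+ k)%MM.
  by rewrite mdegMn mdeg1 mul1n.
have [h hE] := JQ c; have /(congr1 (meval z)) := hE; rewrite cE -mpolyXn rmorphXn /= mevalXU.
rewrite raddf_sum big1 => [/eqP|i _]; last by rewrite /= mevalM gz mulr0.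
by rewrite expf_eq0 => /andP[_ /eqP].
Qed.

(** Irreducibility of the nondegenerate locus: the local numerators and denominators and the
    equation of an open neighbourhood have a nonzero product, which has a nonzero value
    somewhere. *)
Lemma regular_mul_eq0 (f g : Qform K n m -> K) : regular_function f -> regular_function g ->
    (forall Q, X Q -> f Q * g Q = 0) -> (exists2 Q, X Q & g Q != 0) ->
  forall Q, X Q -> f Q = 0.
Proof.
move=> rf rg fg [Q1 XQ1 gQ1] Q0 XQ0; apply: contrapT => /eqP fQ0.
have [P [S [S0 fE]]] := rf Q0 XQ0; have [P' [S' [S0' gE]]] := rg Q1 XQ1.
have [E [E0 EX]] := nondegenerate_open XQ1.
have nz (T : formpoly K n m) Q : evalf T Q != 0 -> T != 0.
  by apply: contraNneq => ->; rewrite /evalf meval0.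
have P0 : evalf P Q0 != 0 by apply: contraNneq fQ0; rewrite fE // => ->; rewrite mul0r.
have P0' : evalf P' Q1 != 0 by apply: contraNneq gQ1; rewrite gE // => ->; rewrite mul0r.
have [|Q] := @formpoly_nonzero n m K (E * (S * P) * (S' * P')) K0.
  by rewrite !mulf_neq0 ?(nz _ _ P0) ?(nz _ _ P0') ?(nz _ _ S0) ?(nz _ _ S0') ?(nz _ _ E0).
rewrite /evalf !rmorphM !mulf_eq0 !negb_or -!/(evalf _ _) => /andP[/andP[EQ /andP[SQ PQ]] /andP[SQ' PQ']].
have XQ := EX Q EQ; have /eqP := fg Q XQ; rewrite fE // gE // !mulf_eq0 !invr_eq0.
by rewrite (negPf SQ) (negPf PQ) (negPf SQ') (negPf PQ').
Qed.

End Openness.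

Section PhiRegular.
Variables (R : realType) (n m : nat).
Hypotheses (n_ge2 : (2 <= n)%N) (m_ge3 : (3 <= m)%N).
Local Notation C := R[i].
Local Notation S := {mpoly C[n]}.
Local Notation X := (@Defs.nondegenerate C n m).
Local Notation N := (n * (m - 2))%N.
Local Notation J Q := (gideal (fun j => (Q : S)^`M(j))).
Local Notation PhiQ Q := (@Phi C n m m_ge3 Q).

Lemma complex_char0 : char0 C. Proof. by move=> k; rewrite pnatr_eq0. Qed.

Let n_gt0 : (0 < n)%N. Proof. exact: ltnW. Qed.

Lemma nondegenerate_fin (Q : Qform C n m) : X Q -> exists e, forall i, J Q ('X_i ^+ e).
Proof.
move=> XQ; apply: (@homogeneous_nullstellensatz R n n _ (fun=> m.-1)) => //.
by move=> j; apply: homog_deriv; exact: dhomog_is_dhomog.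
Qed.

Lemma Phi_annihilates (Q : Qform C n m) : X Q -> annihilates m (Q : S) (PhiQ Q : S).
Proof. by move=> /nondegenerate_fin Qfin; have [_ h _] := Phi_spec m_ge3 n_gt0 complex_char0 Qfin. Qed.

Lemma Phi_hess (Q : Qform C n m) : X Q -> apolar (hess (Q : S)) (PhiQ Q : S) = N`!%:R.
Proof. by move=> /nondegenerate_fin Qfin; have [_ _ h] := Phi_spec m_ge3 n_gt0 complex_char0 Qfin. Qed.

Lemma mfact_neq0 (F : fieldType) k (a : 'X_{1..k}) : char0 F -> (mfact a)%:R != 0 :> F.
Proof.
move=> F0; rewrite -[mfact a]prednK ?F0 //; elim/big_ind: (mfact a) => // [x y|i _].
  by move=> x0 y0; rewrite muln_gt0 x0.
exact: fact_gt0.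
Qed.

Lemma apolar_form_eq0 (B : S) : B \is N.-homog ->
  (forall p, p \is N.-homog -> apolar p B = 0) -> B = 0.
Proof.
move=> hB B0; apply/mpolyP => a; rewrite mcoeff0; have [aN|aN] := eqVneq (mdeg a) N; last first.
  exact: dhomog_nemf_coeff hB aN.
have /eqP : apolar 'X_[a] B = 0 by apply: B0; rewrite dhomogX /= aN.
by rewrite apolarX -mulr_natr mulf_eq0 (negPf (mfact_neq0 a complex_char0)) orbF => /eqP.
Qed.

Lemma hess_jac_span (Q : Qform C n m) (B : S) : X Q ->
    (forall a j, mdeg a = (N - m.-1)%N -> apolar ('X_[a] * (Q : S)^`M(j)) B = 0) ->
    apolar (hess (Q : S)) B = 0 -> forall p, p \is N.-homog -> apolar p B = 0.
Proof.
move=> XQ JB hB p hp; have Qh := dhomog_is_dhomog Q; have Qfin := nondegenerate_fin XQ.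
have [w [w1 _ _ wH]] := milnor_residue m_ge3 (pred_deg_neq0 m_ge3 complex_char0) Qh Qfin.
have hH := hess_homog m_ge3 Qh.
have hpH : p - (w p / w (hess (Q : S))) *: hess (Q : S) \is N.-homog.
  by apply: rpredB => //; exact: rpredZ.
have /(w1 _ hpH) Jp : w (p - (w p / w (hess (Q : S))) *: hess (Q : S)) = 0.
  by rewrite raddfB /= (linearZ_LR w) divfK // subrr.
have [h hE hh] := gideal_homogE (jac_homog Qh) hpH Jp.
have : apolar (p - (w p / w (hess (Q : S))) *: hess (Q : S)) B = 0.
  rewrite hE apolar_suml big1 // => j _; have [hj _] := hh j.
  rewrite (mpolyE (h j)) mulr_suml apolar_suml big_seq big1 // => a aj.
  by rewrite -scalerAl apolarZl JB ?mulr0 //; exact: (dhomogP _ _ _ hj _ aj).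
by rewrite apolarDl -scaleNr apolarZl hB mulr0 addr0.
Qed.

(** The associated form is the only solution of a linear system with coefficients polynomial in Q:
    it is apolar to the multiples of the derivatives and pairs to N! with the Hessian (the row
    [None]). *)
Lemma Phi_coef_regular i : regular_function (fun Q : Qform C n m => coefs (PhiQ Q) i).
Proof.
pose T := option ('X_{1..n < N.+1} * 'I_n); pose G := generic_form n m C.
pose row_ (L : comNzRingType) (q : {mpoly L[n]}) (t : T) : {mpoly L[n]} :=
  if t is Some (a, j) then if mdeg a == (N - m.-1)%N then 'X_[a] * q^`M(j) else 0 else hess q.
pose E : 'M[formpoly C n m]_(#|{: T}|, ncoef n N) :=
  \matrix_(t, c) apolar (row_ _ G (enum_val t : T)) 'X_[fmon c].
pose e : 'cV[formpoly C n m]_(#|{: T}|) := \col_t (if (enum_val t : T) is Some _ then 0 else N`!%:R).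
have EE (Q : Qform C n m) t (v : 'cV[C]_(ncoef n N)) : (map_mx (evalf_at Q) E *m v) t 0 =
    apolar (row_ _ (Q : S) (enum_val t : T)) (fgen (v^~ 0)).
  rewrite mxE [RHS]raddf_sum; apply: eq_bigr => c _ /=; rewrite (linearZ_LR (apolar _)) mulrC.
  congr (_ * _); rewrite !mxE; apply: etrans (apolar_map _ _ _) _.
  rewrite map_mpolyX; congr apolar; case: (enum_val t : T) => [[a j]|] /=.
    case: eqP => _; last by rewrite rmorph0.
    by rewrite rmorphM /= map_mpolyX mderiv_map generic_form_eval.
  by rewrite hess_map generic_form_eval.
apply: regular_ext (regular_linear_solution (E := E) (e := e) (b := fun Q => \col_c coefs (PhiQ Q) c) _ _ i).
- by move=> Q _; rewrite mxE.
- move=> Q XQ; apply/colP => t; rewrite EE !mxE.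
  have -> : fgen ((\col_c coefs (PhiQ Q) c)^~ 0) = (PhiQ Q : S).
    rewrite [RHS](@fgen_coef n N) ?dhomog_is_dhomog //; apply: eq_bigr => c _; by rewrite mxE.
  case: (enum_val t : T) => [[a j]|] /=; last by rewrite Phi_hess // rmorph_nat.
  rewrite rmorph0; case: eqP => [aN|_]; last first.
    by rewrite -(mul0r (0 : S)) mul0r -(scale0r (1 : S)) apolarZl mul0r.
  have mN : (m.-1 <= N)%N.
    apply: (@leq_trans (2 * (m - 2))); last by rewrite leq_mul2r n_ge2 orbT.
    by move: m_ge3; clear; lia.
  have JX : J Q ('X_[a] * (Q : S)^`M(j)).
    by apply: gidealMl; exact: (gideal_gen (fun j => (Q : S)^`M(j))).
  apply/(Phi_annihilates XQ) => //.
  rewrite -[X in X.-homog](subnK mN); apply: dhomogM; first by rewrite dhomogX /= aN.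
  by apply: homog_deriv; exact: dhomog_is_dhomog.
move=> Q XQ v Ev; have E0 t : apolar (row_ _ (Q : S) t) (fgen (v^~ 0)) = 0.
  by rewrite -[t]enum_rankK -EE Ev mxE.
have /(apolar_form_eq0 (fgen_homog _)) v0 : forall p, p \is N.-homog -> apolar p (fgen (v^~ 0)) = 0.
  apply: (hess_jac_span XQ) => [a j aN|]; last exact: (E0 None).
  have aN' : (mdeg a < N.+1)%N by rewrite aN ltnS leq_subr.
  by have := E0 (Some (BMultinom aN', j)); rewrite /= aN eqxx.
by apply/colP => c; rewrite -[LHS](mcoeff_fgen (v^~ 0)) v0 mcoeff0 mxE.
Qed.

Lemma Phi_evalf_regular (P : formpoly C n N) :
  regular_function (fun Q : Qform C n m => evalf P (PhiQ Q)).
Proof.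
elim/mpoly_ring_ind: P => [c|i|p q IHp IHq|p q IHp IHq].
- by apply: regular_ext (@regular_const n m C c) => Q _; rewrite /evalf mevalC.
- by apply: regular_ext (Phi_coef_regular i) => Q _; rewrite /evalf mevalXU.
- by apply: regular_ext (regularD IHp IHq) => Q _; rewrite /evalf mevalD.
- by apply: regular_ext (regularM IHp IHq) => Q _; rewrite /evalf mevalM.
Qed.

End PhiRegular.

(** * Recovering a form from its associated form *)

Definition subform n d (K : fieldType) (u : 'M[K]_n) (B : Qform K n d) : Qform K n d :=
  DHomog (sub_homog u (dhomog_is_dhomog B)).

Lemma act_sub n d (K : fieldType) (A : 'M[K]_n) (Q : Qform K n d) :
  act A Q = subform (invmx A) Q.
Proof.
apply: val_inj; rewrite /= /sub; congr comp_mpoly; apply: eq_from_tnth => i.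
by rewrite !tnth_mktuple; apply: eq_bigr => j _; rewrite mxE.
Qed.

Lemma sub_scalar n d (K : comNzRingType) (c : K) (p : {mpoly K[n]}) : p \is d.-homog ->
  sub c%:M p = c ^+ d *: p.
Proof.
move=> hp; rewrite (mpolyE p) raddf_sum scaler_sumr big_seq [RHS]big_seq; apply: eq_bigr => a ap.
have <- : mdeg a = d by exact: (dhomogP _ _ _ hp _ ap).
transitivity (p@_a *: (c ^+ mdeg a *: 'X_[a])); last by rewrite !scalerA mulrC.
rewrite /= -mul_mpolyC rmorphM /= subC mul_mpolyC; congr (_ *: _); rewrite mpolyXE_id rmorph_prod mdegE -prodrXr /=.
rewrite -scaler_prod; apply: eq_bigr => i _; rewrite rmorphXn /= subX (bigD1 i) //=.
rewrite big1 ?addr0 => [|j ji]; first by rewrite mxE eqxx mulr1n exprZn.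
by rewrite mxE eq_sym (negPf ji) mulr0n scale0r.
Qed.

Section RationalInverse.
Variables (R : realType) (n m : nat).
Hypotheses (n_ge2 : (2 <= n)%N) (m_ge3 : (3 <= m)%N).
Local Notation C := R[i].
Local Notation S := {mpoly C[n]}.
Local Notation X := (@Defs.nondegenerate C n m).
Local Notation N := (n * (m - 2))%N.
Local Notation J Q := (gideal (fun j => (Q : S)^`M(j))).
Local Notation PhiQ Q := (@Phi C n m m_ge3 Q).
Variable f : Qform C n m -> C.
Hypotheses (f_regular : regular_function f) (f_invariant : GL_invariant f).

Lemma fin_nondegenerate (Q : Qform C n m) : (exists e, forall i, J Q ('X_i ^+ e)) -> X Q.
Proof.
move=> [e Je] z gz j; have [h /(congr1 (meval z))] := Je j.
rewrite rmorphXn /= mevalXU raddf_sum big1 => [/eqP|k _]; last by rewrite /= mevalM gz mulr0.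
by rewrite expf_eq0 => /andP[_ /eqP].
Qed.

Lemma nondegenerate_neq0 (Q : Qform C n m) : X Q -> (Q : S) != 0.
Proof.
move=> XQ; apply/negP => /eqP Q0; have E1 : 1 = 0 :> C.
  by apply: (XQ (fun=> 1) _ (Ordinal (ltnW n_ge2))) => j; rewrite Q0 linear0 meval0.
by move/eqP: E1; rewrite oner_eq0.
Qed.

(** An m-th root of the scalar is absorbed into the matrix. *)
Lemma invariant_orbit (Q Q' : Qform C n m) (u : 'M[C]_n) (l : C) : X Q -> u \in unitmx ->
  l != 0 -> (Q' : S) = l *: sub u (Q : S) -> X Q' /\ f Q' = f Q.
Proof.
move=> XQ uu l0 Q'E; pose c := (m.-root l)%R; have m0 : (0 < m)%N by exact: ltn_trans m_ge3.
have cm : c ^+ m = l by exact: rootCK.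
have c0 : c != 0 by apply: contraNneq l0 => c0; rewrite -cm c0 expr0n eqn0Ngt m0.
have ucu : c *: u \in unitmx by rewrite unitmxZ // unitfE.
have Q'E2 : Q' = subform (c *: u) Q.
  apply: val_inj; apply: etrans Q'E _; rewrite /= -mul_mx_scalar -sub_sub -cm (@sub_scalar n m) //.
  exact/sub_homog/dhomog_is_dhomog.
split; last first.
  by rewrite Q'E2 -(invmxK (c *: u)) -act_sub f_invariant // unitmx_inv.
by apply: fin_nondegenerate; rewrite Q'E2 /=; apply: jac_sub_fin => //; exact: nondegenerate_fin.
Qed.

Lemma jac_of_annihilator (Q : Qform C n m) (B p : S) k : X Q -> annihilates m (Q : S) B ->
    (k <= N)%N -> p \is k.-homog ->
    (forall a, mdeg a = (N - k)%N -> apolar ('X_[a] * p) B = 0) -> J Q p.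
Proof.
move=> XQ QB kN hp pB; have Qfin := nondegenerate_fin XQ.
have [w [w1 _ w3 _]] := milnor_residue m_ge3 (pred_deg_neq0 m_ge3 (@complex_char0 R)) (dhomog_is_dhomog Q) Qfin.
apply: (w3 _ _ kN hp) => q hq; have hpq : p * q \is N.-homog.
  by rewrite -(subnKC kN); exact: dhomogM.
apply/(w1 _ hpq)/(QB _ hpq); rewrite (mpolyE q) mulr_sumr apolar_suml big_seq big1 // => a aq.
rewrite -scalerAr apolarZl mulrC [p * _]mulrC pB ?mul0r //; exact: (dhomogP _ _ _ hq _ aq).
Qed.

Lemma deg_le_N : (m.-1 <= N)%N.
Proof.
apply: (@leq_trans (2 * (m - 2))); last by rewrite leq_mul2r n_ge2 orbT.
by move: m_ge3; clear; lia.
Qed.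

(** The rows of [E] ask that the derivatives of an unknown form be apolar to B in all complementary
    degrees; one more row reads the coefficient [c0]. At Phi(Q1) the kernel is zero by the
    assumption on Q1, so a minor [G0] is nonzero there, and where it does not vanish Cramer's rule
    gives a form proportional to the wanted one. *)
Lemma rational_inverse (Q1 : Qform C n m) : X Q1 ->
    (forall q, q \is m.-homog -> (forall k, J Q1 q^`M(k)) -> exists c, q = c *: (Q1 : S)) ->
  exists s p : formpoly C n N, evalf s (PhiQ Q1) != 0 /\
    forall Q u, X Q -> u \in unitmx ->
      evalf p (subform u (PhiQ Q)) = f Q * evalf s (subform u (PhiQ Q)).
Proof.
move=> XQ1 irr; pose T := option ('X_{1..n < N.+1} * 'I_n); pose G := generic_form n N C.
have [c0 Qc0] : exists c0, coefs Q1 c0 != 0.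
  apply: contrapT => /forallNP H; case/negP: (nondegenerate_neq0 XQ1); apply/eqP.
  apply: (@homog_eq n m); [exact: dhomog_is_dhomog|exact: rpred0|move=> i].
  by rewrite mcoeff0; apply/eqP; have /negP := H i; rewrite negbK.
pose E : 'M[formpoly C n N]_(#|{: T}|, ncoef n m) := \matrix_(t, c)
  if (enum_val t : T) is Some (a, j) then
    if mdeg a == (N - m.-1)%N then apolar ('X_[a] * 'X_[fmon c]^`M(j)) G else 0
  else (c == c0)%:R.
have EE (B : Qform C n N) t (v : 'cV[C]_(ncoef n m)) : (map_mx (evalf_at B) E *m v) t 0 =
    if (enum_val t : T) is Some (a, j) then
      if mdeg a == (N - m.-1)%N then apolar ('X_[a] * (fgen (v^~ 0))^`M(j)) (B : S) else 0
    else v c0 0.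
  rewrite mxE; case tE: (enum_val t : T) => [[a j]|].
    case: ifP => aN; last first.
      by rewrite big1 // => c _; rewrite !mxE tE aN rmorph0 mul0r.
    rewrite (raddf_sum (mderiv j)) mulr_sumr apolar_suml; apply: eq_bigr => c _ /=.
    rewrite mderivZ -scalerAr apolarZl mulrC !mxE tE aN; congr (_ * _).
    apply: etrans (apolar_map _ _ _) _.
    by rewrite generic_form_eval rmorphM /= map_mpolyX mderiv_map map_mpolyX.
  rewrite (bigD1 c0) //= big1 ?addr0 => [|c cc0]; rewrite !mxE tE ?eqxx ?rmorph1 ?mul1r //.
  by rewrite (negPf cc0) rmorph0 mul0r.
have [|g gB1] := @full_rank_minor n N C _ _ E (PhiQ Q1).
  move=> v Ev; have Et t : (map_mx (evalf_at (PhiQ Q1)) E *m v) (enum_rank (t : T)) 0 = 0.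
    by rewrite Ev mxE.
  have [c qE] : exists c, fgen (v^~ 0) = c *: (Q1 : S).
    apply: irr; [exact: fgen_homog|move=> k].
    apply: (jac_of_annihilator XQ1 (Phi_annihilates n_ge2 m_ge3 XQ1) deg_le_N).
      by apply: homog_deriv; exact: fgen_homog.
    move=> a aN; have aN' : (mdeg a < N.+1)%N by rewrite aN ltnS leq_subr.
    by have := Et (Some (BMultinom aN', k)); rewrite EE enum_rankK /= aN eqxx.
  have := Et None; rewrite EE enum_rankK -[v c0 0](mcoeff_fgen (v^~ 0)) qE mcoeffZ => /eqP.
  rewrite mulf_eq0 -[_@_ _]/(coefs Q1 c0) (negPf Qc0) orbF => /eqP c0'.
  by apply/colP => c'; rewrite -[LHS](mcoeff_fgen (v^~ 0)) qE c0' scale0r mcoeff0 mxE.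
pose G0 := \det (rowsub g E).
pose ehat (L : nzRingType) : 'cV[L]_(ncoef n m) := \col_i (if (enum_val (g i) : T) is None then 1 else 0).
pose qv : 'cV[formpoly C n N]_(ncoef n m) := \adj (rowsub g E) *m ehat _.
pose qB (B : Qform C n N) : Qform C n m := mkform (fun i => evalf (qv i 0) B).
have qBE (B : Qform C n N) (Q : Qform C n m) : (Q : S) != 0 ->
    (forall a j, mdeg a = (N - m.-1)%N -> apolar ('X_[a] * (Q : S)^`M(j)) (B : S) = 0) ->
    evalf G0 B != 0 -> exists2 l, l != 0 & (qB B : S) = l *: (Q : S).
  move=> Q0 QB GB; pose M := rowsub g (map_mx (evalf_at B) E).
  pose v : 'cV[C]_(ncoef n m) := \col_i coefs Q i.
  have vQ : fgen (v^~ 0) = (Q : S).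
    rewrite [RHS](@fgen_coef n m) ?dhomog_is_dhomog //.
    by apply: eq_bigr => c _; rewrite mxE.
  have detM : \det M = evalf G0 B by rewrite /M -map_mxsub det_map_mx.
  have Mv : M *m v = v c0 0 *: ehat _.
    apply/colP => i; rewrite /M -rowsubM mxE EE !mxE vQ.
    case: (enum_val (g i) : T) => [[a j]|]; last by rewrite mulr1.
    by rewrite mulr0; case: eqP => // aN; rewrite QB.
  have Mq : M *m map_mx (evalf_at B) qv = evalf G0 B *: ehat _.
    rewrite /qv map_mxM map_mx_adj map_mxsub -/M mulmxA mul_mx_adj detM mul_scalar_mx.
    congr (_ *: _); apply/colP => i; rewrite !mxE; case: (enum_val _ : T) => *; [exact: rmorph0|exact: rmorph1].
  have uM : M \in unitmx by rewrite unitmxE detM unitfE.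
  have vq : v c0 0 *: map_mx (evalf_at B) qv = evalf G0 B *: v.
    apply: (can_inj (mulKmx uM)); rewrite -!scalemxAr Mv Mq !scalerA; congr (_ *: _).
    exact: mulrC.
  have v0 : v c0 0 != 0.
    apply: contraNneq Q0 => v0; move: vq; rewrite v0 scale0r => /esym/eqP.
    rewrite scaler_eq0 (negPf GB) /= => /eqP v00; rewrite -vQ v00.
    by rewrite /fgen big1 // => c _; rewrite mxE scale0r.
  exists (evalf G0 B / v c0 0); first by rewrite mulf_neq0 ?invr_eq0.
  apply: (@homog_eq n m); [exact: dhomog_is_dhomog|by apply: rpredZ; exact: dhomog_is_dhomog|].
  move=> i; rewrite /= mcoeff_fgen mcoeffZ; apply: (mulfI v0).
  have := congr1 (fun w : 'cV_ _ => w i 0) vq; rewrite mxE [RHS]mxE [v i 0]mxE [map_mx _ _ _ _]mxE.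
  move=> E1; apply: etrans E1 _; by rewrite mulrA [v c0 0 * _]mulrC divfK.
have jacB (Q : Qform C n m) (B : Qform C n N) : annihilates m (Q : S) (B : S) ->
    forall a j, mdeg a = (N - m.-1)%N -> apolar ('X_[a] * (Q : S)^`M(j)) (B : S) = 0.
  move=> QB a j aN; apply/QB.
    rewrite -(subnK deg_le_N) -aN; apply: dhomogM; first by rewrite dhomogX.
    by apply: homog_deriv; exact: dhomog_is_dhomog.
  by apply: gidealMl; exact: (gideal_gen (fun j => (Q : S)^`M(j))).
have [l1 l10 q1E] := qBE _ _ (nondegenerate_neq0 XQ1) (jacB _ _ (Phi_annihilates n_ge2 m_ge3 XQ1)) gB1.
have [Xq1 _] : X (qB (PhiQ Q1)) /\ f (qB (PhiQ Q1)) = f Q1.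
  by apply: (invariant_orbit XQ1 (unitmx1 _ _) l10); rewrite sub1.
have [P1 [S1 [S10 fE]]] := f_regular Xq1.
pose lift (P : formpoly C n m) : formpoly C n N := P \mPo [tuple qv i 0 | i < ncoef n m].
have liftE P B : evalf (lift P) B = evalf P (qB B).
  rewrite evalf_mkform /lift /evalf comp_mpoly_meval; apply: meval_eq => i.
  by rewrite tnth_mktuple.
move: (lift P1) (lift S1) (liftE P1) (liftE S1) => LP LS LPE LSE {lift liftE}.
have evM (P P' : formpoly C n N) B : evalf (P * P') B = evalf P B * evalf P' B by exact: mevalM.
(* The extra factors make both sides vanish where the minor or the denominator of f does, so that
   the identity holds on whole orbits. *)
exists (G0 * (LS * LS)), (G0 * (LP * LS)); split; first by rewrite !evM LSE !mulf_neq0.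
move=> Q u XQ uu; set B := subform u (PhiQ Q).
rewrite !evM LPE LSE.
have [->|GB] := eqVneq (evalf G0 B) 0; first by rewrite !mul0r mulr0.
have [->|SB] := eqVneq (evalf S1 (qB B)) 0; first by rewrite !mulr0.
have ut : (invmx u)^T \in unitmx by rewrite unitmx_tr unitmx_inv.
pose Qu := subform (invmx u)^T Q.
have QuB : annihilates m (Qu : S) (B : S) by apply: annihilates_sub => //; exact: Phi_annihilates.
have [XQu _] : X Qu /\ f Qu = f Q by apply: (invariant_orbit XQ ut (oner_neq0 _)); rewrite scale1r.
have [l l0 qE] := qBE _ _ (nondegenerate_neq0 XQu) (jacB _ _ QuB) GB.
have [XqB fq] := invariant_orbit XQ ut l0 qE.
by rewrite -fq fE //; field.
Qed.

End RationalInverse.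

(** * The orbit of the special linear group *)

Section GenericMatrix.
Variables (n : nat) (L : comNzRingType).

Definition gmx : 'M[{mpoly L[n * n]}]_n := \matrix_(i, j) 'X_(mxvec_index i j).

Definition mxeval (A : 'M[L]_n) (p : {mpoly L[n * n]}) : L := p.@[mxvec A 0].
HB.instance Definition _ A := GRing.RMorphism.copy (mxeval A) (meval (mxvec A 0)).

Lemma mxeval_gmx A : map_mx (mxeval A) gmx = A.
Proof. by apply/matrixP => i j; rewrite !mxE /mxeval mevalXU mxvecE. Qed.

Lemma mxevalC A c : mxeval A c%:MP = c. Proof. exact: mevalC. Qed.

Lemma det_gmx_eval A : mxeval A (\det gmx) = \det A.
Proof. by rewrite -det_map_mx mxeval_gmx. Qed.

Lemma det_gmx_neq0 : \det gmx != 0.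
Proof.
apply/eqP => /(congr1 (mxeval 1%:M)); rewrite det_gmx_eval det1 rmorph0 => /eqP.
by rewrite oner_eq0.
Qed.

End GenericMatrix.

Arguments gmx : clear implicits.

Section CompositionWithSubstitution.
Variables (n d : nat) (C : fieldType).

(** The polynomial B |-> s(uB). *)
Definition scomp (u : 'M[C]_n) (s : formpoly C n d) : formpoly C n d :=
  feval (@mpolyC _ C) s (sub (map_mx (@mpolyC _ C) u) (generic_form n d C)).

Lemma feval_ext (L : comNzRingType) (f g : C -> L) (s : formpoly C n d)
    (B : {mpoly L[n]}) : f =1 g ->
  feval f s B = feval g s B :> L.
Proof. by move=> fg; apply: eq_bigr => a _; rewrite fg. Qed.

Lemma feval_scomp (L : comNzRingType) (f : {rmorphism C -> L}) u s (B : {mpoly L[n]}) :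
  B \is d.-homog -> feval f (scomp u s) B = feval f s (sub (map_mx f u) B) :> L.
Proof.
move=> hB; have [e [eF eC eX]] : exists e : {rmorphism formpoly C n d -> L},
    [/\ forall t, feval f t B = e t, forall c, e c%:MP = f c & forall i, e 'X_i = B@_(fmon i)].
  exists (mmap f (fun i => B@_(fmon i))); split=> // [c|i]; first exact: mmapC.
  exact: etrans (mmapX _ _ _) (mmap1U _ _).
rewrite eF /scomp (feval_map (@mpolyC (ncoef n d) C) e); apply: etrans (_ : feval f s _ = _).
  by apply: feval_ext => c /=; exact: eC.
congr (feval f s); rewrite msub_map; congr sub; first by apply/matrixP => i j; rewrite !mxE; exact: eC.
apply: (@homog_eq n d) => //; first exact/homog_map/generic_form_homog.
by move=> i; rewrite mcoeff_map_mpoly mcoeff_fgen; exact: eX.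
Qed.

(** The function u |-> s(uB), as a polynomial in the entries of u. *)
Definition gmx_eval (L : comNzRingType) (f : C -> L) (s : formpoly C n d) (B : {mpoly L[n]}) :
    {mpoly L[n * n]} :=
  feval (fun c => (f c)%:MP) s (sub (gmx n L) (map_mpoly (@mpolyC _ L) B)).

Lemma mxeval_gmx_eval (L : comNzRingType) (f : {rmorphism C -> L}) s (B : {mpoly L[n]}) A :
  mxeval A (gmx_eval f s B) = feval f s (sub A B) :> L.
Proof.
rewrite (feval_map (@mpolyC _ L \o f) (mxeval A)) msub_map mxeval_gmx.
rewrite (feval_ext _ _ (g := f)) => [|c]; last by rewrite /= mxevalC.
congr (feval f s (sub A _)); apply/mpolyP => a.
by rewrite !mcoeff_map_mpoly /=; exact: mxevalC.
Qed.

Lemma evalf_subform s (B : Qform C n d) A :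
  evalf s (subform A B) = mxeval A (gmx_eval idfun s (B : {mpoly C[n]})).
Proof. by rewrite (mxeval_gmx_eval idfun). Qed.

End CompositionWithSubstitution.

Lemma mcoeff_sub_diag n (L : comNzRingType) (D : 'I_n -> L) (p : {mpoly L[n]}) a :
  (sub (diag_mx (\row_j D j)) p)@_a = \prod_i D i ^+ a i * p@_a.
Proof.
rewrite {1}(mpolyE p) [sub _ _]raddf_sum /=.
have subXa b : sub (diag_mx (\row_j D j)) 'X_[b] = (\prod_i D i ^+ b i) *: 'X_[b].
  rewrite [in LHS]mpolyXE_id rmorph_prod /= [in RHS]mpolyXE_id -scaler_prod.
  apply: eq_bigr => i _; rewrite rmorphXn /= subX (bigD1 i) //= !mxE eqxx mulr1n.
  rewrite big1 ?addr0 ?exprZn // => j ji; by rewrite !mxE eq_sym (negPf ji) mulr0n scale0r.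
under eq_bigr => b _ do rewrite linearZ /= subXa scalerA.
rewrite raddf_sum /=; under eq_bigr => b _ do rewrite mcoeffZ mcoeffX.
have [ap|ap] := boolP (a \in msupp p); last first.
  rewrite memN_msupp_eq0 // mulr0 big_seq big1 // => b bp; case: eqP => [ba|]; rewrite ?mulr0 //.
  by rewrite -ba bp in ap.
rewrite (bigD1_seq a) ?msupp_uniq //= eqxx mulr1 mulrC [X in _ + X]big1 ?addr0 // => b /negPf ->.
by rewrite mulr0.
Qed.

Lemma jac_sub_irreducible n m (F : fieldType) (Q : {mpoly F[n]}) (A : 'M[F]_n) : A \in unitmx ->
    (forall q, q \is m.-homog -> (forall k, gideal (fun j => Q^`M(j)) q^`M(k)) -> exists c, q = c *: Q) ->
  forall q, q \is m.-homog -> (forall k, gideal (fun j => (sub A Q)^`M(j)) q^`M(k)) ->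
    exists c, q = c *: sub A Q.
Proof.
move=> uA irr q hq Jq; have [|k|c qE] := irr (sub (invmx A) q); first exact: sub_homog.
  rewrite sub_deriv; apply: gideal_sum => i _; rewrite -mul_mpolyC; apply: gidealMl.
  by apply/(jac_sub _ _ uA); rewrite subVK.
by exists c; rewrite -(subVK q uA) qE linearZ.
Qed.

(** * Specialization of the generic orbit point along a place *)

Section PlaceContradiction.
Variables (R : realType) (n m : nat).
Hypotheses (n_ge2 : (2 <= n)%N) (m_ge3 : (3 <= m)%N) (nm : (3 < m)%N || (2 < n)%N).
Local Notation C := R[i].
Local Notation S := {mpoly C[n]}.
Local Notation N := (n * (m - 2))%N.
Variable Q1 : Qform C n m.
Hypothesis Q1E : (Q1 : S) = base_form n m C.
Local Notation B1 := (@Phi C n m m_ge3 Q1).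

Lemma base_form_nondeg : Defs.nondegenerate Q1.
Proof. by move=> z; rewrite Q1E; apply: base_form_nondegenerate; exact: ltnW. Qed.

Lemma base_extension (k : fieldType) (h : {rmorphism C -> k}) (A : 'M[k]_n) : A \in unitmx ->
  let Q2 := sub (invmx A)^T (base_form n m k) in
  [/\ char0 k, Q2 \is m.-homog, exists e, forall i, gideal (fun j => Q2^`M(j)) ('X_i ^+ e),
    annihilates m Q2 (sub A (map_mpoly h (B1 : S)))
  & forall q, q \is m.-homog -> (forall l, gideal (fun j => Q2^`M(j)) q^`M(l)) ->
      exists c, q = c *: Q2].
Proof.
move=> uA Q2; have uA' : (invmx A)^T \in unitmx by rewrite unitmx_tr unitmx_inv.
have k0 : char0 k.
  by move=> i; rewrite -(rmorph_nat h) fmorph_eq0; exact: complex_char0.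
have hQ : base_form n m k \is m.-homog by exact: base_form_homog.
have Qmap : map_mpoly h (Q1 : S) = base_form n m k by rewrite Q1E base_form_map.
have Qfin : exists e, forall i, gideal (fun j => (base_form n m k)^`M(j)) ('X_i ^+ e).
  have [e Je] := nondegenerate_fin base_form_nondeg; exists e => i.
  have := gideal_rmorph (map_mpoly h) (Je i); rewrite rmorphXn /= map_mpolyX => -[c ->].
  by exists c; apply: eq_bigr => j _; rewrite /= mderiv_map Qmap.
have ann : annihilates m (base_form n m k) (map_mpoly h (B1 : S)).
  apply: annihilates_crit => // [a j aN|].
    have -> : 'X_[a] * (base_form n m k)^`M(j) = map_mpoly h ('X_[a] * (Q1 : S)^`M(j)).
      by rewrite rmorphM /= map_mpolyX mderiv_map Qmap.
    rewrite -apolar_map (_ : apolar _ _ = 0) ?rmorph0 //.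
    apply/(Phi_annihilates n_ge2 m_ge3 base_form_nondeg).
      rewrite -[X in X.-homog](subnK (deg_le_N n_ge2 m_ge3)) -aN.
      apply: dhomogM; first by rewrite dhomogX.
      by apply: homog_deriv; exact: dhomog_is_dhomog.
    by apply: gidealMl; exact: (gideal_gen (fun j => (Q1 : S)^`M(j))).
  rewrite -Qmap -hess_map -apolar_map fmorph_eq0 Phi_hess //; last exact: base_form_nondeg.
  by rewrite pnatr_eq0 -lt0n fact_gt0.
split; [exact: k0|exact: sub_homog|exact: jac_sub_fin|exact: annihilates_sub|].
by apply: (jac_sub_irreducible uA') => q hq; exact: base_form_irreducible.
Qed.

Variables (K : fieldType) (iotaC : {rmorphism C -> K}) (u : 'M[K]_n).
Hypothesis det_u : \det u = 1.
Local Notation Bu := (sub u (map_mpoly iotaC (B1 : S))).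
Variables (V : comNzRingType) (iota : {rmorphism V -> K}) (k : fieldType) (pi : {rmorphism V -> k}).
Hypothesis iota_inj : injective iota.
Hypothesis iota_val : forall x, x != 0 -> (exists v, iota v = x) \/ (exists v, iota v = x^-1).
Hypothesis pi_unit : forall v, pi v != 0 -> exists v', v' * v = 1.
Hypothesis iota_const : forall c, exists v, iota v = iotaC c.
Hypothesis iota_Bu : forall a, exists v, iota v = Bu@_a.
Variable I : formpoly C n N -> Prop.
Hypothesis I_scomp : forall s g, I s -> g \in unitmx -> I (scomp g s).
Hypothesis I_pi : forall s v, I s -> iota v = feval iotaC s Bu -> pi v = 0.

(** With u = L D P in Smith form, D^a times the coefficient of z^a in L B1 is integral. When z^a
    lies outside the Jacobian ideal of the specialized form, that coefficient is a unit of V, so D^a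
    is integral, as [diagonal_stable] requires. *)
Lemma place_integral (g : {rmorphism C -> V}) : (forall c, iota (g c) = iotaC c) ->
  exists2 U : 'M[V]_n, u = map_mx iota U & \det U = 1.
Proof.
move=> gE; have [L [L' [P [P' [D [[LL LL'] [PP PP'] uE DD]]]]]] := valuation_smith iota_val u.
pose O x := exists v, iota v = x.
have O1 : O 1 by exists 1; rewrite rmorph1.
have OM x y : O x -> O y -> O (x * y) by move=> [v <-] [w <-]; exists (v * w); rewrite rmorphM.
have BV : map_mpoly iotaC (B1 : S) = map_mpoly iota (map_mpoly g (B1 : S)).
  by apply/mpolyP => a; rewrite !mcoeff_map_mpoly /= gE.
have /choice[t tE] := iota_Bu.
pose T : {mpoly V[n]} := fgen (fun i : 'I_(ncoef n N) => t (fmon i)).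
have TE : map_mpoly iota T = Bu.
  apply: (@homog_eq n N); [exact/homog_map/fgen_homog|exact/sub_homog/homog_map/dhomog_is_dhomog|].
  by move=> i; rewrite mcoeff_map_mpoly /= mcoeff_fgen; exact: tE.
clearbody T.
have [B2 B2def] : exists B, B = sub L (map_mpoly g (B1 : S)) by eexists.
have coefD (a : 'X_{1..n}) : \prod_(j < n) D j ^+ a j * iota B2@_a = iota (sub P' T)@_a.
  transitivity ((sub (diag_mx (\row_j D j)) (map_mpoly iota B2))@_a).
    by rewrite mcoeff_sub_diag; congr (_ * _); symmetry; exact: mcoeff_map_mpoly.
  transitivity ((map_mpoly iota (sub P' T))@_a); last exact: mcoeff_map_mpoly.
  congr (_@_a); rewrite [RHS]msub_map TE B2def msub_map -BV !sub_sub; congr sub.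
  by rewrite uE -!mulmxA -map_mxM PP map_mx1 mulmx1.
have detD : iota (\det L * \det P) * \prod_(j < n) D j = 1.
  rewrite -[RHS]det_u uE !det_mulmx !det_map_mx det_diag rmorphM mulrAC; congr (_ * _ * _).
  by apply: eq_bigr => j _; rewrite mxE.
have D0 j : (j < n)%N -> D j != 0.
  move=> jn; have : \prod_(j < n) D j != 0.
    by apply/eqP => H; move/eqP: detD; rewrite H mulr0 eq_sym oner_eq0.
  by move=> /prodf_neq0 /(_ (Ordinal jn) isT).
have uL : map_mx pi L \in unitmx.
  have := congr1 (map_mx pi) LL; rewrite map_mxM map_mx1 => /mulmx1_unit[]//.
have [k0 hQ2 Q2fin ann irr] := base_extension (pi \o g) uL.
have B2E : map_mpoly pi B2 = sub (map_mx pi L) (map_mpoly (pi \o g) (B1 : S)).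
  by rewrite B2def msub_map; congr sub; apply/mpolyP => a; rewrite !mcoeff_map_mpoly.
have DV j : (j.+1 < n)%N -> O (D j.+1 / D j).
  move=> jn; have [v ->] := DD j jn; exists v; rewrite mulfK // D0 //; exact: ltnW.
have stab := diagonal_stable m_ge3 k0 hQ2 Q2fin irr O1 OM D0 DV.
have {}stab j : (j.+1 < n)%N -> O (D j / D j.+1).
  apply: stab => a aN Ja; apply: (OM).
    have : pi B2@_a != 0.
      apply/eqP => pa; apply: Ja; apply/ann; first by rewrite dhomogX /= aN.
      by rewrite apolarX -B2E mcoeff_map_mpoly /= pa mul0rn.
    case/pi_unit=> v' vB; exists (v' * (sub P' T)@_a).
    by rewrite rmorphM -coefD mulrCA -rmorphM vB rmorph1 mulr1.
  exists ((\det L * \det P) ^+ (m - 2)); rewrite rmorphXn -exprVn; congr (_ ^+ _).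
  rewrite -[RHS]div1r; apply: (canRL (mulfK _) detD); apply/prodf_neq0 => l _; exact: D0.
have Drel i j : (i < n)%N -> (j < n)%N -> O (D i / D j).
  have up a b : (a + b < n)%N -> O (D (a + b)%N / D a) /\ O (D a / D (a + b)%N).
    elim: b => [|b IHb] abn.
      by rewrite addn0 divff ?D0 // -[a]addn0.
    rewrite addnS in abn *; have [h1 h2] := IHb (ltnW abn); split.
      rewrite -[X in O X](_ : D (a + b).+1 / D (a + b)%N * (D (a + b)%N / D a) = _).
        by apply: OM => //; exact: DV.
      by rewrite mulrA divfK // D0 // ltnW.
    rewrite -[X in O X](_ : D a / D (a + b)%N * (D (a + b)%N / D (a + b).+1) = _).
      by apply: OM => //; exact: stab.
    by rewrite mulrA divfK // D0 // ltnW.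
  move=> iN jN; have [ij|/ltnW ji] := leqP i j.
    by have := up i (j - i)%N; rewrite subnKC // => /(_ jN)[].
  by have := up j (i - j)%N; rewrite subnKC // => /(_ iN)[].
have Oexp x e : O x -> O (x ^+ e) by move=> [v <-]; exists (v ^+ e); rewrite rmorphXn.
have prodD : O (\prod_(j < n) D j).
  have e1 : \det L' * \det L = 1 by rewrite -det_mulmx LL' det1.
  have e2 : \det P' * \det P = 1 by rewrite -det_mulmx PP' det1.
  have e : iota (\det L' * \det P') * iota (\det L * \det P) = 1.
    by rewrite -rmorphM mulrACA e1 e2 mulr1 rmorph1.
  by exists (\det L' * \det P'); rewrite -[LHS]mulr1 -[X in _ * X]detD mulrA e mul1r.
(* The quotients [D i / D j] and the product of all entries are integral, hence so is [D j ^+ n]; a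
   valuation ring is integrally closed. *)
have Dint j : (j < n)%N -> O (D j).
  move=> jn; have Dn : O (D j ^+ n).
    rewrite (_ : D j ^+ n = \prod_(i < n) D i * \prod_(i < n) (D j / D i)).
      apply: (OM) => //; elim/big_ind: _ => // i _; exact: Drel.
    rewrite -big_split /= -{1}[n]card_ord -prodr_const; apply: eq_bigr => i _.
    by rewrite mulrCA divff ?mulr1 // D0.
  have [//|Oinv] := iota_val (D0 j jn).
  rewrite (_ : D j = D j ^+ n * (D j)^-1 ^+ n.-1); first by apply: OM => //; exact: Oexp.
  have n0 : (0 < n)%N by exact: ltnW.
  by rewrite -{1}(prednK n0) exprS exprVn mulfK // expf_neq0 // D0.
have /choice[dv dvE] : forall j : 'I_n, exists v, iota v = D j by move=> j; exact: Dint.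
have uE' : u = map_mx iota (L *m diag_mx (\row_j dv j) *m P).
  rewrite !map_mxM uE; congr (_ *m _ *m _); apply/matrixP => i j; rewrite !mxE.
  by rewrite rmorphMn /= dvE.
exists (L *m diag_mx (\row_j dv j) *m P) => //.
by apply: iota_inj; rewrite -det_map_mx -uE' det_u rmorph1.
Qed.

(** The specialized matrix A has entries in k, not in C. As I is stable under GL_n(C), [s0] vanishes
    after every further substitution with entries in C; these are dense among matrices over k, so
    the inverse of A may be substituted too. *)
Lemma place_contradiction s0 : I s0 -> evalf s0 B1 = 0.
Proof.
have /choice[g gE] := iota_const.
have g_add : zmod_morphism g by move=> x y; apply: iota_inj; rewrite rmorphB !gE rmorphB.
have g_mul : monoid_morphism g.
  by split=> [|x y]; apply: iota_inj; rewrite ?rmorphM !gE ?rmorph1 ?rmorphM.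
pose gA := GRing.isZmodMorphism.Build C V g g_add.
pose gM := GRing.isMonoidMorphism.Build C V g g_mul.
pose G : {rmorphism C -> V} := HB.pack g gA gM.
have [U uE detU] := place_integral (g := G) gE.
pose h : {rmorphism C -> k} := pi \o G; pose A := map_mx pi U.
have uA : A \in unitmx by rewrite unitmxE det_map_mx detU rmorph1 unitr1.
pose Bk := map_mpoly h (B1 : S).
have hBk : Bk \is N.-homog by exact/homog_map/dhomog_is_dhomog.
have vanish s : I s -> feval h s (sub A Bk) = 0.
  move=> Is; pose v := feval G s (sub U (map_mpoly G (B1 : S))).
  have piv : pi v = feval h s (sub A Bk).
    rewrite /v feval_map msub_map; congr (feval _ _ (sub _ _)).
    by apply/mpolyP => a; rewrite !mcoeff_map_mpoly.
  rewrite -piv; apply: (I_pi Is); rewrite /v feval_map; apply: etrans (_ : feval iotaC s _ = _).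
    by apply: feval_ext => c; rewrite /= gE.
  rewrite msub_map -uE; congr (feval _ _ (sub _ _)).
  by apply/mpolyP => a; rewrite !mcoeff_map_mpoly /= gE.
move=> Is0; have [k0 _ _ _ _] := base_extension h uA.
pose P := gmx_eval h s0 (sub A Bk).
have P0 : P = 0.
  apply/eqP; apply: contraT => Pn0.
  have [|v] := @mpoly_nat_nonzero (n * n) k (P * \det (gmx n k)) k0.
    by rewrite mulf_neq0 // det_gmx_neq0.
  pose M : 'M[C]_n := vec_mx (\row_i (v i)%:R).
  have -> : (P * \det (gmx n k)).@[fun i => (v i)%:R] = mxeval (map_mx h M) (P * \det (gmx n k)).
    apply: meval_eq => i; rewrite -map_mxvec vec_mxK !mxE; symmetry; exact: rmorph_nat.
  rewrite rmorphM /= det_gmx_eval mulf_eq0 negb_or => /andP[+ detM].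
  rewrite mxeval_gmx_eval -feval_scomp ?vanish ?eqxx //; last exact: sub_homog.
  by apply: I_scomp => //; rewrite unitmxE unitfE -(fmorph_eq0 h) -det_map_mx.
have /eqP : mxeval (invmx A) P = 0 by rewrite P0 rmorph0.
rewrite mxeval_gmx_eval subK // => E.
apply/eqP; rewrite -(fmorph_eq0 h) fevalE (feval_map idfun h).
by rewrite (feval_ext _ _ (g := h)).
Qed.

End PlaceContradiction.

Section FractionEvaluation.
Variables (n : nat) (C : fieldType).
Local Notation W := {mpoly C[n * n]}.
Local Notation "x %:F" := (tofrac x).
Local Notation K := {fraction W}.
Variable A : 'M[C]_n.

(** Evaluation at A is partial on the fraction field; a relation avoids choosing a
    representative. *)
Definition fraceval (x : K) (c : C) : Prop :=
  exists p q : W, [/\ x = p%:F / q%:F, mxeval A q != 0 & c = mxeval A p / mxeval A q].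

Lemma fraceval_poly p : fraceval p%:F (mxeval A p).
Proof. by exists p, 1; rewrite !rmorph1 !divr1 oner_eq0. Qed.

Let denom_neq0 q : mxeval A q != 0 -> q%:F != 0.
Proof. by rewrite tofrac_eq0; apply: contraNneq => ->; rewrite rmorph0. Qed.

Lemma fraceval_uniq x c c' : fraceval x c -> fraceval x c' -> c = c'.
Proof.
move=> [p [q [-> qA ->]]] [p' [q' [E qA' ->]]]; apply/eqP; rewrite eqr_div //; apply/eqP.
move/eqP: E; rewrite eqr_div ?denom_neq0 // -!tofracM tofrac_eq => /eqP.
by move/(congr1 (mxeval A)); rewrite !rmorphM.
Qed.

Lemma fracevalD x y c d : fraceval x c -> fraceval y d -> fraceval (x + y) (c + d).
Proof.
move=> [p [q [-> qA ->]]] [p' [q' [-> qA' ->]]]; exists (p * q' + p' * q), (q * q').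
rewrite !rmorphD !rmorphM mulf_neq0 //; split=> //; first by rewrite addf_div ?denom_neq0.
by rewrite addf_div.
Qed.

Lemma fracevalM x y c d : fraceval x c -> fraceval y d -> fraceval (x * y) (c * d).
Proof.
move=> [p [q [-> qA ->]]] [p' [q' [-> qA' ->]]]; exists (p * p'), (q * q').
by rewrite !rmorphM mulf_neq0 //; split=> //; rewrite mulf_div.
Qed.

Lemma fraceval_sum (I : Type) (r : seq I) (P : pred I) (F : I -> K) (G : I -> C) :
  (forall i, P i -> fraceval (F i) (G i)) ->
  fraceval (\sum_(i <- r | P i) F i) (\sum_(i <- r | P i) G i).
Proof.
move=> h; elim/big_rec2: _ => [|i y x Pi]; last by apply: fracevalD; exact: h.
by rewrite -(rmorph0 (mxeval A)) -tofrac0; exact: fraceval_poly.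
Qed.

Definition constfrac : C -> K := @tofrac W \o @mpolyC (n * n) C.
HB.instance Definition _ := GRing.RMorphism.on constfrac.

Lemma fraceval_const c : fraceval (constfrac c) c.
Proof. by have := fraceval_poly c%:MP; rewrite mxevalC. Qed.

Lemma fraceval_rmorph (phi : {rmorphism {mpoly C[n]} -> {mpoly K[n]}})
    (psi : {rmorphism {mpoly C[n]} -> {mpoly C[n]}}) :
    (forall c a, fraceval (phi c%:MP)@_a (psi c%:MP)@_a) ->
    (forall i a, fraceval (phi 'X_i)@_a (psi 'X_i)@_a) ->
  forall p a, fraceval (phi p)@_a (psi p)@_a.
Proof.
move=> hC hX; elim/mpoly_ring_ind => [c|i|p q IHp IHq a|p q IHp IHq a] //.
  by rewrite (rmorphD phi) (rmorphD psi) !mcoeffD; exact: fracevalD.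
rewrite (rmorphM phi) (rmorphM psi) !mcoeffM; apply: fraceval_sum => k _; exact: fracevalM.
Qed.

Lemma fraceval_sub (u : 'M[K]_n) (p : {mpoly C[n]}) : (forall i j, fraceval (u i j) (A i j)) ->
  forall a, fraceval (sub u (map_mpoly constfrac p))@_a (sub A p)@_a.
Proof.
move=> uA; apply: (fraceval_rmorph (phi := sub u \o map_mpoly constfrac) (psi := sub A)) => [c a|i a] /=.
  rewrite map_mpolyC !subC !mcoeffC; apply: fracevalM; first exact: fraceval_const.
  by case: (a == 0%MM) => /=; rewrite ?mulr1n ?mulr0n -?(rmorph1 constfrac) -?(rmorph0 constfrac);
    exact: fraceval_const.
rewrite map_mpolyX !subX !raddf_sum; apply: fraceval_sum => j _ /=; rewrite !mcoeffZ !mcoeffX.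
apply: fracevalM => //; case: eqP => _ /=; rewrite ?mulr1n ?mulr0n.
  by rewrite -(rmorph1 constfrac); exact: fraceval_const.
by rewrite -(rmorph0 constfrac); exact: fraceval_const.
Qed.

Lemma fraceval_feval d (s : formpoly C n d) (B : {mpoly K[n]}) (b : {mpoly C[n]}) :
  (forall a, fraceval B@_a b@_a) -> fraceval (feval constfrac s B) (feval idfun s b).
Proof.
move=> Bb; elim/mpoly_ring_ind: s => [c|i|p q IHp IHq|p q IHp IHq].
- by rewrite /feval !mmapC; exact: fraceval_const.
- by rewrite /feval !mmapX !mmap1U; exact: Bb.
- by rewrite /feval !rmorphD; exact: fracevalD.
- by rewrite /feval !rmorphM; exact: fracevalM.
Qed.

End FractionEvaluation.

Section UnitOnSL.
Local Notation "x %:F" := (tofrac x).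
Variables (R : realType) (n m : nat).
Hypotheses (n_ge2 : (2 <= n)%N) (m_ge3 : (3 <= m)%N) (nm : (3 < m)%N || (2 < n)%N).
Local Notation C := R[i].
Local Notation N := (n * (m - 2))%N.
Variable Q1 : Qform C n m.
Hypothesis Q1E : (Q1 : {mpoly C[n]}) = base_form n m C.
Local Notation B1 := (@Phi C n m m_ge3 Q1).
Variable I : formpoly C n N -> Prop.
Hypothesis I0 : I 0.
Hypothesis ID : forall s t, I s -> I t -> I (s + t).
Hypothesis IM : forall s t, I t -> I (s * t).
Hypothesis I_scomp : forall s g, I s -> g \in unitmx -> I (scomp g s).
Variable s0 : formpoly C n N.
Hypotheses (Is0 : I s0) (s0B1 : evalf s0 B1 != 0).

(* If no member of [I] restricts to [1] on the orbit of the special linear group, then there is a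
   place of the function field of [SL_n] that is finite on the coordinates of the orbit and
   kills [I]; this contradicts the stability of [B1]. *)
Lemma unit_on_SL : exists2 s, I s & forall A : 'M[C]_n, \det A = 1 -> evalf s (subform A B1) = 1.
Proof.
pose W := {mpoly C[n * n]}; pose K := {fraction W}; pose w := gmx n C.
pose r0 : 'I_n := Ordinal (ltnW n_ge2).
pose cf : {rmorphism C -> K} := @constfrac n C.
(* The generic matrix with one row divided by its determinant: a generic point of SL_n, which
   specializes to A whenever A has determinant 1. *)
pose u : 'M[K]_n := \matrix_(i, j) (if i == r0 then (w i j)%:F / (\det w)%:F else (w i j)%:F).
have dw0 : (\det w)%:F != 0 :> K by rewrite tofrac_eq0 det_gmx_neq0.
have det_u : \det u = 1.
  have -> : u = diag_mx (\row_j (if j == r0 then (\det w)%:F^-1 else 1)) *m map_mx (@tofrac W) w.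
    apply/matrixP => i j; rewrite mxE mul_diag_mx !mxE; case: eqP => _; last by rewrite mul1r.
    by rewrite mulrC.
  rewrite det_mulmx det_diag det_map_mx (bigD1 r0) //= mxE eqxx big1 ?mulr1 ?mulVf // => i ir.
  by rewrite mxE (negPf ir).
pose Bu := sub u (map_mpoly cf (B1 : {mpoly C[n]})).
pose ev (s : formpoly C n N) : K := feval cf s Bu.
have evD s t : ev (s + t) = ev s + ev t by exact: rmorphD.
have evB s t : ev (s - t) = ev s - ev t by exact: rmorphB.
have evM s t : ev (s * t) = ev s * ev t by exact: rmorphM.
have ev1 : ev 1 = 1 by exact: rmorph1.
have ev0 : ev 0 = 0 by exact: rmorph0.
have evC c : ev c%:MP = cf c by exact: mmapC.
have evX i : ev 'X_i = Bu@_(fmon i) by rewrite /ev /feval mmapX mmap1U.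
(* The algebra generated by the coordinates of the generic orbit point, and the image of I in it. *)
pose A0 x := exists s, x = ev s; pose M0 x := exists2 s, I s & x = ev s.
have [[s Is s1]|nM1] := pselect (M0 1).
  exists s => // A detA; apply: (@fraceval_uniq n C A 1); last first.
    by rewrite -(rmorph1 (@constfrac n C)); exact: fraceval_const.
  rewrite s1 /ev fevalE; apply: fraceval_feval => a; apply: fraceval_sub => i j.
  have wE k : fraceval A (w k j)%:F (A k j).
    by have := fraceval_poly A (w k j); rewrite /w mxE /mxeval mevalXU mxvecE.
  rewrite mxE; case: eqP => [->|_]; last exact: wE.
  exists (w r0 j), (\det w); split=> //; rewrite det_gmx_eval detA ?oner_eq0 //.
  by rewrite /w mxE /mxeval mevalXU mxvecE divr1.
have pair : ring_ideal_pair A0 M0.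
  split; [by exists 1; rewrite ev1| | | |split].
  - by move=> _ _ [s ->] [t ->]; exists (s - t); rewrite evB.
  - by move=> _ _ [s ->] [t ->]; exists (s * t); rewrite evM.
  - by move=> _ [s _ ->]; exists s.
  - by exists 0; rewrite ?ev0.
  - by move=> _ _ [s Is ->] [t It ->]; exists (s + t); [exact: ID|rewrite evD].
  - by move=> _ _ [s ->] [t It ->]; exists (s * t); [exact: IM|rewrite evM].
  - exact: nM1.
have [V [iota [k [pi [iota_inj AV MV iota_val pi_unit]]]]] := place_exists pair.
have BuV a : exists v, iota v = Bu@_a.
  have [/fmon_surj[i <-]|aN] := eqVneq (mdeg a) N; first by apply: AV; exists 'X_i; rewrite evX.
  exists 0; rewrite rmorph0 (dhomog_nemf_coeff _ aN) //.
  exact/sub_homog/homog_map/dhomog_is_dhomog.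
case/eqP: s0B1; apply: (place_contradiction n_ge2 nm Q1E det_u iota_inj iota_val pi_unit _ BuV I_scomp _ Is0).
- by move=> c; apply: AV; exists c%:MP; rewrite evC.
- by move=> s v Is vE; apply: MV; exists s.
Qed.

End UnitOnSL.

(** * The Reynolds operator *)

Lemma pihomog_sub n (K : comNzRingType) (M : 'M[K]_n) k (p : {mpoly K[n]}) :
  pihomog mdeg k (sub M p) = sub M (pihomog mdeg k p).
Proof.
rewrite {1}(mpolyE p) [sub _ _]raddf_sum raddf_sum [in RHS](mpolyE p) [pihomog _ _ _ in RHS]raddf_sum.
rewrite [RHS]raddf_sum; apply: eq_bigr => a _ /=.
rewrite [sub _ _]linearZ [LHS]linearZ /= [pihomog _ _ (_ *: _)]linearZ [RHS]linearZ /=.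
have hX : sub M 'X_[a] \is (mdeg a).-homog by apply: sub_homog; rewrite dhomogX.
have h0 : ('X_[a] : {mpoly K[n]}) \is (mdeg a).-homog by rewrite dhomogX.
have [<-|ka] := eqVneq (mdeg a) k; first by rewrite !pihomog_dE.
have z (q : {mpoly K[n]}) : q \is (mdeg a).-homog -> pihomog mdeg k q = 0.
  move=> hq; apply/mpolyP => b; rewrite mcoeff_pihomog mcoeff0; case: eqP => // bk.
  by rewrite (dhomog_nemf_coeff hq) //= bk eq_sym.
by rewrite (z _ hX) (z _ h0) rmorph0.
Qed.

Lemma sub_congr n (K : comNzRingType) (M M' : 'M[K]_n) (p p' : {mpoly K[n]}) :
  M = M' -> p = p' -> sub M p = sub M' p'.
Proof. by move=> -> ->. Qed.

Section Reynolds.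
Variables (R : realType) (n m : nat).
Hypotheses (n_ge2 : (2 <= n)%N) (m_ge3 : (3 <= m)%N).
Local Notation C := R[i].
Local Notation N := (n * (m - 2))%N.
Local Notation W := {mpoly C[n * n]}.
Local Notation dt := (\det (gmx n C)).
Local Notation F_ s B := (gmx_eval idfun s (B : {mpoly C[n]})).
Implicit Types (s t : formpoly C n N) (B : Qform C n N) (A M : 'M[C]_n).

Lemma mxeval_inj (p q : W) : (forall A, mxeval A p = mxeval A q) -> p = q.
Proof.
move=> pq; apply: (mpoly_eval_inj (@complex_char0 R)) => v.
have := pq (vec_mx (\row_i v i)); rewrite /mxeval vec_mxK.
have E (r : W) : r.@[(\row_i v i) 0] = r.@[v] by apply: meval_eq => i; rewrite mxE.
by rewrite !E.
Qed.

Lemma mxeval_unit_inj (p q : W) : (forall A, A \in unitmx -> mxeval A p = mxeval A q) -> p = q.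
Proof.
move=> pq; apply: (mulfI (det_gmx_neq0 n C)); apply: mxeval_inj => A; rewrite !rmorphM /=.
have [uA|nA] := boolP (A \in unitmx); first by rewrite pq.
by move: nA; rewrite unitmxE unitfE negbK -det_gmx_eval => /eqP ->; rewrite !mul0r.
Qed.

(** Left translation of functions of a matrix, written as a linear substitution so that [apolar_sub]
    gives its adjoint. *)
Definition leftsub M : W -> W := sub (lin_mulmx M)^T.
HB.instance Definition _ M := GRing.RMorphism.on (leftsub M).

Lemma mxeval_leftsub M A p : mxeval A (leftsub M p) = mxeval (M *m A) p.
Proof.
rewrite /mxeval /leftsub sub_meval; apply: meval_eq => i.
have <- : mxvec A *m lin_mulmx M = mxvec (M *m A) by rewrite mul_vec_lin.
by rewrite mxE; apply: eq_bigr => j _; rewrite mxE mulrC.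
Qed.

Lemma lin_mulmxE M (i j k l : 'I_n) :
  lin_mulmx M (mxvec_index i j) (mxvec_index k l) = M k i *+ (l == j) :> C.
Proof.
have := congr1 (fun r : 'rV_(n * n) => r 0 (mxvec_index k l)) (mul_vec_lin (mulmx M) (delta_mx i j)).
rewrite /= mxvec_delta -rowE mxE mxvecE => ->.
rewrite mxE (bigD1 i) //= mxE eqxx /= big1 ?addr0 => [|p pi]; first by rewrite mulr_natr.
by rewrite mxE (negPf pi) mulr0.
Qed.

Lemma lin_mulmx_tr M : (lin_mulmx M)^T = lin_mulmx M^T :> 'M[C]_(n * n).
Proof.
apply/matrixP => x y; case/mxvec_indexP: x => i j; case/mxvec_indexP: y => k l.
by rewrite mxE !lin_mulmxE mxE eq_sym.
Qed.

Lemma leftsub_det M e : leftsub M (dt ^+ e) = (\det M) ^+ e *: dt ^+ e.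
Proof.
apply: mxeval_inj => A; rewrite mxeval_leftsub [RHS]mevalZ -/(mxeval A _).
by rewrite !rmorphXn /= !det_gmx_eval det_mulmx exprMn.
Qed.

Lemma apolar_leftsub M p q : apolar p (leftsub M q) = apolar (leftsub M^T p) q.
Proof. by rewrite /leftsub -apolar_sub trmxK -lin_mulmx_tr trmxK. Qed.

Lemma gmx_eval_subform s B M : F_ s (subform M B) = leftsub M (F_ s B).
Proof.
apply: mxeval_inj => A; rewrite mxeval_leftsub -!evalf_subform; congr evalf.
by apply: val_inj; rewrite /= sub_sub.
Qed.

Lemma gmx_eval_map (L L' : comNzRingType) (f : {rmorphism C -> L}) (g : {rmorphism L -> L'}) s
    (b : {mpoly L[n]}) :
  map_mpoly g (gmx_eval f s b) = gmx_eval (g \o f) s (map_mpoly g b).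
Proof.
rewrite /gmx_eval (feval_map (@mpolyC (n * n) L \o f) (map_mpoly g)).
apply: etrans (_ : feval (fun c => (g (f c))%:MP) s _ = _).
  apply: feval_ext => c /=; apply/mpolyP => a.
  by rewrite mcoeff_map_mpoly /= !mcoeffC rmorphM rmorph_nat.
have -> // : map_mpoly (map_mpoly g) (sub (gmx n L) (map_mpoly (@mpolyC (n * n) L) b)) =
    sub (gmx n L') (map_mpoly (@mpolyC (n * n) L') (map_mpoly g b)).
have e1 : map_mx (map_mpoly g) (gmx n L) = gmx n L'.
  by apply/matrixP => i j; rewrite !mxE; exact: map_mpolyX.
have e2 : map_mpoly (map_mpoly g) (map_mpoly (@mpolyC (n * n) L) b) =
    map_mpoly (@mpolyC (n * n) L') (map_mpoly g b).
  have e3 (c : L) : map_mpoly g (@mpolyC (n * n) L c) = @mpolyC (n * n) L' (g c).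
    by apply/mpolyP => a; rewrite mcoeff_map_mpoly /= !mcoeffC rmorphM rmorph_nat.
  apply/mpolyP => a; apply: etrans (mcoeff_map_mpoly _ _ _) _.
  apply: etrans (congr1 (map_mpoly g) (mcoeff_map_mpoly _ _ _)) _.
  apply: etrans _ (esym (mcoeff_map_mpoly _ _ _)); apply: etrans (e3 _) _.
  by apply: congr1; symmetry; exact: mcoeff_map_mpoly.
apply: etrans (msub_map (map_mpoly g) _ _) _.
exact: sub_congr e1 e2.
Qed.

(** For the generic form, u |-> s(uB) has coefficients that are polynomials in B; the functional is
    applied to the monomials in u. *)
Lemma linear_functional_form (lam : {linear W -> C | *%R}) s :
  exists T, forall B, evalf T B = lam (F_ s B).
Proof.
pose G := gmx_eval (@mpolyC (ncoef n N) C) s (generic_form n N C).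
exists (\sum_(a <- msupp G) lam 'X_[a] *: G@_a) => B.
have -> : F_ s B = map_mpoly (evalf_at B) G.
  rewrite gmx_eval_map generic_form_eval /gmx_eval; apply: feval_ext => c /=.
  by congr (_%:MP); symmetry; exact: mevalC.
rewrite [in RHS](mpolyE G) !rmorph_sum raddf_sum [LHS]raddf_sum; apply: eq_bigr => a _ /=.
rewrite map_mpolyZ map_mpolyX (linearZ_LR lam) mulrC; exact: mevalZ.
Qed.

(** Cayley's Omega process as a pairing. The power of the determinant brings the component of degree
    Nj to the degree nD of [dt ^+ D]. *)
Definition weighted D j (F : W) : C := apolar (dt ^+ D) (pihomog mdeg (N * j) F * dt ^+ (D - (m - 2) * j)).

Lemma weighted_linear D j : linear_for *%R (weighted D j).
Proof.
move=> a p q; rewrite /weighted [pihomog _ _ _]linearP mulrDl -scalerAl.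
by rewrite [LHS]linearP.
Qed.

(** Moved across the pairing, the translation multiplies [dt ^+ D] by the D-th power of [\det M];
    the power of [dt] in the other argument takes back all but (m - 2)j factors. *)
Lemma weighted_leftsub D j M F : M \in unitmx -> ((m - 2) * j <= D)%N ->
  weighted D j (leftsub M F) = (\det M) ^+ ((m - 2) * j) * weighted D j F.
Proof.
move=> uM jD; have dM : \det M != 0 by rewrite -unitfE -unitmxE.
have pl : pihomog mdeg (N * j) (leftsub M F) = leftsub M (pihomog mdeg (N * j) F).
  exact: pihomog_sub.
have -> : weighted D j (leftsub M F) =
    apolar (dt ^+ D) (leftsub M (pihomog mdeg (N * j) F) * dt ^+ (D - (m - 2) * j)) by rewrite -pl.
rewrite /weighted; move: (pihomog mdeg (N * j) F) => G {pl}.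
apply: (mulfI (expf_neq0 (D - (m - 2) * j) dM)).
transitivity (\det M ^+ D * apolar (dt ^+ D) (G * dt ^+ (D - (m - 2) * j))); last first.
  by rewrite [RHS]mulrA -[in RHS]exprD subnK.
move: (D - (m - 2) * j)%N => e.
transitivity (apolar (dt ^+ D) (leftsub M (G * dt ^+ e))).
  by rewrite (rmorphM (leftsub M)) /= leftsub_det -scalerAr (linearZ_LR (apolar _)).
by rewrite apolar_leftsub leftsub_det det_tr apolarZl.
Qed.

Lemma weighted_invariant D j s T : ((m - 2) * j <= D)%N ->
  (forall B, evalf T B = weighted D j (F_ s B)) -> relative_invariant ((m - 2) * j) T.
Proof.
move=> jD TE B A uA; rewrite act_sub !TE gmx_eval_subform weighted_leftsub ?unitmx_inv //.
by rewrite mulrA -exprMn det_inv mulfV ?expr1n ?mul1r // -unitfE -unitmxE.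
Qed.

Lemma apolar_int_pos k (p : {mpoly int[k]}) : p != 0 -> 0 < apolar p p.
Proof.
move=> p0; rewrite /apolar /lfunc; have [a ap] : exists a, a \in msupp p.
  have : msupp p != [::] by rewrite msupp_eq0.
  by case: (msupp p : seq _) => [|a l] // _; exists a; rewrite inE eqxx.
have term b : 0 <= p@_b * (p@_b *+ mfact b).
  by rewrite mulrnAr mulrn_wge0 // -expr2 sqr_ge0.
rewrite (bigD1_seq a) ?msupp_uniq //= ltr_pwDl ?sumr_ge0 //.
rewrite mulrnAr pmulrn_lgt0; first by rewrite -expr2 exprn_even_gt0 //= -mcoeff_msupp.
by rewrite /mfact; elim/big_ind: _ => // [x y|i _]; [rewrite muln_gt0 => -> | exact: fact_gt0].
Qed.

(** The determinant has integer coefficients, and over the integers the pairing of a polynomial with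
    itself is a sum of positive multiples of squares. *)
Lemma apolar_det_neq0 D : apolar (dt ^+ D) (dt ^+ D) != 0.
Proof.
pose ri : {rmorphism int -> C} := intmul 1.
have E : dt = map_mpoly ri (\det (gmx n int)).
  rewrite -det_map_mx; congr (\det _); apply/matrixP => i j; rewrite !mxE; symmetry.
  exact: map_mpolyX.
rewrite E -rmorphXn -apolar_map intr_eq0 gt_eqF // apolar_int_pos // expf_neq0 //.
exact: det_gmx_neq0.
Qed.

Lemma mxeval_scale k (p : W) c A : p \is k.-homog -> mxeval (c *: A) p = c ^+ k * mxeval A p.
Proof.
move=> hp; have -> : c ^+ k * mxeval A p = mxeval A (sub c%:M p).
  by rewrite (sub_scalar _ hp); symmetry; exact: mevalZ.
rewrite /mxeval sub_meval; apply: meval_eq => i.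
rewrite linearZ mxE (bigD1 i) //= mxE eqxx mulr1n big1 ?addr0 // => j ji.
by rewrite mxE eq_sym (negPf ji) mul0r.
Qed.

(** A monomial of degree j in the coefficients of the form contributes degree Nj in the entries of
    the matrix. *)
Lemma gmx_eval_graded s B : F_ s B = \sum_(j < msize s) pihomog mdeg (N * j) (F_ s B).
Proof.
have N0 : (0 < N)%N by rewrite muln_gt0 (ltnW n_ge2) subn_gt0.
pose coefhom d (q : {mpoly W[n]}) := forall a, q@_a \is d.-homog.
have homM d e p q : coefhom d p -> coefhom e q -> coefhom (d + e)%N (p * q).
  by move=> hp hq a; rewrite mcoeffM; apply: rpred_sum => k _; exact: dhomogM.
have homX d (q : {mpoly W[n]}) k : coefhom d q -> coefhom (d * k)%N (q ^+ k).
  move=> hq; elim: k => [|k IHk]; last by rewrite exprS mulnS; exact: homM.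
  by rewrite muln0 expr0 => a; rewrite mcoeff1; case: (a == 0%MM); [exact: dhomog1|exact: dhomog0].
pose b := sub (gmx n C) (map_mpoly (@mpolyC (n * n) C) (B : {mpoly C[n]})).
have hb : coefhom N b.
  move=> a; rewrite /b {1}(mpolyE (B : {mpoly C[n]})) [map_mpoly _ _]raddf_sum [sub _ _]raddf_sum raddf_sum big_seq.
  apply: rpred_sum => c /(dhomogP _ _ _ (dhomog_is_dhomog B)) /= cN.
  rewrite map_mpolyZ map_mpolyX -mul_mpolyC rmorphM /= subC mcoeffCM mul_mpolyC; apply: rpredZ.
  suff : coefhom (mdeg c) (sub (gmx n C) 'X_[c]) by rewrite cN => h; exact: h.
  rewrite mpolyXE_id rmorph_prod mdegE; elim/big_rec2: _ => [|i d q _ hd].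
    by move=> a'; rewrite mcoeff1; case: (a' == 0%MM); [exact: dhomog1|exact: dhomog0].
  apply: homM => //; rewrite rmorphXn /= -[X in coefhom X _]mul1n; apply: homX => a'.
  rewrite subX raddf_sum; apply: rpred_sum => j _ /=; rewrite mcoeffZ mcoeffX mulr_natr.
  by apply: rpredMn; rewrite mxE dhomogX /= mdeg1.
rewrite [LHS](_ : _ = \sum_(a <- msupp s) (s@_a)%:MP * mmap1 (fun i => b@_(fmon i)) a) //.
have hm a : (s@_a)%:MP * mmap1 (fun i => b@_(fmon i)) a \is (N * mdeg a)%N.-homog.
  by rewrite mul_mpolyC; apply: rpredZ; apply: mmap_homog => i; exact: hb.
rewrite [in RHS](_ : F_ s B = \sum_(a <- msupp s) (s@_a)%:MP * mmap1 (fun i => b@_(fmon i)) a) //.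
under [RHS]eq_bigr => j _ do rewrite raddf_sum.
rewrite exchange_big; apply: eq_big_seq => a /msize_mdeg_lt ad /=.
rewrite (bigD1 (Ordinal ad)) //= pihomog_dE // big1 ?addr0 // => j ja.
apply/mpolyP => c; rewrite mcoeff_pihomog mcoeff0; case: eqP => // cN.
rewrite (dhomog_nemf_coeff (hm a)) //= cN eqn_pmul2l //.
Qed.

Variable f : Qform C n m -> C.
Hypothesis f_invariant : GL_invariant f.
Hypothesis nm : (3 < m)%N || (2 < n)%N.
Hypothesis f_regular : regular_function f.
Local Notation X := (@Defs.nondegenerate C n m).
Local Notation PhiQ Q := (@Phi C n m m_ge3 Q).

(** Write A = tA' with t^n = det A and det A' = 1. The component of degree Nj at A is (det
    A)^((m-2)j) times its value at A', so the components completed to degree nD add up to [dt ^+ D],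
    which pairs nontrivially with itself. *)
Lemma sl_sum_weighted s B : (forall A, \det A = 1 -> evalf s (subform A B) = 1) ->
  exists D j, ((m - 2) * j <= D)%N /\ weighted D j (F_ s B) != 0.
Proof.
move=> s1; pose J := msize s; pose D := ((m - 2) * J)%N; exists D.
have jD (j : 'I_J) : ((m - 2) * j <= D)%N by rewrite leq_mul2l ltnW ?orbT.
apply: contrapT => /forallNP H; case/eqP: (apolar_det_neq0 D).
have W0 (j : 'I_J) : weighted D j (F_ s B) = 0.
  by apply/eqP; have /not_andP[/(_ (jD j))//|/negP] := H j; rewrite negbK.
have -> : apolar (dt ^+ D) (dt ^+ D) = \sum_(j < J) weighted D j (F_ s B); last first.
  by rewrite big1.
rewrite /weighted -raddf_sum; congr apolar; symmetry; apply: mxeval_unit_inj => A uA.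
have dA : \det A != 0 by rewrite -unitfE -unitmxE.
pose t := (n.-root (\det A))%R; have n0 : (0 < n)%N by exact: ltnW.
have tn : t ^+ n = \det A by exact: rootCK.
have t0 : t != 0 by apply: contraNneq dA => t0; rewrite -tn t0 expr0n eqn0Ngt n0.
pose A' := t^-1 *: A; have AE : A = t *: A' by rewrite scalerA mulfV ?scale1r.
have detA' : \det A' = 1 by rewrite detZ exprVn tn mulVf.
rewrite rmorphXn /= det_gmx_eval rmorph_sum /=.
transitivity (\sum_(j < J) \det A ^+ D * mxeval A' (pihomog mdeg (N * j) (F_ s B))).
  apply: eq_bigr => j _; rewrite rmorphM rmorphXn /= det_gmx_eval.
  rewrite {1}AE (mxeval_scale _ _ (pihomogP _ _ _)) -mulnA exprM tn mulrAC -exprD subnKC //.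
rewrite -mulr_sumr -[RHS]mulr1 -(s1 A' detA') evalf_subform [in RHS]gmx_eval_graded.
by rewrite rmorph_sum.
Qed.

(** The same functional is applied to u |-> s(uB) and u |-> p(uB); at B = Phi(Q) the second function
    is f(Q) times the first, and linearity keeps this factor. *)
Lemma invariant_quotient : exists Q1 l P S, [/\ X Q1, relative_invariant l P, relative_invariant l S,
  evalf S (PhiQ Q1) != 0 & forall Q, X Q -> evalf P (PhiQ Q) = f Q * evalf S (PhiQ Q)].
Proof.
pose Q1 : Qform C n m := DHomog (base_form_homog n m C).
have Q1E : (Q1 : {mpoly C[n]}) = base_form n m C by [].
have XQ1 : X Q1 by exact: base_form_nondeg.
pose rel p s := forall Q u, X Q -> u \in unitmx ->
  evalf p (subform u (PhiQ Q)) = f Q * evalf s (subform u (PhiQ Q)).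
have [s0 [p0 [s0B1 rel0]]] : exists s p, evalf s (PhiQ Q1) != 0 /\ rel p s.
  apply: rational_inverse => // q hq Jq.
  by apply: base_form_irreducible (@complex_char0 R) _ _ nm hq Jq.
have evD (s t : formpoly C n N) B : evalf (s + t) B = evalf s B + evalf t B by exact: mevalD.
have evM (s t : formpoly C n N) B : evalf (s * t) B = evalf s B * evalf t B by exact: mevalM.
have ev0 B : evalf (0 : formpoly C n N) B = 0 by exact: meval0.
have evS g s B : evalf (scomp g s) B = evalf s (subform g B).
  have h := feval_scomp (idfun : {rmorphism C -> C}) g s (dhomog_is_dhomog B).
  by apply: etrans h _; rewrite map_mx_id.
have [||||s [p ps] s1] := @unit_on_SL R n m n_ge2 m_ge3 nm Q1 Q1E (fun s => exists p, rel p s) _ _ _ _ s0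
  (ex_intro _ p0 rel0) s0B1.
- by exists 0 => Q u _ _; rewrite !ev0 mulr0.
- move=> s t [p ps] [q qt]; exists (p + q) => Q u XQ uu.
  by rewrite !evD ps // qt // mulrDr.
- move=> s t [q qt]; exists (s * q) => Q u XQ uu; by rewrite !evM qt // mulrCA.
- move=> s g [p ps] ug; exists (scomp g p) => Q u XQ uu.
  have E (B : Qform C n N) : subform g (subform u B) = subform (u *m g) B.
    by apply: val_inj; rewrite /= sub_sub.
  have uug : u *m g \in unitmx by rewrite unitmx_mul uu.
  have h := ps Q (u *m g) XQ uug; rewrite -E in h.
  apply: etrans (evS g p _) _; apply: etrans h _.
  by apply: (congr1 (fun x => f Q * x)); symmetry; exact: evS.
have [D [j [jD w0]]] := sl_sum_weighted s1.
pose wL := GRing.isLinear.Build C W C *%R (weighted D j) (weighted_linear D j).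
pose lam : {linear W -> C | *%R} := HB.pack (weighted D j) wL.
have [P PE] := linear_functional_form lam p; have [S SE] := linear_functional_form lam s.
exists Q1, ((m - 2) * j)%N, P, S; split=> //.
- exact: weighted_invariant jD PE.
- exact: weighted_invariant jD SE.
- by rewrite SE.
move=> Q XQ; rewrite PE SE -(linearZ_LR lam); congr (lam _); apply: mxeval_unit_inj => A uA.
rewrite -evalf_subform ps // evalf_subform; symmetry; exact: mevalZ.
Qed.

End Reynolds.

(** * Binary cubics *)

Section BinaryCubics.
Variable R : realType.
Local Notation C := R[i].
Local Notation S := {mpoly C[2]}.
Local Notation X := (@Defs.nondegenerate C 2 3).
Local Notation x0 := (ord0 : 'I_2).
Local Notation x1 := (ord_max : 'I_2).

Lemma binary_form_expand (L : comNzRingType) d (p : {mpoly L[2]}) : p \is d.-homog ->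
  p = \sum_(i < d.+1) p@_(U_(x0) *+ i + U_(x1) *+ (d - i)) *: ('X_x0 ^+ i * 'X_x1 ^+ (d - i)).
Proof.
move=> hp; pose u i := (U_(x0) *+ i + U_(x1) *+ (d - i))%MM : 'X_{1..2}.
transitivity (\sum_(i < d.+1) p@_(u i) *: 'X_[L, u i]); last first.
  by apply: eq_bigr => i _; rewrite mpolyXD !mpolyXn.
have mdeg2 (a : 'X_{1..2}) : mdeg a = (a x0 + a x1)%N
  by rewrite mdegE big_ord_recr big_ord1 /=; congr (a _ + _)%N; exact: val_inj.
have u0 i : u i x0 = i by rewrite mnmDE !mulmnE !mnm1E /= ?mul0n ?muln0 ?mul1n ?addn0 ?add0n.
have u1 i : u i x1 = (d - i)%N by rewrite mnmDE !mulmnE !mnm1E /= ?mul0n ?muln0 ?mul1n ?addn0 ?add0n.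
apply/mpolyP => a; rewrite raddf_sum /=; have [ad|ad] := eqVneq (mdeg a) d; last first.
  rewrite (dhomog_nemf_coeff hp ad) big1 // => i _; rewrite mcoeffZ mcoeffX.
  case: eqP => [ua|_]; last exact: mulr0.
  by move: ad; rewrite -ua mdeg2 u0 u1 subnKC ?eqxx // -ltnS.
have au : a = u (a x0).
  apply/mnmP => i; have [->|->] : i = x0 \/ i = x1.
  - by case: i => -[|[|//]] hi; [left|right]; exact: val_inj.
  - by rewrite u0.
  - by rewrite u1 -ad mdeg2 addKn.
have a0 : (a x0 < d.+1)%N by rewrite ltnS -ad mdeg2 leq_addr.
rewrite (bigD1 (Ordinal a0)) //= -au mcoeffZ mcoeffX eqxx mulr1 big1 ?addr0 // => i ia.
rewrite mcoeffZ mcoeffX; case: eqP => [ua|_]; last exact: mulr0.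
by case/negP: ia; apply/eqP/val_inj; rewrite /= -ua u0.
Qed.

Lemma binary_cubic_expand (L : comNzRingType) (p : {mpoly L[2]}) : p \is 3.-homog ->
  let c i := p@_(U_(x0) *+ i + U_(x1) *+ (3 - i)) in
  p = c 0%N *: 'X_x1 ^+ 3 + c 1%N *: ('X_x0 * 'X_x1 ^+ 2) + c 2%N *: ('X_x0 ^+ 2 * 'X_x1) + c 3 *: 'X_x0 ^+ 3.
Proof.
move=> hp c; rewrite {1}(binary_form_expand hp) !big_ord_recr big_ord0 /= -/(c 0%N) -/(c 1%N) -/(c 2%N) -/(c 3).
by rewrite add0r mul1r mulr1.
Qed.

Lemma binary_form_eval (L : comNzRingType) d (p : {mpoly L[2]}) (v : 'I_2 -> L) : p \is d.-homog ->
  p.@[v] = \sum_(i < d.+1) p@_(U_(x0) *+ i + U_(x1) *+ (d - i)) * (v x0 ^+ i * v x1 ^+ (d - i)).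
Proof.
move=> hp; rewrite {1}(binary_form_expand hp) raddf_sum; apply: eq_bigr => i _.
by rewrite /= mevalZ rmorphM !rmorphXn /= !mevalXU.
Qed.

Lemma binary_form_eval_e0 (L : comNzRingType) d (p : {mpoly L[2]}) : p \is d.-homog ->
  p.@[fun i => (i == x0)%:R] = p@_(U_(x0) *+ d).
Proof.
move=> hp; rewrite (binary_form_eval _ hp) big_ord_recr /= subnn mulm0n addm0 expr1n expr0 !mulr1.
rewrite big1 ?add0r // => i _.
by rewrite (expr0n _ (_ - _)) subn_eq0 leqNgt ltn_ord !mulr0.
Qed.

Lemma binary_form_root d (p : S) : p \is d.+1.-homog ->
  exists2 v : 'I_2 -> C, v x0 != 0 \/ v x1 != 0 & p.@[v] = 0.
Proof.
move=> hp; set c := fun i => p@_(U_(x0) *+ i + U_(x1) *+ (d.+1 - i)).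
have pE v : p.@[v] = \sum_(i < d.+2) c i * (v x0 ^+ i * v x1 ^+ (d.+1 - i)).
  exact: binary_form_eval.
have [cd|cd] := eqVneq (c d.+1) 0.
  exists (fun i => (i == x0)%:R); first by left; rewrite oner_neq0.
  by rewrite (binary_form_eval_e0 hp) -[RHS]cd /c subnn mulm0n addm0.
have [|t /rootP t0] := @closed_rootP C (\poly_(i < d.+2) c i) _.
  by rewrite size_poly_eq.
exists (fun i => if i == x0 then t else 1); first by right; rewrite oner_neq0.
by rewrite pE -[RHS]t0 horner_poly; apply: eq_bigr => i _; rewrite /= expr1n mulr1.
Qed.

Lemma det_mx22 (L : comNzRingType) (A : 'M[L]_2) :
  \det A = A x0 x0 * A x1 x1 - A x0 x1 * A x1 x0.
Proof.
have e1 (i : 'I_1) : i = ord0 by rewrite ord1.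
rewrite (expand_det_row _ x0) big_ord_recr big_ord1 /= /cofactor !det_mx11 !mxE /= expr0 expr1 mul1r mulN1r mulrN.
by congr (A _ _ * A _ _ - A _ _ * A _ _); exact: val_inj.
Qed.

Definition cubic_normal_form : S := 'X_x0 ^+ 2 * 'X_x1 + 'X_x1 ^+ 3.

Lemma cubic_normal_form_homog : cubic_normal_form \is 3.-homog.
Proof.
have hX d i : ('X_i ^+ d : S) \is d.-homog.
  by rewrite mpolyXn dhomogX /= mdegMn mdeg1 mul1n.
by apply: rpredD => //; have := dhomogM (hX 2 x0) (hX 1 x1); rewrite expr1.
Qed.

Lemma cubic_normal_form_deriv (v : 'I_2 -> C) :
  (cubic_normal_form^`M(x0)).@[v] = 2 * v x0 * v x1 /\
  (cubic_normal_form^`M(x1)).@[v] = v x0 ^+ 2 + 3 * v x1 ^+ 2.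
Proof.
have E k : cubic_normal_form^`M(k) = (2 * (x0 == k))%:R *: ('X_x0 * 'X_x1) +
    (x1 == k)%:R *: 'X_x0 ^+ 2 + (3 * (x1 == k))%:R *: 'X_x1 ^+ 2.
  rewrite mderivD mderivM !deriv_varX -{2}(expr1 'X_x1) deriv_varX mul1n expr1 expr0.
  by rewrite -scalerAr mulr1 -scalerAl.
have x01 : (x0 == x1) = false by []. have x10 : (x1 == x0) = false by [].
rewrite !E !eqxx x01 x10 !muln0 !scale0r !addr0 !muln1 scale1r add0r.
split; first by rewrite mevalZ mevalM !mevalXU mulrA.
by rewrite !expr2 mevalD mevalZ !mevalM !mevalXU.
Qed.

Lemma double_root_degenerate (Q : Qform C 2 3) (L B : S) w : X Q ->
  (Q : S) = L * (L * B) -> L.@[w] = 0 -> forall j, w j = 0.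
Proof.
move=> XQ QE Lw; apply: XQ => j; rewrite QE mderivM mevalD !mevalM mderivM mevalD !mevalM.
by rewrite Lw !(mul0r, mulr0, addr0).
Qed.

(** The cubic is y times a quadratic form. Nondegeneracy excludes a = 0 and a double root, and
    completing the square gives a y((x + ey)^2 + t^2 y^2) with t nonzero. *)
Lemma cubic_normalize (Q : Qform C 2 3) a b c : X Q ->
  (Q : S) = c *: 'X_x1 ^+ 3 + b *: ('X_x0 * 'X_x1 ^+ 2) + a *: ('X_x0 ^+ 2 * 'X_x1) ->
  exists u k, [/\ u \in unitmx, k != 0 & (Q : S) = k *: sub u cubic_normal_form].
Proof.
move=> XQ QE; have a0 : a != 0.
  apply/eqP => c2; have /eqP := oner_neq0 C; apply.
  apply: (double_root_degenerate (L := 'X_x1) (B := c *: 'X_x1 + b *: 'X_x0) (w := fun i => (i == x0)%:R) XQ _ _ x0).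
    2: by rewrite mevalXU.
  rewrite QE c2 scale0r addr0 -!mul_mpolyC.
  have id (A : comNzRingType) (x y p q : A) : p * y ^+ 3 + q * (x * y ^+ 2) = y * (y * (p * y + q * x)) by ring.
  exact: id.
pose e := b / (2 * a); pose t := sqrtC (c / a - e ^+ 2).
have c1E : b = 2 * a * e by rewrite /e mulrC divfK // mulf_neq0 // pnatr_eq0.
have c0E : c = a * (t ^+ 2 + e ^+ 2) by rewrite sqrtCK subrK mulrC divfK.
have t0 : t != 0.
  apply/eqP => t0; have /eqP := oner_neq0 C; apply.
  apply: (double_root_degenerate (L := 'X_x0 + e *: 'X_x1) (B := a *: 'X_x1)
    (w := fun i => if i == x0 then - e else 1) XQ _ _ x1).
    2: by rewrite mevalD mevalZ !mevalXU /= mulr1 addNr.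
  rewrite QE c0E c1E t0 expr0n add0r; clearbody e; clear.
  rewrite -!mul_mpolyC !rmorphM /=.
  rewrite rmorph_nat.
  have id (A : comNzRingType) (x y p q : A) : p * q ^+ 2 * y ^+ 3 + 2 * p * q * (x * y ^+ 2) + p * (x ^+ 2 * y) =
    (x + q * y) * ((x + q * y) * (p * y)) by ring.
  exact: id.
pose u : 'M[C]_2 := \matrix_(i, j) (if i == x0 then if j == x0 then 1 else e else if j == x0 then 0 else t).
have uu : u \in unitmx by rewrite unitmxE unitfE det_mx22 !mxE /= mulr0 subr0 mul1r.
have k0 : a / t != 0 by rewrite mulf_neq0 ?invr_eq0.
exists u, (a / t); split=> //.
have aE : a = a / t * t by rewrite divfK.
move: (a / t) aE => k aE; rewrite QE c0E c1E aE /= /cubic_normal_form rmorphD rmorphM !rmorphXn /= !subX.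
rewrite !big_ord_recl !big_ord0 !mxE /= scale1r scale0r add0r !addr0.
have -> : lift ord0 ord0 = x1 :> 'I_2 by exact: val_inj.
rewrite -!mul_mpolyC !rmorphM rmorphD !rmorphM /= rmorph_nat.
have id (A : comNzRingType) (x y k' t' e' : A) : k' * t' * (t' ^+ 2 + e' ^+ 2) * y ^+ 3 +
    2 * (k' * t') * e' * (x * y ^+ 2) + k' * t' * (x ^+ 2 * y) =
  k' * ((x + e' * y) ^+ 2 * (t' * y) + (t' * y) ^+ 3) by ring.
exact: id.
Qed.

Lemma binary_cubic_orbit (f : Qform C 2 3 -> C) : GL_invariant f ->
  exists c, forall Q, X Q -> f Q = c.
Proof.
move=> finv; pose Q0 : Qform C 2 3 := DHomog cubic_normal_form_homog.
have orbit := @invariant_orbit R 2 3 (leqnn 3) f finv.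
have two_ind (P : 'I_2 -> Prop) : P x0 -> P x1 -> forall i, P i.
  by move=> P0 P1 i; have [->|->] : i = x0 \/ i = x1 by case: i => -[|[|//]] hi; [left|right]; exact: val_inj.
have XQ0 : X Q0.
  move=> z gz; have [E0 E1] := cubic_normal_form_deriv z.
  have /esym/eqP := E0; rewrite gz !mulf_eq0 pnatr_eq0 /= => zz.
  move: E1; rewrite gz; case/orP: zz => /eqP z0; rewrite z0.
    rewrite expr0n add0r => /esym/eqP; rewrite mulf_eq0 pnatr_eq0 expf_eq0 /= => /eqP z1.
    exact: two_ind.
  rewrite expr0n mulr0 addr0 => /esym/eqP; rewrite expf_eq0 /= => /eqP z1.
  exact: two_ind.
exists (f Q0) => Q XQ; have [v v0 Qv] := binary_form_root (dhomog_is_dhomog Q).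
(* The first column moves the zero v to the first unit vector; the second is a unit vector that
   keeps M invertible. *)
pose M : 'M[C]_2 := \matrix_(i, j) (if j == x0 then v i else if v x0 == 0 then (i == x0)%:R else (i == x1)%:R).
have uM : M \in unitmx.
  rewrite unitmxE unitfE det_mx22 !mxE /=.
  have [E0|E0] := eqVneq (v x0) 0; rewrite ?mulr0 ?mul0r ?sub0r ?subr0 ?mulr1 ?mul1r ?oppr_eq0 //=.
  by case: v0; rewrite ?E0 ?eqxx.
pose Q1 := subform M Q.
have [XQ1 <-] : X Q1 /\ f Q1 = f Q by apply: (orbit _ _ M 1 XQ uM (oner_neq0 _)); rewrite scale1r.
pose c i := (Q1 : S)@_(U_(x0) *+ i + U_(x1) *+ (3 - i)).
have Q1v : (Q1 : S).@[fun i => (i == x0)%:R] = 0.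
  rewrite /= sub_meval -[RHS]Qv; apply: meval_eq => i.
  by rewrite big_ord_recl big_ord1 !mxE /= mulr1 mulr0 addr0.
have c3 : c 3 = 0.
  by rewrite -Q1v (binary_form_eval_e0 (dhomog_is_dhomog Q1)) /c subnn mulm0n addm0.
have Q1E : (Q1 : S) = c 0%N *: 'X_x1 ^+ 3 + c 1%N *: ('X_x0 * 'X_x1 ^+ 2) + c 2%N *: ('X_x0 ^+ 2 * 'X_x1).
  have E1 := binary_cubic_expand (dhomog_is_dhomog Q1); cbv zeta in E1.
  rewrite -/(c 3) c3 scale0r addr0 in E1; exact: E1.
have [u [k [uu k0 Q1E2]]] := cubic_normalize XQ1 Q1E.
by have [_ ->] := orbit Q0 Q1 u k XQ0 uu k0 Q1E2.
Qed.

End BinaryCubics.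

(** * The pullback *)

Lemma invariant_pullback (R : realType) n m (n_ge2 : (2 <= n)%N) (m_ge3 : (3 <= m)%N)
    (f : Qform R[i] n m -> R[i]) : regular_function f -> GL_invariant f ->
  exists Q1 l P S, [/\ Defs.nondegenerate Q1, relative_invariant l P, relative_invariant l S,
    evalf S (Phi m_ge3 Q1) != 0 &
    forall Q, Defs.nondegenerate Q -> evalf P (Phi m_ge3 Q) = f Q * evalf S (Phi m_ge3 Q)].
Proof.
move=> f_regular f_invariant; have [nm|] := boolP ((3 < m)%N || (2 < n)%N).
  exact: invariant_quotient.
rewrite negb_or -!leqNgt => /andP[m_le3 n_le2].
have nE : n = 2 by apply/eqP; rewrite eqn_leq n_le2.
have mE : m = 3 by apply/eqP; rewrite eqn_leq m_le3.
subst n m; have [c fc] := binary_cubic_orbit f_invariant.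
exists (DHomog (base_form_homog 2 3 R[i])), 0%N, c%:MP, 1.
have ev1 B : evalf (1 : formpoly R[i] 2 (2 * (3 - 2))) B = 1 by exact: meval1.
split.
- by move=> z; apply: base_form_nondegenerate.
- by move=> Q A _; rewrite expr0 mul1r /evalf !mevalC.
- by move=> Q A _; rewrite expr0 mul1r !ev1.
- by rewrite ev1 oner_eq0.
- by move=> Q XQ; rewrite ev1 mulr1 fc // /evalf mevalC.
Qed.

Theorem theorem4p1 (R : realType) (n m : nat) (n_ge2 : (2 <= n)%N)
    (m_ge3 : (3 <= m)%N) (f : Qform R[i] n m -> R[i])
    (f_regular : regular_function f) (f_invariant : GL_invariant f) :
  exists r : formrat R[i] n (n * (m - 2)),
    absolute_invariant r /\ comp_Phi_coincides m_ge3 r f.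
Proof.
have [Q1 [l [P [S [XQ1 invP invS S1 PS]]]]] := invariant_pullback n_ge2 m_ge3 f_regular f_invariant.
have nz (T : formpoly R[i] n (n * (m - 2))) B : evalf T B != 0 -> T != 0.
  by apply: contraNneq => ->; rewrite /evalf meval0.
have S0 := nz _ _ S1; exists (tofrac P / tofrac S); split; first by exists l, P, S.
split; first by exists Q1 => //; exists (evalf P (Phi m_ge3 Q1) / evalf S (Phi m_ge3 Q1)), P, S.
move=> Q c XQ [P' [S' [/eqP + SQ ->]]]; rewrite eqr_div ?tofrac_eq0 ?S0 ?(nz _ _ SQ) //.
rewrite -!rmorphM tofrac_eq => /eqP PE.
have regPhi := @Phi_evalf_regular R n m n_ge2 m_ge3.
have null := @nondegenerate_fin R n m.
pose g T (Q : Qform R[i] n m) := evalf T (@Phi R[i] n m m_ge3 Q).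
(* Equal fractions give P S' = P' S, but S may vanish at Phi(Q) and cannot be cancelled there. Since
   it does not vanish at Phi(Q1), irreducibility yields f S' = P' at every Phi(Q). *)
pose h Q := f Q * g S' Q + -1 * g P' Q.
have reg : regular_function h.
  apply: regularD; first exact: (regularM f_regular (regPhi S')).
  exact: (regularM (@regular_const n m R[i] (-1)) (regPhi P')).
have hS Q2 : Defs.nondegenerate Q2 -> h Q2 * g S Q2 = 0.
  move=> XQ2; have : g (P * S') Q2 = g (P' * S) Q2 by rewrite PE.
  have gM T T' : g (T * T') Q2 = g T Q2 * g T' Q2 by exact: mevalM.
  rewrite !gM [g P Q2]PS // -/(g S Q2) => E.
  by rewrite /h mulrDl mulN1r mulNr -E mulrAC subrr.
have h0 : h Q = 0.
  exact: (@regular_mul_eq0 n m R[i] (@complex_char0 R) null h (g S) reg (regPhi S) hS (ex_intro2 _ _ _ XQ1 S1) Q XQ).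
move/eqP: h0; rewrite /h mulN1r subr_eq0 -/(g P' Q) -/(g S' Q) => /eqP <-; exact: esym (mulfK SQ _).
Qed.
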